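(* Let $w$ be a weight on $\mathbb{R}^N$ with $\|w\|_{A_2}<\infty$ and let $\sigma:=w^{-1}$. Let $m\in\mathbb{Z}$ be fixed. Let $T$ be a bounded linear operator on $L^2(w)$, and let $f\in L^2(w)$ and $g\in L^2(\sigma)$ be compactly supported. With $T_{JI}:=\langle \mathbb{D}_J g,T\mathbb{D}_I f\rangle$, $$\begin{aligned} \langle g,Tf\rangle\cdot\pi_{\mathrm{good}}^2 &=\lim_{n\to\infty}\mathbb{E}_{\beta}\Big[\sum_{\substack{I,J\in\mathscr{D}^0\\ \ell(J)\ge\ell(I)}}^{n} T_{J\dot+\beta,I\dot+\beta}\;\mathbb{E}_\beta\big[1_{\mathrm{good}(\beta)}(I\dot+\beta)\,\big|\,\beta_j:2^{-j}<\ell(J)\big]\;1_{\mathrm{good}(\beta)}(J\dot+\beta)\\ &\qquad\qquad+\sum_{\substack{I,J\in\mathscr{D}^0\\ \ell(J)<\ell(I)}}^{n} T_{J\dot+\beta,I\dot+\beta}\;1_{\mathrm{good}(\beta)}(I\dot+\beta)\;\mathbb{E}_\beta\big[1_{\mathrm{good}(\beta)}(J\dot+\beta)\,\big|\,\beta_j:2^{-j}<\ell(I)\big]\Big]\\ &=\lim_{n\to\infty}\mathbb{E}_\beta\sum^{n}_{(I,J)}\langle\mathbb{D}_J g,T\mathbb{D}_I f\rangle\cdot\pi_{IJ}, \end{aligned}$$ where the last sum is over pairs $I,J\in\mathscr{D}^\beta$ such that $J$ is good if $\ell(J)\ge\ell(I)$, $I$ is good if $\ell(I)>\ell(J)$,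 and the pair $(I,J)$ is good; and $\pi_{IJ}\in[0,1]$ are the values of the conditional probabilities on the previous lines after reindexing the summation in terms of $\mathscr{D}^\beta$ (that is, for $I',J'\in\mathscr{D}^0$, $\pi_{I'\dot+\beta,J'\dot+\beta}$ is the conditional expectation in the first sum if $\ell(J')\ge\ell(I')$, and the one in the second sum if $\ell(J')<\ell(I')$).
   Context: A weight is a function $w\in L^1_{\mathrm{loc}}(\mathbb{R}^N)$, positive a.e.; $\|w\|_{A_2}:=\sup_Q\frac1{|Q|}\int_Qw\cdot\frac1{|Q|}\int_Qw^{-1}$ over all cubes $Q$. The pairing is the unweighted one, $\langle g,h\rangle=\int_{\mathbb{R}^N} g h\,dx$. Dyadic systems: $\mathscr{D}^0:=\bigcup_{k\in\mathbb{Z}}\mathscr{D}^0_k$, $\mathscr{D}^0_k:=\{2^{-k}([0,1)^N+m'):m'\in\mathbb{Z}^N\}$. For $\beta=(\beta_j)_{j\in\mathbb{Z}}\in(\{0,1\}^N)^{\mathbb{Z}}$ and $I\in\mathscr{D}^0_k$, $I\dot+\beta:=I+\sum_{j>k}\beta_j2^{-j}$; $\mathscr{D}^\beta_k:=\{I\dot+\beta:I\in\mathscr{D}^0_k\}$ and $\mathscr{D}^\beta:=\bigcup_k\mathscr{D}^\beta_k$. $\ell(I)$ is the side length of $I$. The children $\operatorname{ch}(I)$ of $I=x+[0,\ell)^N$ are the cubes $x+\eta\ell/2+[0,\ell/2)^N$, $\eta\in\{0,1\}^N$. Randomness: $\beta$ is random with the $\beta_j$ independent and uniformly distributed on $\{0,1\}^N$;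 $\mathbb{E}_\beta$ is the expectation, and $\mathbb{E}_\beta[\,\cdot\,|\beta_j:j\in\mathscr{J}]$ the conditional expectation given $\beta_j$, $j\in\mathscr{J}$. Martingale differences: $\mathbb{E}_If:=1_I\frac1{|I|}\int_If\,dx$, and $\mathbb{D}_If:=\sum_{I'\in\operatorname{ch}(I)}\mathbb{E}_{I'}f-\mathbb{E}_If$ if $\ell(I)\neq2^{-m}$. By convention, for cubes with $\ell(I)=2^{-m}$ the symbol $\mathbb{D}_I$ stands for the sum of this operator and $\mathbb{E}_I$, i.e. $\mathbb{D}_If:=\sum_{I'\in\operatorname{ch}(I)}\mathbb{E}_{I'}f$. The notation $\sum^n$ means that the summation is restricted to cubes (here both $I$ and $J$) of side length in $(2^{-n},2^{-m}]$. Goodness: fix $\gamma\in(0,\tfrac12)$ and $r\in\mathbb{Z}_+$. A cube $I\in\mathscr{D}=\mathscr{D}^\beta$ is bad if there is $J\in\mathscr{D}$ with $\ell(J)\ge2^r\ell(I)$ and $\operatorname{dist}(I,\partial J)\le\ell(I)^\gamma\ell(J)^{1-\gamma}$; otherwise it is good. $1_{\mathrm{good}(\beta)}(I\dot+\beta)$ equals $1$ if $I\dot+\beta$ is good in $\mathscr{D}^\beta$ and $0$ otherwise. A pair $(I,J)\in\mathscr{D}\times\mathscr{D}$ is good if the smaller of the two cubes, say $I$, satisfies $\operatorname{dist}(I,\partial K)>\ell(I)^\gamma\ell(K)^{1-\gamma}$ for all $K\in\mathscr{D}$ with $2^r\ell(I)\le\ell(K)\le\ell(J)$ (trivially true if $\ell(J)<2^r\ell(I)$).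 The probability $\pi_{\mathrm{good}}:=\mathbb{E}_\beta[1_{\mathrm{good}(\beta)}(I\dot+\beta)]$ does not depend on $I\in\mathscr{D}^0$, only on $r,\gamma,N$; $r$ is fixed large enough that $\pi_{\mathrm{good}}>0$. *)

(* Defs.v *)
From HB Require Import structures.
From mathcomp Require Import all_boot all_order all_algebra.
From mathcomp Require Import all_classical all_reals all_analysis.

Set Implicit Arguments.
Unset Strict Implicit.
Unset Printing Implicit Defensive.

Import Order.TTheory GRing.Theory Num.Theory.
Import numFieldNormedType.Exports.

Local Open Scope classical_set_scope.
Local Open Scope ring_scope.

(* R^N carries the product of the Borel sigma-algebras of the factors. *)
Notation Rn R N := (N.-tuple (measurableTypeR R)).

Definition tcons (R : realType) n (p : measurableTypeR R * Rn R n) :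
    Rn R n.+1 := [tuple of p.1 :: p.2].

Lemma measurable_tcons (R : realType) n :
  measurable_fun [set: measurableTypeR R * Rn R n] (@tcons R n).
Proof. exact: measurable_cons. Qed.

Definition tuncons (R : realType) n (t : Rn R n.+1) :
    measurableTypeR R * Rn R n := (thead t, [tuple of behead t]).

Lemma measurable_tuncons (R : realType) n :
  measurable_fun [set: Rn R n.+1] (@tuncons R n).
Proof.
apply/measurable_fun_pair; first exact: measurable_tnth.
exact: measurable_behead.
Qed.

Lemma tconsK (R : realType) n : cancel (@tcons R n) (@tuncons R n).
Proof. by case=> x t; congr pair; apply: val_inj. Qed.

Section leb_step.
Local Open Scope ereal_scope.
Context (R : realType) (n : nat).
Variable mu : {sigma_finite_measure set (Rn R n) -> \bar R}.

Definition leb_step : set (Rn R n.+1) -> \bar R :=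
  pushforward (@lebesgue_measure R \x mu) (@tcons R n).

Let lambda : {sigma_finite_measure set (measurableTypeR R) -> \bar R} :=
  @lebesgue_measure R.

Let measurable_preimage A :
  measurable A -> measurable (@tcons R n @^-1` A).
Proof. by move=> mA; rewrite -[X in measurable X]setTI; exact: measurable_tcons. Qed.

Let leb_step0 : leb_step set0 = 0.
Proof. by rewrite /leb_step /pushforward preimage_set0 measure0. Qed.

Let leb_step_ge0 A : 0 <= leb_step A.
Proof. by rewrite /leb_step /pushforward; exact: measure_ge0. Qed.

Let leb_step_sigma_additive : semi_sigma_additive leb_step.
Proof.
move=> F mF tF mUF; rewrite /leb_step /pushforward preimage_bigcup.
apply: measure_semi_sigma_additive.
- by move=> k; exact: measurable_preimage.
- apply/trivIsetP => /= i j _ _ ij; rewrite -preimage_setI.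
  by move/trivIsetP : tF => /(_ _ _ _ _ ij) ->//; rewrite preimage_set0.
- by rewrite -preimage_bigcup; exact: measurable_preimage.
Qed.

HB.instance Definition _ := isMeasure.Build _ _ _
  leb_step leb_step0 leb_step_ge0 leb_step_sigma_additive.

Let leb_step_sigma_finite : sigma_finite setT leb_step.
Proof.
have /sigma_finiteP[F [TF ndF Foo]] := sigma_finiteT lambda.
have /sigma_finiteP[G [TG ndG Goo]] := sigma_finiteT mu.
exists (fun k => @tuncons R n @^-1` (F k `*` G k)).
  rewrite -preimage_bigcup -[LHS](preimage_setT (@tuncons R n)); congr preimage.
  rewrite -setXTT TF TG predeqE => -[x y]; split => [[[i _ Fix] [j _ Gjy]]|].
    exists (maxn i j) => //; split.
    - by apply: (subsetPset _ _ (ndF _ _ _)) Fix; exact: leq_maxl.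
    - by apply: (subsetPset _ _ (ndG _ _ _)) Gjy; exact: leq_maxr.
  by move=> [k _ [Fkx Gky]]; split; exists k.
move=> k; have [mF Fk] := Foo k; have [mG Gk] := Goo k; split.
  rewrite -[X in measurable X]setTI; apply: measurable_tuncons => //.
  exact: measurableX.
rewrite /leb_step /pushforward -comp_preimage.
have -> : @tuncons R n \o @tcons R n = id by exact/funext/tconsK.
by rewrite preimage_id product_measure1E// lte_mul_pinfty// ge0_fin_numE.
Qed.

HB.instance Definition _ :=
  Measure_isSigmaFinite.Build _ _ _ leb_step leb_step_sigma_finite.

End leb_step.

(* Lebesgue measure on R^N, as an iterated product measure. *)
Fixpoint leb (R : realType) N : {sigma_finite_measure set (Rn R N) -> \bar R} :=
  match N return {sigma_finite_measure set (Rn R N) -> \bar R} with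
  | 0%N => \d_([tuple] : Rn R 0)
  | n.+1 => leb_step (leb R n)
  end.

Section geometry.
Context {R : realType} {N : nat}.
Implicit Types (A B : set (Rn R N)) (f g h w : Rn R N -> R).

Definition coor (x : Rn R N) (i : 'I_N) : R := tnth x i.

Definition eucl_dist (x y : Rn R N) : R :=
  Num.sqrt (\sum_(i < N) (coor x i - coor y i) ^+ 2).

Definition setdist A B : R :=
  inf [set d | exists x y, [/\ A x, B y & d = eucl_dist x y]].

Definition frontier A : set (Rn R N) :=
  [set y | forall e, 0 < e -> (exists2 x, A x & eucl_dist x y < e) /\
                              (exists2 x, ~ A x & eucl_dist x y < e)].

(* The pair (x, l) encodes the cube x + [0, l)^N. *)
Definition cube : Type := (Rn R N * R)%type.
Implicit Types (Q K : cube).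

Definition corner Q : Rn R N := Q.1.
Definition side Q : R := Q.2.
Definition cube_set Q : set (Rn R N) :=
  [set y | forall i, coor (corner Q) i <= coor y i < coor (corner Q) i + side Q].

Definition child Q (e : N.-tuple bool) : cube :=
  ([tuple coor (corner Q) i + (tnth e i)%:R * (side Q / 2) | i < N],
   side Q / 2).

Definition weight w : Prop :=
  [/\ measurable_fun setT w,
      forall Q, 0 < side Q -> (leb R N).-integrable (cube_set Q) (EFin \o w)
    & {ae leb R N, forall x, 0 < w x}].

Definition A2_char w : \bar R :=
  ereal_sup [set a | exists2 Q, 0 < side Q &
    a = (((fine (leb R N (cube_set Q)))^-1)%:E *
           (\int[leb R N]_(x in cube_set Q) (w x)%:E) *
        (((fine (leb R N (cube_set Q)))^-1)%:E *
           (\int[leb R N]_(x in cube_set Q) ((w x)^-1)%:E)))%E].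

Definition L2norm w f : \bar R :=
  ((\int[leb R N]_x (`|f x| ^+ 2 * w x)%:E) `^ 2^-1)%E.

Definition L2 w f : Prop := measurable_fun setT f /\ (L2norm w f < +oo)%E.

(* Operators act on representatives.  Linearity together with the norm bound
   makes T compatible with equality almost everywhere; the values of T outside
   L2 w are irrelevant. *)
Definition bounded_linear_L2 w (T : (Rn R N -> R) -> (Rn R N -> R)) : Prop :=
  [/\ forall f, L2 w f -> L2 w (T f),
      forall (a : R) f h, L2 w f -> L2 w h ->
        {ae leb R N, forall x, T (fun y => a * f y + h y) x = a * T f x + T h x}
    & exists C : R, forall f, L2 w f ->
        (L2norm w (T f) <= C%:E * L2norm w f)%E].

Definition compactly_supported f : Prop :=
  exists M : R, {ae leb R N, forall x, (exists i, M < `|coor x i|) -> f x = 0}.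

Definition pairing g h : R := \int[leb R N]_x (g x * h x).

Definition cube_avg f Q : Rn R N -> R := fun x =>
  \1_(cube_set Q) x *
    ((fine (leb R N (cube_set Q)))^-1 * \int[leb R N]_(y in cube_set Q) f y).

(* Side length 2^-m is the coarsest level considered: there the operator also
   includes the average over the cube itself. *)
Definition mart_diff (m : int) f Q : Rn R N -> R := fun x =>
  if side Q == 2 ^ (- m) then
    \sum_(e : N.-tuple bool) cube_avg f (child Q e) x
  else \sum_(e : N.-tuple bool) cube_avg f (child Q e) x - cube_avg f Q x.

(* If f and g are compactly supported, then only finitely many pairs of cubes of
   a dyadic system with side lengths in a bounded range (2^-n, 2^-m] have a
   nonzero coefficient, so finitely supported sums of these are the full sums. *)
Definition Tcoef (T : (Rn R N -> R) -> (Rn R N -> R)) (m : int) f g J I : R :=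
  pairing (mart_diff m g J) (T (mart_diff m f I)).

End geometry.
Arguments cube : clear implicits.

Section dyadic_systems.
Context {R : realType} {N : nat}.

(* The pair (k, m') encodes the cube 2^-k ([0, 1)^N + m'). *)
Definition dyadic : Type := (int * N.-tuple int)%type.
Definition bits : Type := int -> N.-tuple bool.
Implicit Types (I J : dyadic) (b : bits) (Q K : cube R N).

Definition dside I : R := 2 ^ (- I.1).

(* The i-th coordinate of the sum of beta_j 2^-j over j > k. *)
Definition bit_shift (k : int) b (i : 'I_N) : R :=
  limn (series (fun p : nat =>
    (tnth (b (k + p.+1%:Z)) i)%:R * 2 ^ (- (k + p.+1%:Z)) : R)).

Definition dshift I b : cube R N :=
  ([tuple dside I * (tnth I.2 i)%:~R + bit_shift I.1 b i | i < N],
   dside I).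

Definition dsys b : set (cube R N) := range (dshift ^~ b).

Variables (r : nat) (gamma : R).

Definition close_to_frontier Q K : Prop :=
  setdist (cube_set Q) (frontier (cube_set K)) <=
    side Q `^ gamma * side K `^ (1 - gamma).

Definition good b : set (cube R N) :=
  [set Q | dsys b Q /\
    ~ exists K, [/\ dsys b K, 2 ^+ r * side Q <= side K &
                    close_to_frontier Q K]].

Definition good_wrt b Q K0 : Prop :=
  forall K, dsys b K -> 2 ^+ r * side Q <= side K <= side K0 ->
    ~ close_to_frontier Q K.

Definition good_pair b Q K : Prop :=
  if side Q <= side K then good_wrt b Q K else good_wrt b K Q.

Definition side_range (m : int) (n : nat) (l : R) : Prop :=
  2 ^ (- n%:Z) < l <= 2 ^ (- m).

End dyadic_systems.
Arguments dyadic : clear implicits.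
Arguments bits : clear implicits.
Arguments dside R {N} I.

Section randomness.
Context d {Omega : measurableType d} {R : realType} (P : probability Omega R).

(* Y is a version of the conditional expectation of X given the sigma-algebra G. *)
Definition is_cond_exp (G : set (set Omega)) (X Y : Omega -> R) : Prop :=
  [/\ forall B : set R, measurable B -> G (Y @^-1` B),
      P.-integrable setT (EFin \o Y)
    & forall A, G A ->
        (\int[P]_(x in A) (Y x)%:E = \int[P]_(x in A) (X x)%:E)%E].

Context {N : nat} (beta : int -> {RV P >-> N.-tuple bool}).

Definition uniform_bits : Prop :=
  forall j e, P (beta j @^-1` [set e]) = ((2 ^+ N)^-1)%:E.

Definition independent_bits : Prop :=
  forall (s : seq int) (A : int -> set (N.-tuple bool)),
    uniq s -> (forall j, measurable (A j)) ->
    P (\bigcap_(j in [set` s]) beta j @^-1` A j) =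
    (\prod_(j <- s) P (beta j @^-1` A j))%E.

Definition sigma_bits (S : set int) : set (set Omega) :=
  <<s [set A | exists2 j, S j & exists2 B, measurable B & A = beta j @^-1` B] >>.

Definition bits_of (om : Omega) : bits N := fun j => beta j om.

Definition one_good (r : nat) (gamma : R) (I : dyadic N) (om : Omega) : R :=
  \1_(good r gamma (bits_of om)) (dshift I (bits_of om)).

Definition pi_good (r : nat) (gamma : R) (I : dyadic N) : R :=
  fine 'E_P[one_good r gamma I].

End randomness.

(* Main.v *)
Require Import Defs.
From mathcomp Require Import all_boot all_order all_algebra finmap.
From mathcomp Require Import all_classical all_reals all_analysis measurable_realfun.
From mathcomp Require Import ring lra zify.

Set Implicit Arguments.
Unset Strict Implicit.
Unset Printing Implicit Defensive.

Import Order.TTheory GRing.Theory Num.Theory.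
Import numFieldNormedType.Exports HBNNSimple.

Local Open Scope classical_set_scope.
Local Open Scope ring_scope.

(** Write E_n h for the sum of the averages of h over the cubes of generation n
    of the random system, and t_JI for the coefficient of the pair (J, I).  Summed
    over the generations from m to n - 1, the martingale differences telescope to
    E_n, so that without any goodness the double sum of the t_JI is
    <E_n g, T E_n f>.  For an A2 weight the operators E_n are uniformly bounded on
    L^2(w) (sqnorm_level_avg) and converge strongly to the identity
    (recovered_supported, level_avg_cvg); the same holds for the dual weight, and
    <E_n g, T E_n f> tends to <g, T f> boundedly (total_cvg).  It remains to see
    that inserting the goodness factors multiplies the expectation by the square
    of the probability pi of being good.

    A cube of generation k has a position that depends on the bits j > k, whereas
    its goodness depends on the bits j <= k.  For a pair with J the larger cube,
    goodness of J is thus independent of t_JI and of the conditional probability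
    that I is good given the bits j > J.1, and can be replaced by pi; after that
    the conditional probability can be replaced by the goodness of I, since t_JI
    is measurable with respect to the bits conditioned upon.  The coefficient t_JI
    is however not independent of the goodness of the smaller cube I.  But the sum
    of t_JI over all J is <E_n g, T D_I f>, which does not depend on the positions
    of the cubes larger than I; it is independent of the goodness of I, and so are
    the terms in which J is smaller than I.  Subtraction gives the second factor
    pi for the sum over the larger J (sum_good_finer, Ex_weighted_sum).

    All expectations are reduced to finitely many bits: a function of the bits is
    called tame if it is a bounded limit of functions of finitely many of them.
    Goodness is tame because each generation of larger cubes is tested separately
    (tame_good_ind), and t_JI is tame because truncating the expansion of the shift
    moves the cubes by a small amount (tame_pairing).  The probability of being
    good is the same for all cubes, because random digits translate a cube
    uniformly relative to the larger grids (Ex_periodic, Ex_good_ind).  The given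
    versions of the conditional expectations agree almost surely with averages
    over the bits that are not conditioned upon (cond_exp_cond_avg).

    In the second form of the sum the pairs that are not good are left out.  This
    costs nothing: for such a pair the conditional probability that the smaller
    cube is good is zero (cond_good_bad_pair). *)

(** * Dyadic cubes and their random shifts *)

Section shifts.
Context {R : realType} {N : nat}.
Implicit Types (b : bits N) (k : int) (x y : Rn R N) (i : 'I_N).

Lemma pow2_gt0 (z : int) : 0 < 2 ^ z :> R.
Proof. by rewrite exprz_gt0. Qed.

Lemma pow2_neq0 (z : int) : 2 ^ z != 0 :> R.
Proof. by rewrite lt0r_neq0// pow2_gt0. Qed.

Lemma pow2D (y z : int) : 2 ^ (y + z) = 2 ^ y * 2 ^ z :> R.
Proof. by rewrite expfzDr// pnatr_eq0. Qed.

Lemma pow2N (z : int) : 2 ^ (- z) = (2 ^ z)^-1 :> R.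
Proof. by rewrite invr_expz. Qed.

Lemma pow2_half k : 2 ^ (- k) = 2 ^ (- (k + 1)) + 2 ^ (- (k + 1)) :> R.
Proof.
have -> : - k = - (k + 1) + 1 by lia.
by rewrite pow2D expr1z -mulr2n mulr_natr.
Qed.

Lemma ltr_pow2 (y z : int) : (2 ^ y < 2 ^ z :> R) = (y < z).
Proof. by rewrite ltr_eXz2l// ltr1n. Qed.

Lemma ler_pow2 (y z : int) : (2 ^ y <= 2 ^ z :> R) = (y <= z).
Proof. by rewrite ler_eXz2l// ltr1n. Qed.

Lemma pow2_inj : injective (fun z : int => 2 ^ z : R).
Proof.
move=> y z /= /eqP; rewrite eq_le !ler_pow2 => /andP[yz zy].
by apply/eqP; rewrite eq_le yz zy.
Qed.

Lemma pow2_small (k : int) (e : R) : 0 < e -> \forall n \near \oo, 2 ^ (- (k + n%:Z)) < e.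
Proof.
move=> e0; have : ((2^-1 : R) ^+ n @[n --> \oo] --> 0).
  by apply: cvg_expr; rewrite ger0_norm ?invr_ge0// invf_lt1// ltr1n.
move/cvgrPdist_lt => /(_ (e * 2 ^ k)) /(_ (mulr_gt0 e0 (pow2_gt0 _))).
apply: filterS => n; rewrite sub0r normrN ger0_norm ?exprn_ge0 ?invr_ge0// => h.
rewrite opprD pow2D mulrC pow2N -exprnP -exprVn.
by rewrite pow2N ltr_pdivrMr ?pow2_gt0.
Qed.

Definition bit_term k b i (p : nat) : R :=
  (tnth (b (k + p.+1%:Z)) i)%:R * 2 ^ (- (k + p.+1%:Z)).

Lemma bit_term_ge0 k b i p : 0 <= bit_term k b i p.
Proof. by rewrite mulr_ge0// ltW// pow2_gt0. Qed.

Lemma series_bit_term_le k b i n :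
  series (bit_term k b i) n <= 2 ^ (- k) - 2 ^ (- (k + n%:Z)).
Proof.
elim: n => [|n ih]; first by rewrite /series/= big_geq// addr0 subrr.
rewrite seriesSr; set u := bit_term _ _ _ _.
have : u <= 2 ^ (- (k + n.+1%:Z)).
  by rewrite /u /bit_term ler_piMl ?(ltW (pow2_gt0 _))//; case: (tnth _ _).
have : 2 ^ (- (k + n%:Z)) = 2 ^ (- (k + n.+1%:Z)) + 2 ^ (- (k + n.+1%:Z)) :> R.
  by rewrite pow2_half; congr (2 ^ _ + 2 ^ _); lia.
by lra.
Qed.

Lemma bit_shift_is_cvg k b i : cvgn (series (bit_term k b i)).
Proof.
apply: nondecreasing_is_cvgn.
  by apply: nondecreasing_series => p _ _; exact: bit_term_ge0.
exists (2 ^ (- k)) => _ [n _ <-]; apply: (le_trans (series_bit_term_le _ _ _ _)).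
by rewrite gerBl// ltW// pow2_gt0.
Qed.

Lemma bit_shift_ge0 k b i : 0 <= bit_shift k b i :> R.
Proof.
apply: limr_ge; first exact: bit_shift_is_cvg.
by apply: nearW => n; apply: sumr_ge0 => p _; exact: bit_term_ge0.
Qed.

Lemma bit_shift_le k b i : bit_shift k b i <= 2 ^ (- k) :> R.
Proof.
apply: limr_le; first exact: bit_shift_is_cvg.
apply: nearW => n; apply: (le_trans (series_bit_term_le _ _ _ _)).
by rewrite gerBl// ltW// pow2_gt0.
Qed.

Lemma bit_shift_rec k b i :
  bit_shift k b i =
  (tnth (b (k + 1)) i)%:R * 2 ^ (- (k + 1)) + bit_shift (k + 1) b i :> R.
Proof.
rewrite {1}/bit_shift -/(bit_term k b i).
apply/cvg_lim => //; rewrite -(cvg_shiftS (series (bit_term k b i))).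
have -> : [sequence series (bit_term k b i) n.+1]_n =
    (fun n => (tnth (b (k + 1)) i)%:R * 2 ^ (- (k + 1)) +
      series (bit_term (k + 1) b i) n).
  apply/funext => n; rewrite /series/= big_nat_recl//; congr (_ + _).
  apply: eq_bigr => p _; rewrite /bit_term -!addrA.
  by congr ((tnth (b (k + _)) i)%:R * 2 ^ (- (k + _))); lia.
by apply: cvgD; [exact: cvg_cst | exact: bit_shift_is_cvg].
Qed.

Lemma bit_shift_split k b i (n : nat) :
  bit_shift k b i = series (bit_term k b i) n + bit_shift (k + n%:Z) b i :> R.
Proof.
elim: n => [|n ih]; first by rewrite /series/= big_geq// add0r addr0.
rewrite ih seriesSr -addrA; congr (_ + _); rewrite bit_shift_rec /bit_term.
by have -> : k + n%:Z + 1 = k + n.+1%:Z by lia.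
Qed.

Lemma eq_bit_shift k b b' i : (forall j, k < j -> b j = b' j) ->
  bit_shift k b i = bit_shift k b' i :> R.
Proof.
move=> h; rewrite /bit_shift; congr (limn (series _)); apply/funext => p.
by rewrite h//; lia.
Qed.

(** Truncation makes every quantity a function of finitely many bits above a
    given position. *)
Definition trunc_bits (p : int) b : bits N :=
  fun j => if j <= p then b j else [tuple false | _ < N].

Lemma bit_shift_trunc0 p b i : bit_shift p (trunc_bits p b) i = 0 :> R.
Proof.
rewrite /bit_shift; have -> : (fun q : nat =>
    (tnth (trunc_bits p b (p + q.+1%:Z)) i)%:R * 2 ^ (- (p + q.+1%:Z)) : R) = (fun=> 0).
  apply/funext => q; rewrite /trunc_bits ifF ?tnth_mktuple ?mul0r//.
  by apply/negbTE; lia.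
have -> : series (fun=> 0 : R) = (fun=> 0).
  by apply/funext => n; rewrite /series/= big1.
exact: lim_cst.
Qed.

Lemma bit_shift_trunc k (p : int) b i : k <= p ->
  @bit_shift R N k (trunc_bits p b) i <= @bit_shift R N k b i
    <= @bit_shift R N k (trunc_bits p b) i + 2 ^ (- p).
Proof.
move=> kp; have [n ->] : exists n : nat, p = k + n%:Z by exists `|p - k|%N; lia.
rewrite (bit_shift_split k b i n) (bit_shift_split k _ i n) bit_shift_trunc0.
rewrite addr0; have -> : series (bit_term k (trunc_bits (k + n%:Z) b) i) n =
    series (bit_term k b i) n.
  apply: eq_big_nat => q /andP[_ qn].
  by rewrite /bit_term /trunc_bits ifT//; lia.
by rewrite lerDl lerD2l bit_shift_ge0 bit_shift_le.
Qed.

End shifts.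

Section cubes.
Context {R : realType} {N : nat}.
Implicit Types (b : bits N) (k : int) (x y : Rn R N) (i : 'I_N) (I J : dyadic N).

(** The index of the cube of generation k that contains x. *)
Definition loc b k x : N.-tuple int :=
  [tuple Num.floor ((coor x i - bit_shift k b i) * 2 ^ k) | i < N].

Lemma coor_tuple (F : 'I_N -> R) i :
  coor ([tuple F i | i < N] : Rn R N) i = F i.
Proof. by rewrite /coor tnth_mktuple. Qed.

Lemma dshiftP I b x : cube_set (dshift I b) x <-> loc b I.1 x = I.2.
Proof.
have E i : (coor (corner (dshift I b : cube R N)) i <= coor x i <
    coor (corner (dshift I b)) i + side (dshift I b)) =
  (tnth (loc b I.1 x) i == tnth I.2 i).
  rewrite /corner/= /dside coor_tuple tnth_mktuple floor_eq pow2N.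
  have p0 := @pow2_gt0 R I.1; set s := bit_shift _ _ _; set p := 2 ^ I.1 in p0 *.
  rewrite -ler_pdivrMr// -ltr_pdivlMr// lerBrDr ltrBlDr intrD mulrDl mul1r.
  by rewrite mulrC [in RHS]addrAC.
split => [h | h i]; last by rewrite E h.
by apply: eq_from_tnth => i; apply/eqP; rewrite -E; exact: h.
Qed.

Lemma loc_dshift b k x : cube_set (dshift (k, loc b k x) b) x.
Proof. exact/dshiftP. Qed.

Lemma dshift_inj b : injective (fun I => dshift I b : cube R N).
Proof.
move=> [k m] [k' m'] E; have /pow2_inj/oppr_inj/= kk := congr1 snd E.
subst k'; congr pair; apply: eq_from_tnth => i.
have := congr1 (fun q => tnth q.1 i) E; rewrite !tnth_mktuple => /addIr/mulfI.
by move=> /(_ (pow2_neq0 _)) /(@intr_inj R).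
Qed.

(** Passing to the parent halves the index, after subtracting the digit that
    the shift of the parent has in addition to the shift of the child. *)
Lemma locS b k x i :
  tnth (loc b k x) i = ((tnth (loc b (k + 1) x) i - (tnth (b (k + 1)) i)%:Z) %/ 2)%Z.
Proof.
rewrite !tnth_mktuple (bit_shift_rec k); set s := bit_shift _ _ _.
set c : bool := tnth _ _; set t := (_ - (_ + s)) * 2 ^ k.
have -> : (coor x i - s) * 2 ^ (k + 1) = 2 * t + c%:R.
  rewrite /t opprD addrA mulrBl mulrBl mulrBl pow2N !pow2D expr1z.
  have := @pow2_neq0 R k; set p := _ ^ k => p0.
  by field.
have := floor_itv t; have := floor_itv (2 * t + c%:R : R).
move: (Num.floor _) => u; move: (Num.floor _) => v.
rewrite !intrD => /andP[u1 u2] /andP[v1 v2].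
have h1 : 2 * v + c%:Z <= u.
  rewrite -ltzD1 -(ltr_int R) !intrD intrM; apply: le_lt_trans u2.
  by have : (c%:Z)%:~R = c%:R :> R by []; lra.
have h2 : u < 2 * (v + 1) + c%:Z.
  rewrite -(ltr_int R) !intrD intrM intrD; apply: (le_lt_trans u1).
  by have : (c%:Z)%:~R = c%:R :> R by []; lra.
by lia.
Qed.

Lemma loc_coarser b k k' x y : k <= k' -> loc b k' x = loc b k' y ->
  loc b k x = loc b k y.
Proof.
move=> kk; have [n ->] : exists n : nat, k' = k + n%:Z by exists `|k' - k|%N; lia.
elim: n k {kk} => [k|n ih k h]; first by rewrite addr0.
have {}h : loc b (k + 1) x = loc b (k + 1) y.
  by apply: ih; have -> : k + 1 + n%:Z = k + n.+1%:Z by lia.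
by apply: eq_from_tnth => i; rewrite (locS b k x) (locS b k y) h.
Qed.

Lemma child_dshift k (m : N.-tuple int) b e :
  child (dshift (k, m) b : cube R N) e =
  dshift (k + 1, [tuple 2 * tnth m i + (tnth (b (k + 1)) i)%:Z + (tnth e i)%:Z
                 | i < N]) b.
Proof.
have half : (2 ^ (- k) : R) / 2 = 2 ^ (- (k + 1)).
  by rewrite pow2_half; field.
rewrite /child/dshift/dside/side/corner/= half; congr pair.
apply: eq_from_tnth => i; rewrite !tnth_mktuple coor_tuple (bit_shift_rec k).
rewrite !intrD intrM pow2_half.
have E (c : bool) : (c%:Z)%:~R = c%:R :> R by [].
by rewrite !E; ring.
Qed.

(** The bounds are uniform in the shift, so that finite index sets can be chosen
    once for all values of the random bits. *)
Lemma loc_bound b k x i :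
  2 ^ k * coor x i - 2 <= (tnth (loc b k x) i)%:~R <= 2 ^ k * coor x i.
Proof.
rewrite tnth_mktuple.
have := floor_itv ((coor x i - bit_shift k b i) * 2 ^ k : R).
rewrite intrD => /andP[f1 f2].
have s0 : 0 <= bit_shift k b i * 2 ^ k :> R.
  by rewrite mulr_ge0 ?bit_shift_ge0// ltW// pow2_gt0.
have s1 : bit_shift k b i * 2 ^ k <= 1 :> R.
  by rewrite -ler_pdivlMr ?pow2_gt0// mul1r -pow2N bit_shift_le.
by move: f1 f2; rewrite mulrBl; lra.
Qed.

Lemma eq_dshift I b b' : (forall j, I.1 < j -> b j = b' j) ->
  dshift I b = dshift I b' :> cube R N.
Proof.
move=> h; rewrite /dshift; congr pair; apply: eq_from_tnth => i.
by rewrite !tnth_mktuple; congr (_ + _); exact: eq_bit_shift.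
Qed.

End cubes.

(** * Weighted square-integrable functions *)

Section weighted_L2.
Context {d : measure_display} {T : measurableType d} {R : realType}.
Variable mu : {measure set T -> \bar R}.
Implicit Types (w f h a : T -> R).

Definition wL2 w f : Prop :=
  measurable_fun setT f /\
  mu.-integrable setT (EFin \o (fun x => f x ^+ 2 * w x)).

Definition sqnorm w f : R := \int[mu]_x (f x ^+ 2 * w x).

Lemma le_integrableR f h : measurable_fun setT f ->
  mu.-integrable setT (EFin \o h) -> (forall x, `|f x| <= h x) ->
  mu.-integrable setT (EFin \o f).
Proof.
move=> mf ih fh; apply: le_integrable ih => //; first exact/measurable_EFinP.
by move=> x _ /=; rewrite lee_fin (le_trans (fh x))// ler_norm.
Qed.

Lemma integrableDR f h : mu.-integrable setT (EFin \o f) ->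
  mu.-integrable setT (EFin \o h) ->
  mu.-integrable setT (EFin \o (fun x => f x + h x)).
Proof. by move=> i1 i2; exact: (integrableD measurableT i1 i2). Qed.

Lemma integrableZR c f : mu.-integrable setT (EFin \o f) ->
  mu.-integrable setT (EFin \o (fun x => c * f x)).
Proof. by move=> i1; exact: (integrableZl measurableT c i1). Qed.

Lemma Rintegral_cvg (F : nat -> T -> R) f g :
  (forall n, measurable_fun setT (F n)) -> mu.-integrable setT (EFin \o g) ->
  (forall n x, `|F n x| <= g x) -> (forall x, F n x @[n --> \oo] --> f x) ->
  \int[mu]_x F n x @[n --> \oo] --> \int[mu]_x f x.
Proof.
move=> mF ig Fg Ff.
have mf : measurable_fun setT f.
  by apply: (measurable_fun_cvg mF) => x _; exact: Ff.
have int_f : mu.-integrable setT (EFin \o f).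
  apply: (le_integrableR mf ig) => x.
  have cx : `|F n x| @[n --> \oo] --> `|f x| by apply: cvg_norm; exact: Ff.
  rewrite -(cvg_lim _ cx)//.
  by apply: limr_le; [exact: cvgP cx | exact: nearW].
have key : (\int[mu]_x (F n x)%:E)%E @[n --> \oo] --> (\int[mu]_x (f x)%:E)%E.
  apply: (@dominated_cvg _ _ _ mu setT measurableT
    (fun n x => (F n x)%:E) (EFin \o f) (EFin \o g)) => //.
  - by move=> n; apply/measurable_EFinP.
  - by move=> x _; apply: cvg_EFin; [exact: nearW | exact: Ff].
  - by move=> n x _ /=; rewrite lee_fin.
apply: fine_cvg; rewrite fineK//; exact: (integrable_fin_num measurableT int_f).
Qed.

Section fixed_weight.
Variable w : T -> R.
Hypotheses (mw : measurable_fun setT w) (w0 : forall x, 0 < w x).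

Lemma measurable_sqw f : measurable_fun setT f ->
  measurable_fun setT (fun x => f x ^+ 2 * w x).
Proof. by move=> mf; apply: measurable_funM => //; exact: measurable_funX. Qed.

Lemma sqw_ge0 (u : R) x : 0 <= u ^+ 2 * w x.
Proof. by apply: mulr_ge0; [exact: sqr_ge0 | exact: ltW]. Qed.

Lemma sqnorm_ge0 f : 0 <= sqnorm w f.
Proof. by apply: Rintegral_ge0 => x _; exact: sqw_ge0. Qed.

Lemma sqrDle (x y : R) : (x + y) ^+ 2 <= 2 * x ^+ 2 + 2 * y ^+ 2.
Proof. by have := sqr_ge0 (x - y); nra. Qed.

Lemma ler_norm_sqr (x y : R) : `|x| <= `|y| -> x ^+ 2 <= y ^+ 2.
Proof.
move=> xy; rewrite -(real_normK (num_real x)) -(real_normK (num_real y)).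
by rewrite ler_sqr ?nnegrE.
Qed.

Lemma wL2D f h : wL2 w f -> wL2 w h -> wL2 w (fun x => f x + h x).
Proof.
move=> [mf iF] [mh ih]; split; first exact: measurable_funD.
apply: (@le_integrableR _ (fun x => 2 * (f x ^+ 2 * w x) + 2 * (h x ^+ 2 * w x))).
- by apply: measurable_sqw; exact: measurable_funD.
- by apply: integrableDR; exact: integrableZR.
- move=> x; rewrite ger0_norm ?sqw_ge0//.
  rewrite (_ : _ + _ = (2 * f x ^+ 2 + 2 * h x ^+ 2) * w x); last by ring.
  by rewrite ler_pM2r ?sqrDle.
Qed.

Lemma wL2Z (c : R) f : wL2 w f -> wL2 w (fun x => c * f x).
Proof.
move=> [mf iF]; split; first exact: measurable_funM.
have -> : (fun x => (c * f x) ^+ 2 * w x) = (fun x => c ^+ 2 * (f x ^+ 2 * w x)).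
  by apply/funext => x; rewrite exprMn mulrA.
exact: integrableZR.
Qed.

Lemma wL2B f h : wL2 w f -> wL2 w h -> wL2 w (fun x => f x - h x).
Proof.
move=> Lf /(wL2Z (-1)) Lh; have := wL2D Lf Lh.
by congr (wL2 w _); apply/funext => x; rewrite mulN1r.
Qed.

Lemma wL20 : wL2 w (fun=> 0).
Proof.
split; first exact: measurable_cst.
have -> : EFin \o (fun x => 0 ^+ 2 * w x) = cst 0%E.
  by apply/funext => x /=; rewrite expr0n mul0r.
exact: integrable0.
Qed.

Lemma wL2_sum {J : Type} (s : seq J) (F : J -> T -> R) :
  (forall j, wL2 w (F j)) -> wL2 w (fun x => \sum_(j <- s) F j x).
Proof.
move=> h; elim: s => [|j s ih].
  by under eq_fun do rewrite big_nil; exact: wL20.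
by under eq_fun do rewrite big_cons; exact: wL2D.
Qed.

Lemma sqnormZ (c : R) f : wL2 w f ->
  sqnorm w (fun x => c * f x) = c ^+ 2 * sqnorm w f.
Proof.
move=> [mf iF]; rewrite /sqnorm -RintegralZl//.
by apply: eq_Rintegral => x _; rewrite exprMn mulrA.
Qed.

Lemma sqnormD_le f h : wL2 w f -> wL2 w h ->
  sqnorm w (fun x => f x + h x) <= 2 * sqnorm w f + 2 * sqnorm w h.
Proof.
move=> Lf Lh; have [_ i1] := wL2D Lf Lh; case: Lf Lh => [mf iF] [mh ih].
rewrite /sqnorm -!RintegralZl// -RintegralD//; [|exact: integrableZR..].
apply: le_Rintegral => //; first by apply: integrableDR; exact: integrableZR.
move=> x _; rewrite [leRHS](_ : _ = (2 * f x ^+ 2 + 2 * h x ^+ 2) * w x); last by ring.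
by rewrite ler_pM2r ?sqrDle.
Qed.

Lemma sqnorm_le f h : wL2 w f -> wL2 w h -> (forall x, `|f x| <= `|h x|) ->
  sqnorm w f <= sqnorm w h.
Proof.
move=> [mf iF] [mh ih] fh; apply: le_Rintegral => // x _.
by rewrite ler_pM2r// ler_norm_sqr.
Qed.

Lemma wL2_le f h : measurable_fun setT f -> wL2 w h -> (forall x, `|f x| <= `|h x|) ->
  wL2 w f.
Proof.
move=> mf [mh ih] fh; split => //; apply: le_integrableR ih _; first exact: measurable_sqw.
move=> x /=; rewrite ger0_norm ?sqw_ge0//.
by rewrite ler_pM2r// ler_norm_sqr.
Qed.

Lemma sqnorm_cvg0 (F : nat -> T -> R) f h : (forall n, measurable_fun setT (F n)) ->
  measurable_fun setT f -> wL2 w h ->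
  (forall n x, `|F n x| <= h x) -> (forall x, F n x @[n --> \oo] --> f x) ->
  sqnorm w (fun x => F n x - f x) @[n --> \oo] --> 0.
Proof.
move=> mF mf [mh ih] Fh Ff.
have fh x : `|f x| <= h x.
  have cx : `|F n x| @[n --> \oo] --> `|f x| by apply: cvg_norm; exact: Ff.
  rewrite -(cvg_lim _ cx)//.
  by apply: limr_le; [exact: cvgP cx | exact: nearW].
have h0 x : 0 <= h x by rewrite (le_trans _ (fh x)).
have key : (\int[mu]_x ((F n x - f x) ^+ 2 * w x)%:E)%E @[n --> \oo] -->
    (\int[mu]_x (0 : R)%:E)%E.
  apply: (@dominated_cvg _ _ _ mu setT measurableT
    (fun n x => ((F n x - f x) ^+ 2 * w x)%:E) (cst 0%E)
    (fun x => (4 * (h x ^+ 2 * w x))%:E)) => //.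
  - by move=> n; apply/measurable_EFinP; apply: measurable_sqw; exact: measurable_funB.
  - move=> x _; apply: cvg_EFin; first exact: nearW.
    have -> : (0 : R) = (f x - f x) ^+ 2 * w x by rewrite subrr expr0n mul0r.
    apply: cvgMl; rewrite expr2; under eq_fun do rewrite expr2.
    by apply: cvgM; apply: cvgB => //; exact: cvg_cst.
  - exact: integrableZR.
  - move=> n x _ /=; rewrite lee_fin ger0_norm ?sqw_ge0//.
    rewrite mulrA ler_pM2r//.
    have -> : 4 * h x ^+ 2 = (2 * h x) ^+ 2 by ring.
    apply: ler_norm_sqr; rewrite [leRHS]ger0_norm ?mulr_ge0//.
    by rewrite (le_trans (ler_normB _ _))//; have := Fh n x; have := fh x; lra.
rewrite integral0_eq// in key.
by move/fine_cvgP : key => [_].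
Qed.

(** The pairing is unweighted, and the weight cancels in the inequality
    2 |a h| <= t a^2 / w + t^-1 h^2 w; integrating and optimising over t > 0
    gives the duality between the weights w and 1 / w. *)
Lemma cauchy_schwarz a h : wL2 (fun x => (w x)^-1) a -> wL2 w h ->
  mu.-integrable setT (EFin \o (fun x => a x * h x)) /\
  (\int[mu]_x (a x * h x)) ^+ 2 <= sqnorm (fun x => (w x)^-1) a * sqnorm w h.
Proof.
move=> [ma ia] [mh ih].
have amgm (t : R) : 0 < t -> forall x,
    2 * `|a x * h x| <= t * (a x ^+ 2 * (w x)^-1) + t^-1 * (h x ^+ 2 * w x).
  move=> t0 x; rewrite normrM -(real_normK (num_real (a x)))
    -(real_normK (num_real (h x))).
  have := normr_ge0 (a x); have := normr_ge0 (h x).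
  move: `|a x| `|h x| => u v v0 u0; have wx := w0 x; set z := w x in wx *.
  have -> : t * (u ^+ 2 / z) + t^-1 * (v ^+ 2 * z) =
      2 * (u * v) + (t * z)^-1 * (t * u - z * v) ^+ 2.
    by field; rewrite !gt_eqF.
  by rewrite lerDl mulr_ge0 ?sqr_ge0// invr_ge0 mulr_ge0// ltW.
have iah : mu.-integrable setT (EFin \o (fun x => a x * h x)).
  apply: (@le_integrableR _ (fun x => a x ^+ 2 * (w x)^-1 + h x ^+ 2 * w x)).
  - exact: measurable_funM.
  - exact: integrableDR.
  - move=> x; have := amgm 1 ltr01 x; rewrite invr1 !mul1r.
    by have := normr_ge0 (a x * h x); lra.
split => //; set A := sqnorm _ a; set B := sqnorm _ h.
have A0 : 0 <= A by apply: Rintegral_ge0 => x _; rewrite mulr_ge0 ?sqr_ge0// invr_ge0 ltW.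
have B0 : 0 <= B := sqnorm_ge0 h.
set S := \int[mu]_x _.
have le t : 0 < t -> 2 * `|S| <= t * A + t^-1 * B.
  move=> t0; rewrite /A /B /sqnorm -!RintegralZl// -RintegralD//; [|exact: integrableZR..].
  apply: (@le_trans _ _ (2 * \int[mu]_x `|a x * h x|)).
    by rewrite ler_pM2l//; exact: le_normr_Rintegral.
  rewrite -RintegralZl//; last exact: (integrable_norm iah).
  apply: le_Rintegral => //.
  - by apply: integrableZR; exact: (integrable_norm iah).
  - by apply: integrableDR; exact: integrableZR.
  - by move=> x _; exact: amgm.
rewrite -(real_normK (num_real S)); have := normr_ge0 S; move: `|S| le => s le s0.
have [A00|An0] := eqVneq A 0.
  rewrite A00 mul0r; have [->|sn0] := eqVneq s 0; first by rewrite expr0n.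
  have sp : 0 < s by rewrite lt0r sn0.
  (* When A vanishes, only large t is informative; this one forces s = 0. *)
  have := le ((B + 1) / s) (divr_gt0 _ sp); rewrite A00 mulr0 add0r invf_div => h1.
  have {h1} : 2 * s <= s / (B + 1) * B by apply: h1; lra.
  rewrite mulrAC ler_pdivlMr; last by lra.
  by nra.
have Ap : 0 < A by rewrite lt0r An0.
have [s00|sn0] := eqVneq s 0; first by rewrite s00 expr0n mulr_ge0.
have sp : 0 < s by rewrite lt0r sn0.
(* The value of t for which t A = s. *)
have := le (s / A) (divr_gt0 sp Ap); rewrite invf_div divfK// => h1.
have {}h1 : s <= A / s * B by lra.
by move: h1; rewrite mulrAC ler_pdivlMr// expr2.
Qed.

End fixed_weight.
End weighted_L2.

(** * Averages over cubes and the A2 condition *)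

Section lebesgue_cubes.
Context {R : realType}.

Lemma measurable_coor N (i : 'I_N) :
  measurable_fun [set: Rn R N] (fun x => coor x i : measurableTypeR R).
Proof. exact: measurable_tnth. Qed.

Lemma measurable_cube_set N (Q : cube R N) : measurable (cube_set Q).
Proof.
have -> : cube_set Q = \bigcap_(i in [set: 'I_N])
    ((fun x : Rn R N => coor x i : measurableTypeR R) @^-1`
      `[coor (corner Q) i, coor (corner Q) i + side Q[).
  apply/seteqP; split => x h i; last by have := h i Logic.I; rewrite /= in_itv/=.
  by move=> _ /=; rewrite in_itv/=; exact: h.
apply: fin_bigcap_measurable => // i _.
rewrite -[X in measurable X]setTI; apply: measurable_coor => //.
Qed.

Lemma tnth_behead_lift (T : Type) n (t : n.+1.-tuple T) (i : 'I_n) :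
  tnth [tuple of behead t] i = tnth t (lift ord0 i).
Proof.
rewrite (tnth_behead t i); congr tnth; apply: val_inj.
by rewrite /= inordK// ltnS.
Qed.

Lemma leb_cube N (Q : cube R N) : 0 <= side Q ->
  leb R N (cube_set Q) = (side Q ^+ N)%:E.
Proof.
case: Q => c l; rewrite /side/= => l0; elim: N c => [|n ih] c.
  rewrite expr0 /= diracE mem_set// => -[m]//.
transitivity ((@lebesgue_measure R \x leb R n)%E
    (`[thead c, thead c + l[%classic `*` cube_set ([tuple of behead c], l))).
  congr ((_ \x _)%E _); apply/seteqP; split => -[x t].
    move=> h; split => /=.
      by have := h ord0; rewrite /coor/corner/side/= /thead in_itv.
    by move=> i; have := h (lift ord0 i); rewrite /coor/corner/side/= tnth_behead_lift tnthS.
  move=> [/=]; rewrite in_itv/= => h1 h2 i; rewrite /coor/corner/side/=.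
  case: (unliftP ord0 i) => [j ->|->]; last by rewrite tnth0.
  by have := h2 j; rewrite /coor/corner/side/= tnth_behead_lift tnthS.
rewrite product_measure1E//; last exact: measurable_cube_set.
have E : lebesgue_measure `[thead c, thead c + l[%classic = l%:E.
  rewrite lebesgue_measure_itv/= lte_fin ltrDl; case: ltgtP l0 => // [l0|<-] _ //.
  by rewrite -EFinD addrAC subrr add0r.
transitivity (l%:E * (l ^+ n)%:E)%E; last by rewrite -EFinM exprS.
by congr (_ * _)%E; [exact: E | exact: ih].
Qed.

End lebesgue_cubes.

Section A2_weights.
Context {R : realType} {N : nat}.
Implicit Types (w f : Rn R N -> R) (Q : cube R N).
Local Notation mu := (leb R N).

(** The A2 condition for an everywhere positive weight; in this form it is
    visibly symmetric in the weight and its inverse. *)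
Record A2w w (K : R) : Prop := {
  A2w_measurable : measurable_fun setT w ;
  A2w_gt0 : forall x, 0 < w x ;
  A2w_integrable : forall Q, 0 < side Q -> mu.-integrable (cube_set Q) (EFin \o w) ;
  A2w_integrableV : forall Q, 0 < side Q ->
    mu.-integrable (cube_set Q) (EFin \o (fun x => (w x)^-1)) ;
  A2w_bound : forall Q, 0 < side Q ->
    (\int[mu]_(x in cube_set Q) w x) * (\int[mu]_(x in cube_set Q) (w x)^-1)
    <= K * (side Q ^+ N) ^+ 2 }.

Lemma measurable_invr (w : Rn R N -> R) : measurable_fun setT w ->
  measurable_fun setT (fun x => (w x)^-1).
Proof.
move=> mw; have -> : (fun x => (w x)^-1) = (fun x => w x * (w x ^+ 2) `^ (-1)).
  (* The factor w x takes care of the sign and of the zeros of w. *)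
  apply/funext => x; rewrite powR_inv1 ?sqr_ge0//.
  by have [->|w0] := eqVneq (w x) 0; rewrite ?mul0r ?invr0// expr2 invfM mulrA divff ?mul1r.
apply: measurable_funM => //.
apply: (@measurableT_comp _ _ _ _ _ _ (fun u : R => u `^ (-1))); first exact: measurable_powR.
exact: measurable_funX.
Qed.

Lemma A2wV w K : A2w w K -> A2w (fun x => (w x)^-1) K.
Proof.
case=> mw w0 iw iv b; have E : (fun x => ((w x)^-1)^-1) = w.
  by apply/funext => x; rewrite invrK.
split=> //; first exact: measurable_invr.
- by move=> x; rewrite invr_gt0.
- by rewrite E.
- by move=> Q Q0; rewrite E mulrC; exact: b.
Qed.

Lemma integrable_cubeP (f : Rn R N -> R) Q :
  mu.-integrable (cube_set Q) (EFin \o f) <->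
  mu.-integrable setT (EFin \o (fun x => f x * \1_(cube_set Q) x)).
Proof.
rewrite (integrable_mkcond (EFin \o f) (measurable_cube_set Q)) epatch_indic.
by [].
Qed.

Lemma Rintegral_cube (f : Rn R N -> R) Q :
  \int[mu]_(x in cube_set Q) f x = \int[mu]_x (f x * \1_(cube_set Q) x).
Proof. by rewrite Rintegral_mkcond patch_indic. Qed.

Lemma indic_cube_measurable Q : measurable_fun setT (\1_(cube_set Q) : Rn R N -> R).
Proof. exact: measurable_indic (measurable_cube_set Q). Qed.

Lemma indic_sqr (T : Type) (A : set T) x : (\1_A x : R) ^+ 2 = \1_A x.
Proof. by rewrite indicE; case: (x \in A); rewrite ?expr1n ?expr0n. Qed.

Section fixed_A2_weight.
Variables (w : Rn R N -> R) (K : R).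
Hypothesis A2 : A2w w K.
Let mw := A2w_measurable A2.
Let w0 := A2w_gt0 A2.
Let sigma := fun x => (w x)^-1.
Let A2s : A2w sigma K := A2wV A2.

Lemma wL2_indic Q : 0 < side Q -> wL2 mu w \1_(cube_set Q).
Proof.
move=> Q0; split; first exact: indic_cube_measurable.
under eq_fun do rewrite indic_sqr mulrC.
by apply/integrable_cubeP; exact: (A2w_integrable A2).
Qed.

Lemma sqnorm_indic Q :
  sqnorm mu w \1_(cube_set Q) = \int[mu]_(x in cube_set Q) w x.
Proof.
rewrite Rintegral_cube; apply: eq_Rintegral => x _.
by rewrite indic_sqr mulrC.
Qed.

Lemma wL2_indic_mul f (A : set (Rn R N)) : measurable A -> wL2 mu w f ->
  wL2 mu w (fun x => f x * \1_A x).
Proof.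
move=> mA [mf iF]; apply: (wL2_le (mu := mu) mw w0 (h := f)) => //.
  by apply: measurable_funM => //; exact: measurable_indic.
move=> x; rewrite normrM ler_piMr//.
by rewrite indicE; case: (x \in A); rewrite ?normr1 ?normr0.
Qed.

(** Local integrability comes from pairing with the indicator of the cube, which
    has finite norm for the dual weight. *)
Lemma wL2_integrable f Q : 0 < side Q -> wL2 mu w f ->
  mu.-integrable (cube_set Q) (EFin \o f).
Proof.
move=> Q0 Lf; apply/integrable_cubeP.
have Lq : wL2 mu sigma \1_(cube_set Q).
  split; first exact: indic_cube_measurable.
  under eq_fun do rewrite indic_sqr mulrC.
  by apply/integrable_cubeP; exact: (A2w_integrable A2s).
have [+ _] := cauchy_schwarz w0 Lq Lf.
by under eq_fun do rewrite mulrC.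
Qed.

Definition avg f Q : R := (side Q ^+ N)^-1 * \int[mu]_(y in cube_set Q) f y.

Lemma cube_avgE f Q : 0 < side Q ->
  cube_avg f Q = (fun x => avg f Q * \1_(cube_set Q) x).
Proof.
by move=> Q0; apply/funext => x; rewrite /cube_avg leb_cube ?ltW//= mulrC.
Qed.

Lemma wL2_cube_avg f Q : 0 < side Q -> wL2 mu w (cube_avg f Q).
Proof.
move=> Q0; rewrite cube_avgE//; apply: (wL2Z (mu := mu)); exact: wL2_indic.
Qed.

(** The A2 condition is exactly what makes averaging over one cube bounded: by
    Cauchy-Schwarz the square of the average of f is at most
    the product of the squared norm of f on Q and the integral of 1/w. *)
Lemma sqnorm_cube_avg f Q : 0 < side Q -> wL2 mu w f ->
  sqnorm mu w (cube_avg f Q) <= K * sqnorm mu w (fun x => f x * \1_(cube_set Q) x).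
Proof.
move=> Q0 Lf; rewrite cube_avgE// (sqnormZ (mu := mu))//; last exact: wL2_indic.
set F := fun x => _; have LF : wL2 mu w F.
  by apply: wL2_indic_mul => //; exact: measurable_cube_set.
rewrite sqnorm_indic /avg exprMn.
have Lq : wL2 mu sigma \1_(cube_set Q).
  split; first exact: indic_cube_measurable.
  under eq_fun do rewrite indic_sqr mulrC.
  by apply/integrable_cubeP; exact: (A2w_integrable A2s).
have [_] := cauchy_schwarz w0 Lq LF.
have -> : \int[mu]_x (\1_(cube_set Q) x * F x) = \int[mu]_(y in cube_set Q) f y.
  rewrite Rintegral_cube; apply: eq_Rintegral => x _; rewrite /F mulrCA.
  by rewrite -expr2 indic_sqr.
have -> : sqnorm mu (fun x => (w x)^-1) \1_(cube_set Q) = \int[mu]_(x in cube_set Q) sigma x.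
  by rewrite Rintegral_cube; apply: eq_Rintegral => x _; rewrite indic_sqr mulrC.
have S0 := sqnorm_ge0 mu w0 F; set S := sqnorm _ _ F in S0 *.
have := A2w_bound A2 Q0; rewrite -/sigma.
have W0 : 0 <= \int[mu]_(x in cube_set Q) w x.
  by apply: Rintegral_ge0 => x _; exact: ltW.
move: (\int[mu]_(x in _) w x) (\int[mu]_(x in _) sigma x) W0 => W V W0.
move: (\int[mu]_(x in _) f x) => I0.
have L0 : 0 < side Q ^+ N by rewrite exprn_gt0.
move: (side Q ^+ N) L0 => L L0 h1 h2.
rewrite exprVn -mulrA ler_pdivrMl ?exprn_gt0//.
apply: (@le_trans _ _ (V * S * W)); first by rewrite ler_wpM2r.
by rewrite mulrAC [leRHS](_ : _ = K * L ^+ 2 * S) ?ler_wpM2r//; [rewrite mulrC|ring].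
Qed.

End fixed_A2_weight.
End A2_weights.

(** * Averaging over one generation of cubes *)

Section dyadic_generation.
Context {R : realType} {N : nat}.
Implicit Types (b : bits N) (x y : Rn R N) (I J : dyadic N).

(** Including the empty set makes this family closed under intersection. *)
Definition fine_cubes b (m : int) : set (set (Rn R N)) :=
  [set A | A = set0 \/ exists2 I, m <= I.1 & A = cube_set (dshift I b)].

(** Two cubes of a dyadic system that meet are nested. *)
Lemma fine_cubes_setI b m : setI_closed (fine_cubes b m).
Proof.
move=> A B [->|[I mI ->]]; first by rewrite set0I; left.
move=> [->|[J mJ ->]]; first by rewrite setI0; left.
have [[x [/dshiftP xI /dshiftP xJ]]|no] :=
  pselect (exists x, cube_set (dshift I b) x /\ cube_set (dshift J b) x); last first.
  by left; apply/seteqP; split => // x [? ?]; apply: no; exists x.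
right; have [IJ|/ltW JI] := leP I.1 J.1.
  exists J => //; apply/setIidr => y /dshiftP yJ; apply/dshiftP.
  by rewrite -xI; apply: loc_coarser IJ _; rewrite yJ.
exists I => //; apply/setIidl => y /dshiftP yI; apply/dshiftP.
by rewrite -xJ; apply: loc_coarser JI _; rewrite yI.
Qed.

Lemma cube_near b (k : int) x y i : cube_set (dshift (k, loc b k x) b) y ->
  coor y i < coor x i + 2 ^ (- k).
Proof.
move=> /(_ i)/andP[_]; have /(_ i)/andP[+ _] := loc_dshift b k x.
by rewrite /side/= /dside/=; lra.
Qed.

(** An open half-space is the countable union of the cubes that it contains: the
    cubes around a point shrink to the point. *)
Lemma measurable_fine_cubes b (m : int) A : measurable A -> <<s fine_cubes b m >> A.
Proof.
pose T' := g_sigma_algebraType (fine_cubes b m).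
suff mid : measurable_fun [set: T'] (id : T' -> Rn R N).
  by move=> mA; have := mid measurableT A mA; rewrite setTI.
apply/measurable_fun_tnthP => i.
apply: (measurability (@RGenInftyO.G R)); first exact: RGenInftyO.measurableE.
move=> _ [_ [a ->] <-]; rewrite setTI.
pose C I : set T' := if (m <= I.1) &&
  `[< cube_set (dshift I b) `<=` [set x | coor x i < a] >] then cube_set (dshift I b) else set0.
have -> : (@tnth N (measurableTypeR R) ^~ i \o id) @^-1` `]-oo, a[ =
    \bigcup_(I in [set: dyadic N]) C I.
  apply/seteqP; split => x /=; last first.
    case=> I _; rewrite /C; case: ifP => // /andP[_ /asboolP sub] /sub.
    by rewrite /= in_itv.
  rewrite in_itv/= => xa; rewrite -subr_gt0 in xa.
  have [n _ /(_ n (leqnn _)) /= nsmall] := pow2_small m xa.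
  exists (m + n%:Z, loc b (m + n%:Z) x) => //; rewrite /C ifT; first exact: loc_dshift.
  rewrite lerDl/=; apply/asboolP => y /(cube_near i).
  by rewrite /= /coor in xa *; lra.
apply: countable_bigcupT_measurable; first exact: countableP.
move=> I; apply: sub_sigma_algebra; rewrite /C; case: ifP => [/andP[mI _]|_]; [right|by left].
by exists I.
Qed.

End dyadic_generation.

Section dyadic_averages.
Context {R : realType} {N : nat}.
Implicit Types (b : bits N) (x y : Rn R N) (w f h : Rn R N -> R) (F : seq (N.-tuple int)).
Local Notation mu := (leb R N).

Lemma side_dshift_gt0 (I : dyadic N) b : 0 < side (dshift I b : cube R N).
Proof. exact: pow2_gt0. Qed.

Lemma indic_dshift (k : int) m b x :
  \1_(cube_set (dshift (k, m) b)) x = (m == loc b k x)%:R :> R.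
Proof.
rewrite indicE; congr ((nat_of_bool _)%:R); apply/idP/eqP.
  by rewrite inE => /dshiftP.
by move=> ->; rewrite inE; exact: loc_dshift.
Qed.

(** Conditional expectation on the cubes of generation k with index in F. *)
Definition level_avg b (k : int) F f : Rn R N -> R := fun x =>
  \sum_(m <- F) cube_avg f (dshift (k, m) b) x.

Lemma sum_delta (T : eqType) (V : nmodType) (F : seq T) (c : T -> V) (l : T) :
  uniq F -> (forall m, m != l -> c m = 0) ->
  \sum_(m <- F) c m = if l \in F then c l else 0.
Proof.
move=> uF c0; case: ifPn => lF.
  rewrite (bigD1_seq l)//= big1 ?addr0// => m; exact: c0.
rewrite big_seq big1// => m mF; apply: c0.
by apply: contraNneq lF => <-.
Qed.

Lemma level_avgE b k F f x : uniq F -> level_avg b k F f x =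
  if loc b k x \in F then avg f (dshift (k, loc b k x) b) else 0.
Proof.
move=> uF; rewrite /level_avg (sum_delta (l := loc b k x))//.
  by rewrite cube_avgE ?side_dshift_gt0// indic_dshift eqxx mulr1.
move=> m /negbTE mx; rewrite cube_avgE ?side_dshift_gt0//.
by rewrite indic_dshift mx mulr0.
Qed.

Lemma Rintegral_sum {T : Type} (s : seq T) (G : T -> Rn R N -> R) :
  (forall j, mu.-integrable setT (EFin \o G j)) ->
  mu.-integrable setT (EFin \o (fun x => \sum_(j <- s) G j x)) /\
  \int[mu]_x (\sum_(j <- s) G j x) = \sum_(j <- s) \int[mu]_x G j x.
Proof.
move=> iG; elim: s => [|j s [ih1 ih2]].
  under [X in EFin \o X]eq_fun do rewrite big_nil.
  under eq_Rintegral do rewrite big_nil.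
  split; first exact: integrable0.
  by rewrite big_nil Rintegral_cst// mul0r.
under [X in EFin \o X]eq_fun do rewrite big_cons.
under eq_Rintegral do rewrite big_cons.
split; first exact: integrableDR.
by rewrite big_cons -ih2 RintegralD.
Qed.

Section fixed_weight.
Variables (w : Rn R N -> R) (K : R).
Hypothesis A2 : A2w w K.
Let mw := A2w_measurable A2.
Let w0 := A2w_gt0 A2.
Local Notation L2 := (wL2 mu w).
Local Notation nrm := (sqnorm mu w).

Lemma A2w_ge0 : 0 <= K.
Proof.
have Q0 : 0 < side ([tuple 0 | _ < N], 1 : R) by [].
have := A2w_bound A2 Q0; rewrite /side/= !expr1n mulr1; apply: le_trans.
by apply: mulr_ge0; apply: Rintegral_ge0 => x _; rewrite ?invr_ge0; exact: ltW.
Qed.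

Lemma wL2_level_avg b k F f : L2 (level_avg b k F f).
Proof.
apply: (wL2_sum mw w0) => m; apply: (wL2_cube_avg A2); exact: side_dshift_gt0.
Qed.

(** Cubes of one generation are disjoint, so their averaging operators are
    uniformly bounded together as soon as each of them is. *)
Lemma sqnorm_level_avg b k F f : uniq F -> L2 f ->
  nrm (level_avg b k F f) <= K * nrm f.
Proof.
move=> uF Lf; have Lm m : L2 (fun x => f x * \1_(cube_set (dshift (k, m) b)) x).
  by apply: (wL2_indic_mul A2) => //; exact: measurable_cube_set.
have La m : L2 (cube_avg f (dshift (k, m) b)).
  by apply: (wL2_cube_avg A2); exact: side_dshift_gt0.
have -> : nrm (level_avg b k F f) = \sum_(m <- F) nrm (cube_avg f (dshift (k, m) b)).
  have [_ <-] := @Rintegral_sum _ F _ (fun m => (La m).2).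
  apply: eq_Rintegral => x _; rewrite level_avgE// (sum_delta (l := loc b k x))//.
    case: ifP => _; last by rewrite expr0n mul0r.
    by rewrite cube_avgE ?side_dshift_gt0// indic_dshift eqxx mulr1.
  move=> m /negbTE mx; rewrite cube_avgE ?side_dshift_gt0//.
  by rewrite indic_dshift mx mulr0 expr0n mul0r.
apply: (@le_trans _ _ (\sum_(m <- F)
    K * nrm (fun x => f x * \1_(cube_set (dshift (k, m) b)) x))).
  by apply: ler_sum => m _; apply: (sqnorm_cube_avg A2) => //; exact: side_dshift_gt0.
rewrite -mulr_sumr ler_wpM2l ?A2w_ge0//.
have [i1 <-] := @Rintegral_sum _ F _ (fun m => (Lm m).2).
apply: le_Rintegral => //; first exact: Lf.2.
move=> x _; rewrite (sum_delta (l := loc b k x))//.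
  case: ifP => _; last exact: sqw_ge0.
  by rewrite indic_dshift eqxx mulr1.
by move=> m /negbTE mx; rewrite indic_dshift mx mulr0 expr0n mul0r.
Qed.

Lemma avgD f h (c : R) Q : 0 < side Q -> L2 f -> L2 h ->
  avg (fun x => c * f x + h x) Q = c * avg f Q + avg h Q.
Proof.
move=> Q0 Lf Lh; rewrite /avg RintegralD//; last 2 first.
- by apply: (wL2_integrable A2) => //; exact: wL2Z.
- exact: (wL2_integrable A2).
rewrite RintegralZl//; last exact: (wL2_integrable A2).
  by rewrite mulrDr mulrCA.
exact: measurable_cube_set.
exact: measurable_cube_set.
Qed.

Lemma level_avgD b k F f h (c : R) x : L2 f -> L2 h ->
  level_avg b k F (fun x => c * f x + h x) x =
  c * level_avg b k F f x + level_avg b k F h x.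
Proof.
move=> Lf Lh; rewrite /level_avg mulr_sumr -big_split/=; apply: eq_bigr => m _.
have Q0 := side_dshift_gt0 (k, m) b.
by rewrite !cube_avgE// avgD// mulrDl mulrA.
Qed.

End fixed_weight.
End dyadic_averages.

(** * Convergence of the averages to the function *)

Section martingale_convergence.
Context {R : realType} {N : nat}.
Variables (w : Rn R N -> R) (K : R).
Hypothesis A2 : A2w w K.
Let mw := A2w_measurable A2.
Let w0 := A2w_gt0 A2.
Local Notation mu := (leb R N).
Local Notation L2 := (wL2 mu w).
Local Notation nrm := (sqnorm mu w).

Variables (b : bits N) (m : int) (G : seq (N.-tuple int)).
Variable (F : nat -> seq (N.-tuple int)).
Hypothesis uF : forall n, uniq (F n).
Hypothesis GF : forall (n : nat) (x : Rn R N), m <= n%:Z -> loc b m x \in G -> loc b n%:Z x \in F n.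

Local Notation avg_n n := (level_avg b n%:Z (F n)).

Let U : set (Rn R N) := [set x | loc b m x \in G].

Definition recovered f : Prop :=
  L2 f /\ nrm (fun x => avg_n n f x - f x) @[n --> \oo] --> 0.

Lemma sqnorm0 : nrm (fun=> 0) = 0.
Proof.
rewrite /sqnorm; under eq_Rintegral do rewrite expr0n mul0r.
by rewrite Rintegral_cst// mul0r.
Qed.

Lemma Rintegral_cst_cube (c : R) (Q : cube R N) : 0 <= side Q ->
  \int[mu]_(y in cube_set Q) c = c * side Q ^+ N.
Proof.
move=> Q0; rewrite Rintegral_cst; last exact: measurable_cube_set.
by congr (_ * _); have := congr1 fine (leb_cube Q0).
Qed.

(** A function that is constant on the cubes of generation k is equal to its
    averages over every finer generation. *)
Lemma recovered_exact h (k : int) : L2 h ->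
  (forall x y, loc b k x = loc b k y -> h x = h y) ->
  (forall x, ~ U x -> h x = 0) -> recovered h.
Proof.
move=> Lh hloc hU; split => //; apply: cvg_near_cst.
near=> n.
have mn : m <= n%:Z by near: n; exists `|m|%N => // n /=; lia.
have kn : k <= n%:Z by near: n; exists `|k|%N => // n /=; lia.
rewrite -[RHS]sqnorm0; congr (sqnorm _ _); apply/funext => x; apply/eqP.
rewrite subr_eq0 level_avgE//; case: ifPn => [xF|xF]; last first.
  by rewrite hU// => xU; move: xF; rewrite GF.
have Q0 := side_dshift_gt0 (R := R) (n%:Z, loc b n%:Z x) b.
rewrite /avg (_ : \int[mu]_(y in _) _ =
  \int[mu]_(y in cube_set (dshift (n%:Z, loc b n%:Z x) b)) h x); last first.
  apply: eq_Rintegral => y; rewrite inE => /dshiftP/= yx; apply: hloc.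
  exact: loc_coarser kn yx.
rewrite Rintegral_cst_cube ?ltW//= mulrCA mulVf ?mulr1//.
by rewrite expf_neq0// gt_eqF.
Unshelve. all: by end_near. Qed.

Lemma sqnormB_le f h : L2 f -> L2 h ->
  nrm (fun x => f x - h x) <= 2 * nrm f + 2 * nrm h.
Proof.
move=> Lf Lh; have -> : (fun x => f x - h x) = (fun x => f x + (-1) * h x).
  by apply/funext => x; rewrite mulN1r.
apply: (le_trans (sqnormD_le mw w0 Lf (wL2Z (-1) Lh))).
by rewrite (sqnormZ (mu := mu))// sqrrN expr1n mul1r.
Qed.

Lemma sqnormBC f h : nrm (fun x => f x - h x) = nrm (fun x => h x - f x).
Proof. by apply: eq_Rintegral => x _; rewrite -sqrrN opprB. Qed.

Lemma cvg0_le (u v : nat -> R) : (forall n, 0 <= u n <= v n) ->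
  v n @[n --> \oo] --> 0 -> u n @[n --> \oo] --> 0.
Proof.
move=> uv v0; apply: (@squeeze_cvgr _ _ _ _ (fun=> 0) v) => //; last exact: cvg_cst.
exact: nearW.
Qed.

Lemma recoveredD (c : R) f h : recovered f -> recovered h ->
  recovered (fun x => c * f x + h x).
Proof.
move=> [Lf f0] [Lh h0]; split; first by apply: (wL2D mw w0) => //; exact: wL2Z.
apply: (@cvg0_le _ (fun n => 2 * (c ^+ 2 * nrm (fun x => avg_n n f x - f x)) +
    2 * nrm (fun x => avg_n n h x - h x))).
  move=> n; rewrite (sqnorm_ge0 mu w0)/=.
  have Lfn := wL2B mw w0 (wL2_level_avg A2 b n (F n) f) Lf.
  have Lhn := wL2B mw w0 (wL2_level_avg A2 b n (F n) h) Lh.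
  rewrite -(sqnormZ (mu := mu) c)//; apply: le_trans (sqnormD_le mw w0 (wL2Z c Lfn) Lhn).
  rewrite le_eqVlt; apply/orP; left; apply/eqP; congr (sqnorm _ _).
  by apply/funext => x; rewrite (level_avgD A2)//; ring.
rewrite (_ : 0 = 2 * (c ^+ 2 * 0) + 2 * 0); last by rewrite !mulr0 addr0.
by apply: cvgD; do ?[apply: cvgMr].
Qed.

(** Uniform boundedness of the averaging operators makes this class closed. *)
Lemma recovered_closed f : L2 f ->
  (forall e : R, 0 < e -> exists2 h, recovered h & nrm (fun x => f x - h x) <= e) ->
  recovered f.
Proof.
move=> Lf fh; split => //; apply/cvgrPdist_le => e e0.
have K0 := A2w_ge0 A2.
(* The bound found below for the norm is (4 (K + 1) + 2) e1, at most e. *)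
pose e1 := e / (2 * (4 * (K + 1) + 1)).
have e10 : 0 < e1 by apply: divr_gt0 => //; lra.
have [h [Lh h0] fhe] := fh _ e10.
have Ldf := wL2B mw w0 Lf Lh.
move/cvgrPdist_le : h0 => /(_ e1 e10); apply: filterS => n.
rewrite !sub0r !normrN !ger0_norm ?(sqnorm_ge0 mu w0)// => hn.
have La g := wL2_level_avg A2 b n%:Z (F n) g.
have LA := wL2B mw w0 (La f) (La h).
have Lhn := wL2B mw w0 (La h) Lh.
set d1 : Rn R N -> R := fun x => avg_n n f x - avg_n n h x in LA.
set d2 : Rn R N -> R := fun x => avg_n n h x - h x in Lhn hn.
set d3 : Rn R N -> R := fun x => f x - h x in Ldf fhe.
have n1 : nrm d1 <= K * e1.
  apply: le_trans (ler_wpM2l K0 fhe).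
  apply: le_trans (sqnorm_level_avg A2 b n (uF n) Ldf).
  rewrite le_eqVlt; apply/orP; left; apply/eqP; congr (sqnorm _ _).
  apply/funext => x; rewrite /d1 /d3.
  have -> : (fun x => f x - h x) = (fun x => -1 * h x + f x).
    by apply/funext => y; ring.
  by rewrite (level_avgD A2)//; ring.
have -> : (fun x => avg_n n f x - f x) = (fun x => (d1 x + d2 x) - d3 x).
  by apply/funext => x; rewrite /d1 /d2 /d3; ring.
have L12 := wL2D mw w0 LA Lhn.
apply: (le_trans (sqnormB_le L12 Ldf)).
have := sqnormD_le mw w0 LA Lhn.
have : 2 * ((4 * (K + 1) + 1) * e1) = e.
  by rewrite /e1; field; rewrite gt_eqF//; lra.
have : 0 <= K * e1 by rewrite mulr_ge0// ltW.
by lra.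
Qed.

Lemma measurable_U : measurable U.
Proof.
have -> : U = \bigcup_(c in [set` G]) cube_set (dshift (m, c) b).
  apply/seteqP; split => x /=.
    by move=> xU; exists (loc b m x) => //; exact: loc_dshift.
  by move=> [c /= cG /dshiftP /= xc]; rewrite /U/= xc.
by apply: fin_bigcup_measurable => // c _; exact: measurable_cube_set.
Qed.

Lemma indicU x : \1_U x = (loc b m x \in G)%:R :> R.
Proof. by rewrite indicE; congr ((nat_of_bool _)%:R); apply/idP/idP; rewrite inE. Qed.

Lemma wL2_U : L2 \1_U.
Proof.
have -> : \1_U = (fun x => \sum_(c <- undup G) \1_(cube_set (dshift (m, c) b)) x) :> (Rn R N -> R).
  apply/funext => x; rewrite (sum_delta (l := loc b m x)) ?undup_uniq//.
    by rewrite indic_dshift eqxx mem_undup indicU; case: ifP.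
  by move=> c /negbTE cx; rewrite indic_dshift cx.
by apply: (wL2_sum mw w0) => c; apply: (wL2_indic A2); exact: side_dshift_gt0.
Qed.

Lemma wL2_indicU A : measurable A -> L2 (fun x => \1_A x * \1_U x).
Proof.
move=> mA; have := wL2_indic_mul A2 mA wL2_U.
by congr (wL2 _ w _); apply/funext => x; rewrite mulrC.
Qed.

Lemma recovered_level_set (k : int) A : measurable A -> m <= k ->
  (forall x y, loc b k x = loc b k y -> A x -> A y) ->
  recovered (fun x => \1_A x * \1_U x).
Proof.
move=> mA mk hA; apply: (@recovered_exact _ k); first exact: wL2_indicU.
- move=> x y xy; rewrite !indicU (loc_coarser mk xy) !indicE; congr ((nat_of_bool _)%:R * _).
  by apply/idP/idP; rewrite !inE; apply: hA.
- by move=> x xU; rewrite [\1_U x]indicE memNset// mulr0.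
Qed.

(** Dynkin argument: the averages over the cubes of generation n leave the
    indicators of all coarser cubes unchanged, and these cubes generate the
    Borel sets. *)
Lemma recovered_indic A : measurable A -> recovered (fun x => \1_A x * \1_U x).
Proof.
move=> mA.
pose H := [set A | measurable A /\ recovered (fun x => \1_A x * \1_U x)].
suff : H A by case.
suff sub : <<s fine_cubes b m >> `<=` H.
  by apply: sub; exact: measurable_fine_cubes.
apply: (lambda_system_subset (@fine_cubes_setI R N b m)) => //.
- split => //.
  + by split => //; exact: (@recovered_level_set m).
  + move=> A1 A2' BA [mA1 r1] [mA2 r2]; split; first exact: measurableD.
    have := recoveredD (-1) r2 r1; congr recovered; apply/funext => x.
    rewrite mulN1r addrC -mulrBl; congr (_ * _); rewrite !indicE in_setD.
    have [xB|] := boolP (x \in A2'); last by rewrite subr0 andbT.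
    by rewrite (_ : x \in A1) ?subrr//; apply/mem_set/BA; rewrite -inE.
  + move=> Fn ndF HF; have mFn n : measurable (Fn n) := (HF n).1.
    have mUF : measurable (\bigcup_n Fn n) by exact: bigcup_measurable.
    split => //; apply: recovered_closed => [|e e0]; first exact: wL2_indicU.
    have : nrm (fun x => \1_(Fn n) x * \1_U x - \1_(\bigcup_n Fn n) x * \1_U x)
        @[n --> \oo] --> 0.
      apply: (sqnorm_cvg0 mw w0 (h := \1_U)).
      * by move=> n; exact: (wL2_indicU (mFn n)).1.
      * exact: (wL2_indicU mUF).1.
      * exact: wL2_U.
      * move=> n x; rewrite ger0_norm ?mulr_ge0// ler_piMl//.
      * move=> x; apply: cvgMl; have [[n _ xF]|xF] := pselect ((\bigcup_n Fn n) x).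
          apply: cvg_near_cst; exists n => // k /= nk; rewrite !indicE !mem_set//.
            by exists n.
          by have /subsetPset := ndF _ _ nk; exact.
        apply: cvg_near_cst; apply: nearW => k; rewrite !indicE !memNset//.
        by move=> xk; apply: xF; exists k.
    move/cvgrPdist_le => /(_ e e0) [n _ /(_ n (leqnn n))].
    rewrite sub0r normrN ger0_norm ?(sqnorm_ge0 mu w0)// => hn.
    by exists (fun x => \1_(Fn n) x * \1_U x); [exact: (HF n).2 | rewrite sqnormBC].
- move=> _ [->|[I mI ->]]; split => //.
  + by apply: (@recovered_level_set m).
  + exact: measurable_cube_set.
  + apply: (@recovered_level_set I.1) => //; first exact: measurable_cube_set.
    by move=> x y xy /dshiftP xI; apply/dshiftP; rewrite -xy.
Qed.

Lemma recovered_simple (h : {nnsfun Rn R N >-> R}) : recovered (fun x => h x * \1_U x).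
Proof.
have -> : (fun x => h x * \1_U x) =
    (fun x => \sum_(y <- fset_set (range h)) y * (\1_(h @^-1` [set y]) x * \1_U x)).
  apply/funext => x; rewrite fimfunE fsbig_finite//= mulr_suml.
  by apply: eq_bigr => y _; rewrite mulrA.
elim: (fset_set _ : seq R) => [|y s ih].
  under eq_fun do rewrite big_nil.
  by apply: (@recovered_exact _ m) => //; exact: wL20.
under eq_fun do rewrite big_cons.
by apply: recoveredD => //; apply: recovered_indic; exact: measurable_sfunP.
Qed.

Lemma recovered_nonneg f : L2 f -> (forall x, 0 <= f x) ->
  (forall x, ~ U x -> f x = 0) -> recovered f.
Proof.
move=> Lf f0 fU; apply: recovered_closed => // e e0.
have mf : measurable_fun setT (EFin \o f) by apply/measurable_EFinP; exact: Lf.1.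
pose h n := nnsfun_approx measurableT mf n.
have hcvg x : h n x @[n --> \oo] --> f x.
  have f0' y : setT y -> (0 <= (EFin \o f) y)%E by rewrite /= lee_fin.
  by have /fine_cvgP[_] := cvg_nnsfun_approx measurableT mf f0' (x := x) Logic.I.
have hf n x : h n x <= f x.
  rewrite -(cvg_lim _ (hcvg x))//; apply: (@nondecreasing_cvgn_le _ (fun n => h n x)).
    by move=> p q pq; have /lefP/(_ x) := nd_nnsfun_approx measurableT mf pq.
  exact: cvgP (hcvg x).
have hU n x : h n x * \1_U x = h n x.
  have [xU|xU] := pselect (U x); first by rewrite indicE mem_set// mulr1.
  rewrite indicE memNset// mulr0; apply/eqP; rewrite eq_le fun_ge0/=.
  by rewrite -(fU x xU).
have : nrm (fun x => h n x - f x) @[n --> \oo] --> 0.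
  apply: (sqnorm_cvg0 mw w0 (h := f)) => //; first exact: Lf.1.
  by move=> n x; rewrite ger0_norm// fun_ge0.
move/cvgrPdist_le => /(_ e e0) [n _ /(_ n (leqnn n))].
rewrite sub0r normrN ger0_norm ?(sqnorm_ge0 mu w0)// => hn.
exists (h n); last by rewrite sqnormBC.
by have := recovered_simple (h n); congr recovered; apply/funext => x; rewrite hU.
Qed.

Theorem recovered_supported f : L2 f -> (forall x, ~ U x -> f x = 0) -> recovered f.
Proof.
move=> Lf fU.
have mx (g : Rn R N -> R) : measurable_fun setT g -> measurable_fun setT (fun x => Num.max (g x) 0).
  by move=> mg; apply: measurable_maxr.
have L1 : L2 (fun x => Num.max (f x) 0).
  apply: (wL2_le mw w0 (mx _ Lf.1) Lf) => x; rewrite ger0_norm ?le_max ?lexx ?orbT//.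
  by rewrite ge_max ler_norm normr_ge0.
have L2' : L2 (fun x => Num.max (- f x) 0).
  apply: (wL2_le mw w0 (mx _ _) Lf) => [|x]; first exact: measurable_funN Lf.1.
  rewrite ger0_norm ?le_max ?lexx ?orbT//.
  by rewrite ge_max -normrN ler_norm normr_ge0.
have : recovered (fun x => -1 * Num.max (- f x) 0 + Num.max (f x) 0).
  apply: recoveredD; apply: recovered_nonneg => // x; rewrite ?le_max ?lexx ?orbT//.
    by move/fU => ->; rewrite oppr0 maxxx.
  by move/fU => ->; rewrite maxxx.
congr recovered; apply/funext => x.
by rewrite !maxEle oppr_le0; case: (leP 0 (f x)); case: (leP (f x) 0) => *; lra.
Qed.

End martingale_convergence.

(** * The bilinear form of the operator *)

Section operator_form.
Context {R : realType} {N : nat}.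
Local Notation mu := (leb R N).
Variables (w : Rn R N -> R) (K : R).
Hypothesis A2 : A2w w K.
Let mw := A2w_measurable A2.
Let w0 := A2w_gt0 A2.
Let A2s := A2wV A2.
Let ms := A2w_measurable A2s.
Let s0 := A2w_gt0 A2s.
Local Notation L2w := (wL2 mu w).
Local Notation L2s := (wL2 mu (fun x => (w x)^-1)).
Local Notation nw := (sqnorm mu w).
Local Notation ns := (sqnorm mu (fun x => (w x)^-1)).

Variables (T : (Rn R N -> R) -> (Rn R N -> R)) (C : R).
Hypothesis C0 : 0 <= C.
Hypothesis TL2 : forall f, L2w f -> L2w (T f).
Hypothesis Tlin : forall (c : R) f h, L2w f -> L2w h ->
  {ae mu, forall x, T (fun y => c * f y + h y) x = c * T f x + T h x}.
Hypothesis Tbnd : forall f, L2w f -> nw (T f) <= C * nw f.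

Lemma ae_eq_Rintegral (f h : Rn R N -> R) : measurable_fun setT f ->
  measurable_fun setT h -> {ae mu, forall x, f x = h x} ->
  \int[mu]_x f x = \int[mu]_x h x.
Proof.
move=> mf mh fh; congr fine; apply: ae_eq_integral => //; try exact/measurable_EFinP.
by apply: filterS fh => x -> _.
Qed.

Lemma pairing_integrable a h : L2s a -> L2w h ->
  mu.-integrable setT (EFin \o (fun x => a x * T h x)).
Proof. by move=> La Lh; have [] := cauchy_schwarz w0 La (TL2 Lh). Qed.

Lemma pairing_bound a h : L2s a -> L2w h ->
  pairing a (T h) ^+ 2 <= C * (ns a * nw h).
Proof.
move=> La Lh; have [_ cs] := cauchy_schwarz w0 La (TL2 Lh).
apply: (le_trans cs); rewrite [leRHS]mulrCA.
by rewrite ler_wpM2l ?Tbnd// (sqnorm_ge0 mu s0).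
Qed.

Lemma pairingDr (c : R) a f h : L2s a -> L2w f -> L2w h ->
  pairing a (T (fun y => c * f y + h y)) = c * pairing a (T f) + pairing a (T h).
Proof.
move=> La Lf Lh; have Lfh := wL2D mw w0 (wL2Z c Lf) Lh.
rewrite /pairing (ae_eq_Rintegral (h := fun x => c * (a x * T f x) + a x * T h x)).
- rewrite RintegralD//; last exact: pairing_integrable.
    by rewrite RintegralZl//; exact: pairing_integrable.
  by apply: integrableZR; exact: pairing_integrable.
- apply: measurable_funM; first exact: La.1.
  exact: (TL2 Lfh).1.
- apply: measurable_funD.
    by apply: measurable_funM => //; apply: measurable_funM; [exact: La.1|exact: (TL2 Lf).1].
  by apply: measurable_funM; [exact: La.1|exact: (TL2 Lh).1].
- by apply: filterS (Tlin c Lf Lh) => x ->; ring.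
Qed.

Lemma pairingDl (c : R) a a' h : L2s a -> L2s a' -> L2w h ->
  pairing (fun y => c * a y + a' y) (T h) = c * pairing a (T h) + pairing a' (T h).
Proof.
move=> La La' Lh; rewrite /pairing -RintegralZl//; last exact: pairing_integrable.
rewrite -RintegralD//; last exact: pairing_integrable.
  by apply: eq_Rintegral => x _; rewrite mulrDl mulrA.
by apply: integrableZR; exact: pairing_integrable.
Qed.

Lemma pairing0r a : L2s a -> pairing a (T (fun=> 0)) = 0.
Proof.
move=> La; have := pairingDr (-1) La (wL20 mu w) (wL20 mu w).
under [in LHS]eq_fun do rewrite mulr0 addr0.
by rewrite mulN1r addNr.
Qed.

Lemma pairing0l h : pairing (fun=> 0) (T h) = 0.
Proof.
rewrite /pairing; under eq_Rintegral do rewrite mul0r.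
by rewrite Rintegral_cst// mul0r.
Qed.

Lemma pairing_suml {J : Type} (s : seq J) (a : J -> Rn R N -> R) h :
  (forall j, L2s (a j)) -> L2w h ->
  pairing (fun x => \sum_(j <- s) a j x) (T h) = \sum_(j <- s) pairing (a j) (T h).
Proof.
move=> La Lh; elim: s => [|j s ih].
  by under eq_fun do rewrite big_nil; rewrite pairing0l big_nil.
rewrite big_cons -ih -[X in X + _]mul1r -pairingDl//; last exact: (wL2_sum ms s0).
by under eq_fun do rewrite big_cons; under [in RHS]eq_fun do rewrite mul1r.
Qed.

Lemma pairing_sumr {J : Type} (s : seq J) a (h : J -> Rn R N -> R) :
  L2s a -> (forall j, L2w (h j)) ->
  pairing a (T (fun x => \sum_(j <- s) h j x)) = \sum_(j <- s) pairing a (T (h j)).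
Proof.
move=> La Lh; elim: s => [|j s ih].
  by under eq_fun do rewrite big_nil; rewrite pairing0r// big_nil.
rewrite big_cons -ih -[X in X + _]mul1r -pairingDr//; last exact: (wL2_sum mw w0).
by under eq_fun do rewrite big_cons; under [in RHS]eq_fun do rewrite mul1r.
Qed.

Lemma sqr_cvg0 (u : nat -> R) : u n ^+ 2 @[n --> \oo] --> 0 -> u n @[n --> \oo] --> 0.
Proof.
move=> u0; apply/cvgrPdist_lt => e e0.
move/cvgrPdist_lt : u0 => /(_ (e ^+ 2) (exprn_gt0 _ e0)); apply: filterS => n.
rewrite !sub0r !normrN normrX ltr_sqr ?nnegrE//; exact: ltW.
Qed.

Lemma pairing_cvg (a_ : nat -> Rn R N -> R) (h_ : nat -> Rn R N -> R) a h :
  (forall n, L2s (a_ n)) -> (forall n, L2w (h_ n)) -> L2s a -> L2w h ->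
  ns (fun x => a_ n x - a x) @[n --> \oo] --> 0 ->
  nw (fun x => h_ n x - h x) @[n --> \oo] --> 0 ->
  pairing (a_ n) (T (h_ n)) @[n --> \oo] --> pairing a (T h).
Proof.
move=> La_ Lh_ La Lh ca ch.
have Lda n := wL2B ms s0 (La_ n) La.
have Ldh n := wL2B mw w0 (Lh_ n) Lh.
suff : (pairing (a_ n) (T (h_ n)) - pairing a (T h)) @[n --> \oo] --> 0.
  by move/cvg_sub0; apply; exact: cvg_cst.
apply: sqr_cvg0.
pose u n := ns (fun x => a_ n x - a x); pose v n := nw (fun x => h_ n x - h x).
apply: (@cvg0_le _ _ (fun n => 2 * (C * (u n * (2 * v n + 2 * nw h))) +
   2 * (C * (ns a * v n)))); last first.
  rewrite (_ : 0 = 2 * (C * (0 * (2 * 0 + 2 * nw h))) + 2 * (C * (ns a * 0))); last by ring.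
  apply: cvgD; apply: cvgMr; apply: cvgMr; last exact: cvgMr.
  by apply: cvgM => //; apply: cvgD; [exact: cvgMr|exact: cvg_cst].
move=> n; rewrite sqr_ge0/=.
have -> : pairing (a_ n) (T (h_ n)) - pairing a (T h) =
   pairing (fun x => a_ n x - a x) (T (h_ n)) + pairing a (T (fun x => h_ n x - h x)).
  have -> : (fun x => a_ n x - a x) = (fun x => -1 * a x + a_ n x).
    by apply/funext => x; ring.
  have -> : (fun x => h_ n x - h x) = (fun x => -1 * h x + h_ n x).
    by apply/funext => x; ring.
  by rewrite pairingDl// pairingDr//; ring.
apply: (le_trans (sqrDle _ _)).
have b1 := pairing_bound (Lda n) (Lh_ n).
have b2 := pairing_bound La (Ldh n).
have u0 : 0 <= u n by exact: sqnorm_ge0.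
have v0 : 0 <= v n by exact: sqnorm_ge0.
have na0 : 0 <= ns a by exact: sqnorm_ge0.
have hn : nw (h_ n) <= 2 * v n + 2 * nw h.
  have := sqnormD_le mw w0 (Ldh n) Lh; congr (sqnorm _ _ _ <= _).
  by apply/funext => x; rewrite subrK.
apply: lerD; rewrite ler_pM2l//.
  by apply: (le_trans b1); rewrite ler_wpM2l// ler_wpM2l.
Qed.

End operator_form.

Section truncation.
Context {R : realType} {N : nat}.
Local Notation mu := (leb R N).
Implicit Types (b : bits N) (f : Rn R N -> R).

Definition box (M : R) : cube R N := ([tuple - M | _ < N], 2 * M).

(** Families of functions indexed by the bits that are reproduced by truncating
    the bits, pointwise and dominated by a fixed box.  By dominated convergence
    they are continuous along truncation in every weighted norm, so that the
    coefficients formed with them are limits of functions of finitely many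
    bits. *)
Definition trunc_cont (h : bits N -> Rn R N -> R) : Prop :=
  [/\ forall b, measurable_fun setT (h b),
      exists2 M, 0 < M & exists2 C, 0 <= C &
        forall b x, `|h b x| <= C * \1_(cube_set (box M)) x
    & forall b x, h (trunc_bits p%:Z b) x @[p --> \oo] --> h b x].

Lemma box_sub (M M' : R) : M <= M' -> cube_set (box M) `<=` cube_set (box M').
Proof.
by move=> MM x xM i; have := xM i; rewrite /box/corner/side/= !coor_tuple; lra.
Qed.

Lemma indic_le (A B : set (Rn R N)) x : A `<=` B -> (\1_A x : R) <= \1_B x.
Proof.
move=> AB; rewrite !indicE; case: (boolP (x \in A)) => // xA.
by rewrite (_ : x \in B)//; apply/mem_set/AB; rewrite -inE.
Qed.

Lemma trunc_contD (c : R) h h' : trunc_cont h -> trunc_cont h' ->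
  trunc_cont (fun b x => c * h b x + h' b x).
Proof.
move=> [mh [M M0 [C C0 hM]] ch] [mh' [M' M'0 [C' C'0 hM']] ch']; split.
- by move=> b; apply: measurable_funD => //; exact: measurable_funM.
- exists (Num.max M M'); first by rewrite lt_max M0.
  exists (`|c| * C + C'); first by rewrite addr_ge0// mulr_ge0.
  move=> b x; apply: (le_trans (ler_normD _ _)); rewrite mulrDl normrM -mulrA.
  apply: lerD.
    rewrite ler_wpM2l//; apply: (le_trans (hM b x)); rewrite ler_wpM2l//.
    by apply: indic_le; apply: box_sub; rewrite le_max lexx.
  apply: (le_trans (hM' b x)); rewrite ler_wpM2l//.
  by apply: indic_le; apply: box_sub; rewrite le_max lexx orbT.
- by move=> b x; apply: cvgD => //; exact: cvgMr.
Qed.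

Lemma trunc_cont0 : trunc_cont (fun _ _ => 0).
Proof.
split=> [b|| b x]; [exact: measurable_cst | | exact: cvg_cst].
by exists 1 => //; exists 0 => // b x; rewrite normr0 mul0r.
Qed.

Lemma trunc_cont_sum {J : Type} (s : seq J) (h : J -> bits N -> Rn R N -> R) :
  (forall j, trunc_cont (h j)) -> trunc_cont (fun b x => \sum_(j <- s) h j b x).
Proof.
move=> hc; elim: s => [|j s ih].
  have := trunc_cont0; congr trunc_cont; apply/funext => b; apply/funext => x.
  by rewrite big_nil.
have := trunc_contD 1 (hc j) ih; congr trunc_cont; apply/funext => b; apply/funext => x.
by rewrite big_cons mul1r.
Qed.

Section moving_cube.
Variables (k : int) (c : 'I_N -> R) (l : R).
Hypothesis l0 : 0 < l.

Let Q b : cube R N := ([tuple c i + bit_shift k b i | i < N], l).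

Let M := \sum_(i < N) `|c i| + 2 ^ (- k) + l.

Let M0 : 0 < M.
Proof.
rewrite /M -addrA ltr_wpDl ?sumr_ge0// addr_gt0//; exact: pow2_gt0.
Qed.

Let Q_box b : cube_set (Q b) `<=` cube_set (box M).
Proof.
move=> x xQ i; have := xQ i; rewrite /Q/box/corner/side/= !coor_tuple.
have := @bit_shift_ge0 R N k b i; have := @bit_shift_le R N k b i.
have : `|c i| <= \sum_(i < N) `|c i| by rewrite (bigD1 i)//= lerDl sumr_ge0.
have : - `|c i| <= c i <= `|c i| by rewrite -ler_norml.
by rewrite /M; lra.
Qed.

(* Truncating the bits lowers the corner, so the half-open cubes converge at
   every point, including the points of the boundary. *)
Let indic_cvg b x :
  \1_(cube_set (Q (trunc_bits p%:Z b))) x @[p --> \oo] --> (\1_(cube_set (Q b)) x : R).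
Proof.
apply: cvg_near_cst.
suff : \forall p \near \oo, forall i : 'I_N,
    (c i + bit_shift k (trunc_bits p%:Z b) i <= coor x i <
      c i + bit_shift k (trunc_bits p%:Z b) i + l) =
    (c i + bit_shift k b i <= coor x i < c i + bit_shift k b i + l).
  apply: filterS => p hp; rewrite !indicE; congr ((nat_of_bool _)%:R).
  by apply/idP/idP; rewrite !inE => xQ i; have := xQ i;
    rewrite /Q/corner/side/= !coor_tuple hp.
apply: filter_forall => i.
set s := bit_shift k b i.
have [e e0 he] : exists2 e, 0 < e & forall t, s - e < t -> t <= s ->
   (c i + t <= coor x i < c i + t + l) = (c i + s <= coor x i < c i + s + l).
  have [xl|xl] := ltP (coor x i) (c i + s).
    exists (c i + s - coor x i); first by rewrite subr_gt0.
    by move=> t t1 t2; apply/idP/idP; lra.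
  have [xr|xr] := ltP (coor x i) (c i + s + l).
    exists (c i + s + l - coor x i); first by rewrite subr_gt0.
    by move=> t t1 t2; apply/idP/idP; lra.
  by exists 1 => // t t1 t2; apply/idP/idP; lra.
near=> p.
have kp : k <= p%:Z by near: p; exists `|k|%N => // n /=; lia.
have /andP[t1 t2] := @bit_shift_trunc R N k p%:Z b i kp.
apply: he => //; rewrite -/s in t1 t2.
have : 2 ^ (- (0 + p%:Z)) < e by near: p; exact: pow2_small.
by rewrite add0r; lra.
Unshelve. all: by end_near. Qed.

Lemma trunc_cont_avg f :
  (forall Q : cube R N, 0 < side Q -> mu.-integrable (cube_set Q) (EFin \o f)) ->
  measurable_fun setT f ->
  trunc_cont (fun b => cube_avg f ([tuple c i + bit_shift k b i | i < N], l)).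
Proof.
move=> iF mf.
have B0 : 0 < side (box M) by rewrite mulr_gt0.
have mB : mu.-integrable setT (EFin \o (fun x => `|f x| * \1_(cube_set (box M)) x)).
  apply/integrable_cubeP; exact: integrable_norm (iF _ B0).
have avg_int b : \int[mu]_(y in cube_set (Q b)) f y =
    \int[mu]_x (f x * \1_(cube_set (Q b)) x) by rewrite Rintegral_cube.
have dom b x : `|f x * \1_(cube_set (Q b)) x| <= `|f x| * \1_(cube_set (box M)) x.
  by rewrite normrM ler_wpM2l// ger0_norm//; apply: indic_le; exact: Q_box.
have mQ b : measurable_fun setT (fun x => f x * \1_(cube_set (Q b)) x).
  by apply: measurable_funM => //; exact: indic_cube_measurable.
split.
- move=> b; rewrite cube_avgE//; apply: measurable_funM => //.
  exact: indic_cube_measurable.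
- exists M => //; exists ((l ^+ N)^-1 * \int[mu]_x (`|f x| * \1_(cube_set (box M)) x)).
    apply: mulr_ge0; first by rewrite invr_ge0 exprn_ge0// ltW.
    by apply: Rintegral_ge0 => x _; rewrite mulr_ge0.
  move=> b x; rewrite cube_avgE// normrM [X in _ * X]ger0_norm//.
  apply: ler_pM => //; last by apply: indic_le; exact: Q_box.
  have ll : 0 <= (l ^+ N)^-1 by rewrite invr_ge0 exprn_ge0// ltW.
  rewrite /avg normrM /side/= (ger0_norm ll) ler_wpM2l//.
  have iQ : mu.-integrable setT (EFin \o (fun x => f x * \1_(cube_set (Q b)) x)).
    exact: (le_integrableR (mQ b) mB (dom b)).
  rewrite -/(Q b) avg_int; apply: (le_trans (le_normr_Rintegral measurableT iQ)).
  by apply: le_Rintegral => //; exact: integrable_norm iQ.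
- move=> b x; rewrite cube_avgE//; under eq_fun do rewrite cube_avgE//.
  apply: cvgM; last exact: indic_cvg.
  rewrite /avg /side/=; apply: cvgMr; rewrite -/(Q b) avg_int.
  under eq_fun do rewrite -/(Q _) avg_int.
  apply: (Rintegral_cvg _ mB) => //.
  by move=> y; apply: cvgMr; exact: indic_cvg.
Qed.

End moving_cube.

Section dyadic_families.
Variable f : Rn R N -> R.
Hypothesis iF : forall Q : cube R N, 0 < side Q ->
  mu.-integrable (cube_set Q) (EFin \o f).
Hypothesis mf : measurable_fun setT f.

Lemma trunc_cont_cube_avg (I : dyadic N) : trunc_cont (fun b => cube_avg f (dshift I b)).
Proof. by apply: trunc_cont_avg => //; exact: pow2_gt0. Qed.

Lemma trunc_cont_child_avg (I : dyadic N) e :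
  trunc_cont (fun b => cube_avg f (child (dshift I b) e)).
Proof.
have l0 : 0 < dside R I / 2 by rewrite divr_gt0//; exact: pow2_gt0.
have := @trunc_cont_avg I.1 (fun i => dside R I * (tnth I.2 i)%:~R +
  (tnth e i)%:R * (dside R I / 2)) _ l0 f iF mf.
congr trunc_cont; apply/funext => b; congr (cube_avg f (_, _)).
by apply: eq_from_tnth => i; rewrite !tnth_mktuple coor_tuple addrAC.
Qed.

Lemma trunc_cont_mart_diff (m : int) (I : dyadic N) :
  trunc_cont (fun b => mart_diff m f (dshift I b)).
Proof.
have hs := trunc_cont_sum (index_enum _) (trunc_cont_child_avg I).
have [h|h] := boolP (dside R I == 2 ^ (- m)).
  have := hs; congr trunc_cont; apply/funext => b; apply/funext => x.
  by rewrite /mart_diff /side/= h.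
have := trunc_contD (-1) (trunc_cont_cube_avg I) hs.
congr trunc_cont; apply/funext => b; apply/funext => x.
by rewrite /mart_diff /side/= (negbTE h) mulN1r addrC.
Qed.

End dyadic_families.

Lemma trunc_cont_wL2 (w : Rn R N -> R) K h b : A2w w K -> trunc_cont h -> wL2 mu w (h b).
Proof.
move=> A2 [mh [M M0 [C C0 hM]] ch].
have B0 : 0 < side (box M) by rewrite mulr_gt0.
apply: (wL2_le (A2w_measurable A2) (A2w_gt0 A2) (mh b) (wL2Z C (wL2_indic A2 B0))) => x.
by apply: (le_trans (hM b x)); rewrite ger0_norm// mulr_ge0.
Qed.

Lemma trunc_cont_sqnorm (w : Rn R N -> R) K h : A2w w K -> trunc_cont h ->
  (exists B, forall b, sqnorm mu w (h b) <= B) /\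
  forall b, sqnorm mu w (fun x => h (trunc_bits p%:Z b) x - h b x) @[p --> \oo] --> 0.
Proof.
move=> A2 hc; have [mh [M M0 [C C0 hM]] ch] := hc.
have B0 : 0 < side (box M) by rewrite mulr_gt0.
have LB := wL2Z C (wL2_indic A2 B0).
split.
  exists (sqnorm mu w (fun x => C * \1_(cube_set (box M)) x)) => b.
  apply: (sqnorm_le (A2w_gt0 A2) (trunc_cont_wL2 b A2 hc) LB) => x.
  by apply: (le_trans (hM b x)); rewrite ger0_norm// mulr_ge0.
move=> b; apply: (sqnorm_cvg0 (A2w_measurable A2) (A2w_gt0 A2) _ _ LB) => //.
Qed.

End truncation.

(** * Functions of the random bits *)

Section finite_bits.
Context {N : nat}.
Implicit Types (b : bits N) (j : int) (S : seq int) (e : N.-tuple bool).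

Definition depends {A : Type} S (Phi : bits N -> A) : Prop :=
  forall b b', (forall j, j \in S -> b j = b' j) -> Phi b = Phi b'.

Definition set_bit b j e : bits N := fun i => if i == j then e else b i.

(** The bits above k are kept, the others are resampled. *)
Definition merge (k : int) b b' : bits N := fun j => if k < j then b j else b' j.

Lemma set_bit_id b j : set_bit b j (b j) = b.
Proof. by apply/funext => i; rewrite /set_bit; case: eqP => // ->. Qed.

Lemma depends_set_bit {A : Type} S j e (Phi : bits N -> A) : depends S Phi ->
  depends [seq i <- S | i != j] (fun b => Phi (set_bit b j e)).
Proof.
move=> dS b b' h; apply: dS => i iS; rewrite /set_bit.
by case: eqP => // /eqP ij; apply: h; rewrite mem_filter ij.
Qed.

Lemma depends_sub {A : Type} S S' (Phi : bits N -> A) : {subset S <= S'} ->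
  depends S Phi -> depends S' Phi.
Proof. by move=> SS dS b b' h; apply: dS => j /SS; exact: h. Qed.

Context {R : realType}.
Implicit Types Phi Psi : bits N -> R.

Definition avg_bit j Phi b : R := (2 ^+ N)^-1 * \sum_e Phi (set_bit b j e).

Definition avg_bits (js : seq int) Phi : bits N -> R := foldr avg_bit Phi js.

Lemma avg_cst (c : R) : (2 ^+ N)^-1 * (\sum_(e : N.-tuple bool) c) = c.
Proof.
rewrite sumr_const card_tuple card_bool -[c *+ _]mulr_natr natrX mulrCA mulVf ?mulr1//.
Qed.

Lemma pow2N_ge0 : 0 <= (2 ^+ N)^-1 :> R.
Proof. by rewrite invr_ge0 exprn_ge0. Qed.

Lemma avg_bits_itv js Phi (u v : R) : (forall b, u <= Phi b <= v) ->
  forall b, u <= avg_bits js Phi b <= v.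
Proof.
move=> h; elim: js => //= j js ih b.
rewrite /avg_bit -{1}(avg_cst u) -[X in _ && (_ <= X)](avg_cst v).
by rewrite !ler_wpM2l ?pow2N_ge0// ler_sum// => e _; have /andP[] := ih (set_bit b j e).
Qed.

Lemma depends_avg_bits S js Phi : depends S Phi ->
  depends [seq i <- S | i \notin js] (avg_bits js Phi).
Proof.
move=> dS; elim: js => [|j js ih] /=; first by apply: depends_sub dS => i; rewrite mem_filter.
move=> b b' h; rewrite /avg_bit; congr (_ * _); apply: eq_bigr => e _.
apply: ih => i; rewrite mem_filter /set_bit => /andP[ijs iS].
by case: eqP => // /eqP ij; apply: h; rewrite mem_filter in_cons negb_or ij ijs.
Qed.

Lemma avg_bits_merge k js Phi b0 b : (forall j, j \in js -> j <= k) ->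
  avg_bits js (fun b' => Phi (merge k b0 b')) b = avg_bits js Phi (merge k b0 b).
Proof.
elim: js b => //= j js ih b h; rewrite /avg_bit; congr (_ * _).
apply: eq_bigr => e _; rewrite ih => [|i ijs]; last by apply: h; rewrite in_cons ijs orbT.
congr (avg_bits js Phi _); apply/funext => i; rewrite /merge /set_bit.
by have := h j (mem_head _ _); case: (eqVneq i j) => // ->; case: ltgtP.
Qed.

Lemma merge_id k b : merge k b b = b.
Proof. by apply/funext => j; rewrite /merge; case: ifP. Qed.

End finite_bits.

Section random_bits.
Context {d : measure_display} {Omega : measurableType d} {R : realType}.
Variables (P : probability Omega R) (N : nat) (beta : int -> {RV P >-> N.-tuple bool}).
Implicit Types (S : seq int) (Z : set int).

Lemma measurable_tbool (B : set (N.-tuple bool)) : measurable B.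
Proof.
have m1 (e : N.-tuple bool) : measurable [set e].
  have -> : [set e] = \bigcap_(i in [set: 'I_N]) ((@tnth N bool)^~ i @^-1` [set tnth e i]).
    by apply/seteqP; split => [x -> //|x xe]; apply: eq_from_tnth => i; exact: xe.
  apply: fin_bigcap_measurable => // i _; rewrite -[X in measurable X]setTI.
  exact: measurable_tnth.
have -> : B = \bigcup_(e in B) [set e] by rewrite bigcup_imset1 image_id.
by apply: fin_bigcup_measurable => //; exact: finite_finset.
Qed.

(** Induction on the bits used: condition on the value of one of them. *)
Lemma sigma_bits_event Z S (phi : bits N -> bool) : (forall j, j \in S -> Z j) ->
  depends S phi -> sigma_bits beta Z [set om | phi (bits_of beta om)].
Proof.
pose G := [set A | exists2 j, Z j & exists2 B, measurable B & A = beta j @^-1` B].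
suff : (forall j, j \in S -> Z j) -> depends S phi ->
   measurable ([set om | phi (bits_of beta om)] : set (g_sigma_algebraType G)) by [].
elim: S phi => [|j S ih] phi SZ dphi.
  have -> : [set om | phi (bits_of beta om)] = [set _ | phi (fun=> [tuple true | _ < N])].
    by apply/funext => om /=; rewrite (dphi _ (fun=> [tuple true | _ < N])).
  case: (phi _); last by rewrite (_ : [set _ | _] = set0)//; apply/seteqP; split.
  by rewrite (_ : [set _ | _] = setT)//; apply/seteqP; split.
have -> : [set om | phi (bits_of beta om)] = \bigcup_(e in [set: N.-tuple bool])
    (beta j @^-1` [set e] `&` [set om | phi (set_bit (bits_of beta om) j e)]).
  apply/seteqP; split => om /=.
    move=> ph; exists (beta j om) => //; split => //=.
    by rewrite (_ : set_bit _ _ _ = bits_of beta om)//; exact: set_bit_id.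
  by move=> [e _ [/= <-]]; rewrite (_ : set_bit _ _ _ = bits_of beta om)//; exact: set_bit_id.
apply: fin_bigcup_measurable; first exact: finite_finset.
move=> e _; apply: measurableI.
  apply: sub_sigma_algebra; exists j; first by apply: SZ; rewrite mem_head.
  by exists [set e] => //; exact: measurable_tbool.
apply: (ih (fun b => phi (set_bit b j e))) => [i iS|]; first by apply: SZ; rewrite in_cons iS orbT.
apply: depends_sub (depends_set_bit (j := j) e dphi) => i.
by rewrite mem_filter in_cons => /andP[/negbTE ->].
Qed.

Lemma sigma_bits_measurable Z A : sigma_bits beta Z A -> measurable A.
Proof.
apply: smallest_sub; first exact: sigma_algebra_measurable.
move=> _ [j _ [B mB ->]]; rewrite -[X in measurable X]setTI.
exact: measurable_funPT.
Qed.

Lemma measurable_bits S (Phi : bits N -> R) : depends S Phi ->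
  measurable_fun setT (fun om => Phi (bits_of beta om)).
Proof.
move=> dS _ B mB; rewrite setTI; apply: (@sigma_bits_measurable setT).
have -> : (fun om => Phi (bits_of beta om)) @^-1` B =
    [set om | `[< B (Phi (bits_of beta om)) >]].
  by apply/seteqP; split => om /= /asboolP.
apply: (sigma_bits_event (S := S) (phi := fun b => `[< B (Phi b) >])) => //.
by move=> b b' h; rewrite (dS b b').
Qed.

Definition Ex (Phi : bits N -> R) : R := \int[P]_om Phi (bits_of beta om).

Lemma bounded_integrable (X : Omega -> R) (C : R) : measurable_fun setT X ->
  (forall om, `|X om| <= C) -> P.-integrable setT (EFin \o X).
Proof.
move=> mX XC; apply: (le_integrableR mX _ XC); exact: finite_measure_integrable_cst.
Qed.

Lemma Ex_integrable S (Phi : bits N -> R) (C : R) : depends S Phi ->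
  (forall b, `|Phi b| <= C) ->
  P.-integrable setT (EFin \o (fun om => Phi (bits_of beta om))).
Proof. by move=> dS PC; apply: (@bounded_integrable _ C) => //; exact: measurable_bits dS. Qed.

Hypotheses (beta_unif : uniform_bits beta) (beta_indep : independent_bits beta).

Definition agree S (b0 b : bits N) : bool := all (fun j => b j == b0 j) S.

Lemma depends_agree S b0 : depends S (agree S b0).
Proof.
by move=> b b' h; apply: eq_in_all => j jS; rewrite h.
Qed.

Lemma P_agree S b0 : uniq S ->
  P [set om | agree S b0 (bits_of beta om)] = ((2 ^+ N)^-1 ^+ size S)%:E.
Proof.
move=> uS; have := beta_indep (A := fun j => [set b0 j]) uS (fun j => measurable_tbool _).
have -> : \bigcap_(j in [set` S]) beta j @^-1` [set b0 j] =
    [set om | agree S b0 (bits_of beta om)].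
  apply/seteqP; split => om /=; first by move=> h; apply/allP => j jS; apply/eqP; exact: h.
  by move=> /allP h j /h /eqP.
move=> ->; under eq_bigr do rewrite beta_unif.
by elim: (S) => [|j s ih]; rewrite ?big_nil ?expr0// big_cons ih -EFinM exprS.
Qed.

Lemma Ex_cst (c : R) : Ex (fun=> c) = c.
Proof. rewrite /Ex Rintegral_cst// (_ : fine _ = 1) ?mulr1//.
by have := congr1 fine (probability_setT P). Qed.

Lemma Ex_sum {J : Type} (s : seq J) (Phi : J -> bits N -> R) :
  (forall j, P.-integrable setT (EFin \o (fun om => Phi j (bits_of beta om)))) ->
  P.-integrable setT (EFin \o (fun om => \sum_(j <- s) Phi j (bits_of beta om))) /\
  Ex (fun b => \sum_(j <- s) Phi j b) = \sum_(j <- s) Ex (Phi j).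
Proof.
move=> iG; rewrite /Ex; elim: s => [|j s [ih1 ih2]].
  under [X in EFin \o X]eq_fun do rewrite big_nil.
  under eq_Rintegral do rewrite big_nil.
  split; first exact: integrable0.
  by rewrite big_nil Rintegral_cst// mul0r.
under [X in EFin \o X]eq_fun do rewrite big_cons.
under eq_Rintegral do rewrite big_cons.
split; first exact: integrableDR.
by rewrite big_cons -ih2 RintegralD.
Qed.

Lemma ExZ (c : R) (Phi : bits N -> R) :
  P.-integrable setT (EFin \o (fun om => Phi (bits_of beta om))) ->
  Ex (fun b => c * Phi b) = c * Ex Phi.
Proof. by move=> i; rewrite /Ex RintegralZl. Qed.

Lemma normr_indic_mul (c : bool) (x C : R) : `|x| <= C -> `|c%:R * x| <= C.
Proof.
by case: c => h; rewrite ?mul1r// mul0r normr0 (le_trans _ h).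
Qed.

Lemma depends_agree_mul S S' b0 (Phi : bits N -> R) : depends S' Phi ->
  depends (S ++ S') (fun b => (agree S b0 b)%:R * Phi b).
Proof.
move=> dS' b b' h; rewrite (depends_agree b0 (b := b) (b' := b')).
  by rewrite (dS' b b')// => j jS; apply: h; rewrite mem_cat jS orbT.
by move=> j jS; apply: h; rewrite mem_cat jS.
Qed.

Lemma split_bit j (Phi : bits N -> R) b :
  Phi b = \sum_e (agree [:: j] (fun=> e) b)%:R * Phi (set_bit b j e).
Proof.
rewrite (bigD1 (b j))//= big1 ?addr0 ?andbT ?eqxx ?mul1r ?set_bit_id//.
by move=> e /negbTE eb; rewrite /agree/= andbT eq_sym eb mul0r.
Qed.

(** Prescribing finitely many bits is independent of the other bits.  Expanding
    Phi over the values of one more bit moves that bit into the prescribed ones,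
    until nothing but the product rule is left. *)
Lemma Ex_agree S s b0 (Phi : bits N -> R) (C : R) : uniq S -> uniq s ->
  (forall j, j \in s -> j \notin S) -> depends S Phi -> (forall b, `|Phi b| <= C) ->
  Ex (fun b => (agree s b0 b)%:R * Phi b) = (2 ^+ N)^-1 ^+ size s * Ex Phi.
Proof.
elim: S s b0 Phi => [|j S ih] s b0 Phi uS us dis dS PC.
  have -> : Phi = (fun=> Phi b0) by apply/funext => b; exact: dS.
  under eq_fun do rewrite mulrC.
  have i1 : P.-integrable setT (EFin \o (fun om => (agree s b0 (bits_of beta om))%:R : R)).
    apply: (@Ex_integrable s (fun b => (agree s b0 b)%:R) 1).
      by move=> b b' h; rewrite (depends_agree b0 h).
    by move=> b; case: (agree _ _ _); rewrite ?normr1 ?normr0.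
  rewrite (ExZ (Phi := fun b => (agree s b0 b)%:R) _ i1) Ex_cst mulrC; congr (_ * _).
  have := P_agree b0 us; set A := [set om | _] => PA.
  have mA : measurable A.
    apply: (@sigma_bits_measurable setT); apply: (sigma_bits_event (S := s)) => //.
    exact: depends_agree.
  rewrite /Ex /Rintegral (_ : (fun om => _) = (EFin \o \1_A)).
    by rewrite integral_indic// setIT; have := congr1 fine PA.
  by apply/funext => om; rewrite /= indicE; congr ((nat_of_bool _)%:R%:E);
    apply/idP/idP; rewrite inE.
move: uS => /= /andP[jS uS].
have js : j \notin s by apply/negP => /dis; rewrite mem_head.
pose Phie e b := Phi (set_bit b j e).
have dPe e : depends S (Phie e).
  apply: depends_sub (depends_set_bit (j := j) e dS) => i.
  by rewrite mem_filter in_cons => /andP[/negbTE ->].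
have sumE (t : seq int) : j \notin t -> uniq t -> (forall i, i \in t -> i \notin S) ->
    Ex (fun b => (agree t b0 b)%:R * Phi b) =
    \sum_e (2 ^+ N)^-1 ^+ (size t).+1 * Ex (Phie e).
  move=> jt ut tS.
  have E b : (agree t b0 b)%:R * Phi b =
      \sum_e (agree (j :: t) (set_bit b0 j e) b)%:R * Phie e b.
    rewrite (split_bit j Phi b) mulr_sumr; apply: eq_bigr => e _.
    rewrite mulrA; congr (_ * _); rewrite -natrM mulnb /agree/= andbT andbC.
    congr (nat_of_bool (_ && _))%:R; first by rewrite /set_bit eqxx.
    apply: eq_in_all => i it; rewrite /set_bit; case: (eqVneq i j) => // ij.
    by rewrite -ij it in jt.
  under [in LHS]eq_fun do rewrite E.
  have ii e : P.-integrable setT (EFin \o (fun om =>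
      (agree (j :: t) (set_bit b0 j e) (bits_of beta om))%:R * Phie e (bits_of beta om))).
    apply: (@Ex_integrable _ _ C (depends_agree_mul (S := j :: t) (set_bit b0 j e) (dPe e))).
    by move=> b; apply: normr_indic_mul; exact: PC.
  rewrite (Ex_sum _ ii).2; apply: eq_bigr => e _.
  rewrite (ih (j :: t) (set_bit b0 j e) (Phie e))//=.
  - by rewrite jt.
  - by move=> i; rewrite in_cons => /orP[/eqP ->//|/tS].
  - by move=> b; exact: PC.
rewrite sumE//; last by move=> i /dis; rewrite in_cons negb_or => /andP[].
have := sumE [::] isT isT (fun i (h : i \in [::]) => ltac:(by [])).
under [X in Ex X = _]eq_fun do rewrite mul1r.
move=> ->; rewrite mulr_sumr; apply: eq_bigr => e _.
by rewrite /= expr1 exprSr mulrA.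
Qed.

(** Split Phi over the values of the bit: each of them has probability 2^-N and is
    independent of the other bits. *)
Lemma Ex_avg_bit S j (Phi : bits N -> R) (C : R) : depends S Phi ->
  (forall b, `|Phi b| <= C) -> Ex (avg_bit j Phi) = Ex Phi.
Proof.
move=> dS PC; pose S' := [seq i <- undup S | i != j].
have dPe e : depends S' (fun b => Phi (set_bit b j e)).
  apply: depends_set_bit; apply: depends_sub dS => i; by rewrite mem_undup.
have ie e : P.-integrable setT (EFin \o (fun om => Phi (set_bit (bits_of beta om) j e))).
  by apply: (Ex_integrable (dPe e)) => b; exact: PC.
have -> : Ex Phi = \sum_e (2 ^+ N)^-1 * Ex (fun b => Phi (set_bit b j e)).
  have -> : Phi = (fun b => \sum_e (agree [:: j] (fun=> e) b)%:R * Phi (set_bit b j e)).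
    by apply/funext => b; exact: split_bit.
  rewrite (Ex_sum _ _).2; last first.
    move=> e; apply: (@Ex_integrable _ _ C (depends_agree_mul (S := [:: j]) (fun=> e) (dPe e))).
    by move=> b; apply: normr_indic_mul; exact: PC.
  apply: eq_bigr => e _; rewrite -[X in X * _]expr1.
  under [in RHS]eq_fun do rewrite -split_bit.
  apply: (@Ex_agree S' [:: j] (fun=> e) _ C) => //.
  - by rewrite filter_uniq// undup_uniq.
  - by move=> i; rewrite inE => /eqP ->; rewrite mem_filter eqxx.
rewrite /avg_bit ExZ; first by rewrite (Ex_sum _ ie).2 mulr_sumr.
exact: (Ex_sum (Phi := fun e b => Phi (set_bit b j e)) (index_enum _) ie).1.
Qed.

Lemma Ex_avg_bits js S (Phi : bits N -> R) (C : R) : depends S Phi ->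
  (forall b, `|Phi b| <= C) -> Ex (avg_bits js Phi) = Ex Phi.
Proof.
move=> dS PC; elim: js => //= j js ih; rewrite -ih.
apply: (@Ex_avg_bit _ j (avg_bits js Phi) C (depends_avg_bits (js := js) dS)) => b.
by rewrite ler_norml; apply: avg_bits_itv => b'; rewrite -ler_norml.
Qed.

(** The bits j > k are independent of the bits j <= k: the latter can be
    resampled from an independent copy. *)
Lemma Ex_merge_depends k S (Phi : bits N -> R) (C : R) : depends S Phi ->
  (forall b, `|Phi b| <= C) ->
  Ex Phi = Ex (fun b => Ex (fun b' => Phi (merge k b b'))).
Proof.
move=> dS PC; pose js := [seq j <- S | j <= k].
rewrite -(Ex_avg_bits js dS PC); congr Ex; apply/funext => b.
have dm : depends js (fun b' => Phi (merge k b b')).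
  move=> b1 b2 h; apply: dS => j jS; rewrite /merge; case: ltP => // jk.
  by apply: h; rewrite mem_filter jk.
rewrite -(Ex_avg_bits js dm (C := C)) => [|b']; last exact: PC.
have d0 := depends_avg_bits (js := js) dm.
rewrite -[LHS]Ex_cst; congr Ex; apply/funext => b'.
have -> : avg_bits js (fun b'0 => Phi (merge k b b'0)) b' =
    avg_bits js (fun b'0 => Phi (merge k b b'0)) b.
  by apply: d0 => j; rewrite mem_filter => /andP[/negP].
rewrite avg_bits_merge ?merge_id// => j; by rewrite mem_filter => /andP[].
Qed.

Lemma Ex_cvg (Phi_ : nat -> bits N -> R) (Phi : bits N -> R) (C : R) :
  (forall p, measurable_fun setT (fun om => Phi_ p (bits_of beta om))) ->
  (forall p b, `|Phi_ p b| <= C) -> (forall b, Phi_ p b @[p --> \oo] --> Phi b) ->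
  Ex (Phi_ p) @[p --> \oo] --> Ex Phi.
Proof.
move=> mP PC cP.
apply: (@Rintegral_cvg _ _ _ P (fun p om => Phi_ p (bits_of beta om)) _ (fun=> C)) => //.
exact: finite_measure_integrable_cst.
Qed.

(** Bounded limits of functions of finitely many bits in Z.  Goodness indicators
    and operator coefficients are of this kind, the class is stable under sums,
    products and conditional averages, and identities between expectations
    reduce to finitely many bits. *)
Definition tame Z (Phi : bits N -> R) : Prop :=
  exists Phi_ : nat -> bits N -> R, exists C : R,
    [/\ forall p, exists2 S, (forall j, j \in S -> Z j) & depends S (Phi_ p),
        forall p b, `|Phi_ p b| <= C &
        forall b, Phi_ p b @[p --> \oo] --> Phi b].

Lemma tame_depends Z S (Phi : bits N -> R) (C : R) : (forall j, j \in S -> Z j) ->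
  depends S Phi -> (forall b, `|Phi b| <= C) -> tame Z Phi.
Proof.
move=> SZ dS PC; exists (fun=> Phi), C; split => // [_|b]; first by exists S.
exact: cvg_cst.
Qed.

Lemma tame_cst Z (c : R) : tame Z (fun=> c).
Proof. exact: (@tame_depends _ [::] _ `|c|). Qed.

Lemma tame_bounded Z Phi : tame Z Phi -> exists C : R, forall b, `|Phi b| <= C.
Proof.
move=> [Phi_ [C [_ PC cP]]]; exists C => b.
have cb : `|Phi_ p b| @[p --> \oo] --> `|Phi b| by apply: cvg_norm; exact: cP.
rewrite -(cvg_lim _ cb)//.
by apply: limr_le; [exact: cvgP cb | exact: nearW].
Qed.

Lemma tame_agree Z Phi b b' : tame Z Phi -> (forall j, Z j -> b j = b' j) ->
  Phi b = Phi b'.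
Proof.
move=> [Phi_ [C [dP _ cP]]] bb.
have E : Phi_ ^~ b = Phi_ ^~ b'.
  apply/funext => p; have [S SZ dS] := dP p.
  by apply: dS => j /SZ; exact: bb.
by rewrite -(cvg_lim _ (cP b))// -(cvg_lim _ (cP b'))// E.
Qed.

Lemma tame_sub Z Z' Phi : Z `<=` Z' -> tame Z Phi -> tame Z' Phi.
Proof.
move=> ZZ [Phi_ [C [dP PC cP]]]; exists Phi_, C; split => // p.
by have [S SZ dS] := dP p; exists S => // j /SZ /ZZ.
Qed.

Lemma tameM Z Phi Psi : tame Z Phi -> tame Z Psi -> tame Z (fun b => Phi b * Psi b).
Proof.
move=> [F [C [dF FC cF]]] [G [D [dG GD cG]]].
exists (fun p b => F p b * G p b), (C * D); split.
- move=> p; have [S SZ dS] := dF p; have [S' SZ' dS'] := dG p.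
  exists (S ++ S'); first by move=> j; rewrite mem_cat => /orP[/SZ|/SZ'].
  move=> b b' h; rewrite (dS b b') ?(dS' b b')// => j jS; apply: h; rewrite mem_cat jS ?orbT//.
- by move=> p b; rewrite normrM ler_pM.
- by move=> b; exact: cvgM.
Qed.

Lemma tameD Z Phi Psi : tame Z Phi -> tame Z Psi -> tame Z (fun b => Phi b + Psi b).
Proof.
move=> [F [C [dF FC cF]]] [G [D [dG GD cG]]].
exists (fun p b => F p b + G p b), (C + D); split.
- move=> p; have [S SZ dS] := dF p; have [S' SZ' dS'] := dG p.
  exists (S ++ S'); first by move=> j; rewrite mem_cat => /orP[/SZ|/SZ'].
  move=> b b' h; rewrite (dS b b') ?(dS' b b')// => j jS; apply: h; rewrite mem_cat jS ?orbT//.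
- by move=> p b; rewrite (le_trans (ler_normD _ _))// lerD.
- by move=> b; exact: cvgD.
Qed.

Lemma tame_sum Z {J : Type} (s : seq J) (Phi : J -> bits N -> R) :
  (forall j, tame Z (Phi j)) -> tame Z (fun b => \sum_(j <- s) Phi j b).
Proof.
move=> tP; elim: s => [|j s ih].
  by under eq_fun do rewrite big_nil; exact: tame_cst.
by under eq_fun do rewrite big_cons; exact: tameD.
Qed.

Lemma tame_sigma_measurable Z Phi : tame Z Phi -> forall B, measurable B ->
  sigma_bits beta Z ((fun om => Phi (bits_of beta om)) @^-1` B).
Proof.
pose G := [set A | exists2 j, Z j & exists2 B, measurable B & A = beta j @^-1` B].
move=> [Phi_ [C [dP _ cP]]].
suff mP : measurable_fun [set: g_sigma_algebraType G] (fun om => Phi (bits_of beta om)).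
  by move=> B mB; have := mP measurableT B mB; rewrite setTI.
apply: (@measurable_fun_cvg _ (g_sigma_algebraType G) R setT
  (fun p om => Phi_ p (bits_of beta om))) => [p|om _]; last exact: cP.
move=> _ B mB; rewrite setTI.
have -> : (fun om => Phi_ p (bits_of beta om)) @^-1` B =
    [set om | `[< B (Phi_ p (bits_of beta om)) >]].
  by apply/seteqP; split => om /= /asboolP.
have [S SZ dS] := dP p.
apply: (sigma_bits_event (S := S) (phi := fun b => `[< B (Phi_ p b) >])) => //.
by move=> b b' h; rewrite (dS b b').
Qed.

Lemma tame_measurable Z Phi : tame Z Phi ->
  measurable_fun setT (fun om => Phi (bits_of beta om)).
Proof.
move=> tP _ B mB; rewrite setTI.
exact: (sigma_bits_measurable (tame_sigma_measurable tP mB)).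
Qed.

Lemma tame_integrable Z Phi : tame Z Phi ->
  P.-integrable setT (EFin \o (fun om => Phi (bits_of beta om))).
Proof.
move=> tP; have [C PC] := tame_bounded tP.
by apply: (@bounded_integrable _ C) => //; exact: tame_measurable tP.
Qed.

Lemma Ex_tame_sum Z {J : Type} (s : seq J) (Phi : J -> bits N -> R) :
  (forall j, tame Z (Phi j)) ->
  Ex (fun b => \sum_(j <- s) Phi j b) = \sum_(j <- s) Ex (Phi j).
Proof. by move=> tP; apply: (Ex_sum _ _).2 => j; exact: tame_integrable (tP j). Qed.

Lemma Ex_itv Z Phi : tame Z Phi -> (forall b, 0 <= Phi b <= 1) -> 0 <= Ex Phi <= 1.
Proof.
move=> tP P01; apply/andP; split.
  by apply: Rintegral_ge0 => om _; have /andP[] := P01 (bits_of beta om).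
rewrite -[leRHS](Ex_cst 1); apply: le_Rintegral => //.
- exact: tame_integrable tP.
- exact: tame_integrable (tame_cst setT 1).
- by move=> om _; have /andP[] := P01 (bits_of beta om).
Qed.

(** The conditional expectation given the bits j > k. *)
Definition cond_avg k (Phi : bits N -> R) : bits N -> R :=
  fun b => Ex (fun b' => Phi (merge k b b')).

Lemma cond_avg_cvg k Z Phi : tame Z Phi -> exists Phi_ : nat -> bits N -> R, exists C : R,
  [/\ forall p, exists2 S, (forall j, j \in S -> Z j) & depends S (Phi_ p),
      forall p b, `|Phi_ p b| <= C & forall b, Phi_ p b @[p --> \oo] --> Phi b] /\
  [/\ forall p, exists2 S, (forall j, j \in S -> Z j /\ k < j) & depends S (cond_avg k (Phi_ p)),
      forall p b, `|cond_avg k (Phi_ p) b| <= C &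
      forall b, cond_avg k (Phi_ p) b @[p --> \oo] --> cond_avg k Phi b].
Proof.
move=> [Phi_ [C [dP PC cP]]]; exists Phi_, C.
have tm p b : exists2 S, (forall j, j \in S -> Z j) & depends S (fun b' => Phi_ p (merge k b b')).
  have [S SZ dS] := dP p; exists S => // b1 b2 h; apply: dS => j jS.
  by rewrite /merge h.
have im p b : P.-integrable setT (EFin \o (fun om => Phi_ p (merge k b (bits_of beta om)))).
  by have [S SZ dS] := tm p b; exact: (Ex_integrable dS).
split; split => //.
- move=> p; have [S SZ dS] := dP p; exists [seq j <- S | k < j].
    by move=> j; rewrite mem_filter => /andP[kj /SZ].
  move=> b b' h; congr Ex; apply/funext => b2; apply: dS => j jS.
  by rewrite /merge; case: ifP => // kj; apply: h; rewrite mem_filter kj.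
- move=> p b; apply: (le_trans (le_normr_Rintegral measurableT (im p b))).
  rewrite -[leRHS]Ex_cst; apply: le_Rintegral => //; first exact: integrable_norm (im p b).
  exact: tame_integrable (tame_cst setT C).
- move=> b; apply: (@Ex_cvg (fun p b' => Phi_ p (merge k b b')) _ C) => //.
  by move=> p; have [S SZ dS] := tm p b; exact: (measurable_bits dS).
Qed.

Lemma tame_cond_avg k Z Phi : tame Z Phi -> tame [set j | Z j /\ k < j] (cond_avg k Phi).
Proof.
by move=> /(cond_avg_cvg k)[Phi_ [C [_ [dc cc cvgc]]]]; exists (fun p => cond_avg k (Phi_ p)), C.
Qed.

Lemma Ex_cond_avg k Z Phi : tame Z Phi -> Ex (cond_avg k Phi) = Ex Phi.
Proof.
move=> /(cond_avg_cvg k)[Phi_ [C [[dP PC cP] [dc cc cvgc]]]].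
have c1 : Ex (Phi_ p) @[p --> \oo] --> Ex Phi.
  apply: (Ex_cvg _ PC cP) => p; have [S SZ dS] := dP p; exact: measurable_bits dS.
have c2 : Ex (cond_avg k (Phi_ p)) @[p --> \oo] --> Ex (cond_avg k Phi).
  apply: (Ex_cvg _ cc cvgc) => p; have [S SZ dS] := dc p; exact: measurable_bits dS.
rewrite -(cvg_lim _ c2)// -(cvg_lim _ c1)//; congr (limn _); apply/funext => p.
by have [S SZ dS] := dP p; rewrite [RHS](Ex_merge_depends k dS (PC p)).
Qed.

(** The bits above k act as constants. *)
Lemma cond_avgM k Z Phi Psi : tame Z Phi -> tame [set j | k < j] Psi ->
  cond_avg k (fun b => Phi b * Psi b) = (fun b => cond_avg k Phi b * Psi b).
Proof.
move=> tP tS; apply/funext => b; rewrite /cond_avg.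
have -> : (fun b' => Phi (merge k b b') * Psi (merge k b b')) =
    (fun b' => Psi b * Phi (merge k b b')).
  apply/funext => b'; rewrite mulrC; congr (_ * _).
  by apply: (tame_agree tS) => j /= kj; rewrite /merge kj.
rewrite ExZ 1?mulrC//.
have [Phi_ [C [dP PC cP]]] := tP.
have : tame setT (fun b' => Phi (merge k b b')).
  exists (fun p b' => Phi_ p (merge k b b')), C; split => // p.
  have [S SZ dS] := dP p; exists S => // b1 b2 h; apply: dS => j jS.
  by rewrite /merge h.
exact: tame_integrable.
Qed.

Lemma Ex_condM k Z Phi Psi : tame Z Phi -> tame [set j | k < j] Psi ->
  Ex (fun b => Phi b * Psi b) = Ex (fun b => cond_avg k Phi b * Psi b).
Proof.
move=> tP tS; rewrite -(cond_avgM tP tS).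
rewrite (@Ex_cond_avg k setT)//; apply: tameM.
  exact: tame_sub tP.
exact: tame_sub tS.
Qed.

Lemma Ex_indep k Phi Psi : tame [set j | j <= k] Phi -> tame [set j | k < j] Psi ->
  Ex (fun b => Phi b * Psi b) = Ex Phi * Ex Psi.
Proof.
move=> tP tS; rewrite (Ex_condM tP tS) -ExZ; last exact: tame_integrable tS.
congr Ex; apply/funext => b; congr (_ * _); congr Ex; apply/funext => b'.
by apply: (tame_agree tP) => j /= jk; rewrite /merge ltNge jk.
Qed.

End random_bits.

(** * Versions of the conditional expectation *)

Section conditional_expectation.
Context {d : measure_display} {Omega : measurableType d} {R : realType}.
Variables (P : probability Omega R) (N : nat) (beta : int -> {RV P >-> N.-tuple bool}).
Hypotheses (beta_unif : uniform_bits beta) (beta_indep : independent_bits beta).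
Local Notation Ex := (Ex beta).
Local Notation cond_avg := (cond_avg beta).

Definition cylinders (Z : set int) : set (set Omega) :=
  [set A | exists2 S, (forall j, j \in S -> Z j) & exists2 phi : bits N -> bool,
    depends S phi & A = [set om | phi (bits_of beta om)]].

Lemma cylinders_setI Z : setI_closed (cylinders Z).
Proof.
move=> A B [S SZ [phi dphi ->]] [S' SZ' [psi dpsi ->]].
exists (S ++ S'); first by move=> j; rewrite mem_cat => /orP[/SZ|/SZ'].
exists (fun b => phi b && psi b).
  move=> b b' h; rewrite (dphi b b') ?(dpsi b b')// => j jS; apply: h;
  by rewrite mem_cat jS ?orbT.
by apply/seteqP; split => om /=; [move=> [-> ->]|move=> /andP[]].
Qed.

Lemma sigma_bits_cylinders Z : sigma_bits beta Z `<=` <<s cylinders Z >>.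
Proof.
apply: smallest_sub; first exact: smallest_sigma_algebra.
move=> _ [j Zj [B mB ->]]; apply: sub_sigma_algebra.
exists [:: j]; first by move=> i; rewrite inE => /eqP ->.
exists (fun b => `[< B (b j) >]); first by move=> b b' h; rewrite h ?mem_head.
by apply/seteqP; split => om /= /asboolP.
Qed.

Lemma bounded_mul_indic_integrable (X : Omega -> R) (C : R) A : measurable A ->
  measurable_fun setT X -> (forall om, `|X om| <= C) ->
  P.-integrable setT (EFin \o (fun om => X om * \1_A om)).
Proof.
move=> mA mX XC; apply: (@bounded_integrable _ _ _ _ _ C).
  by apply: measurable_funM => //; exact: measurable_indic.
move=> om; rewrite normrM -[leRHS]mulr1 ler_pM//.
by rewrite ger0_norm//.
Qed.

(** Dynkin argument: the cylinders are closed under intersection, and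
    orthogonality to X passes to proper differences and increasing unions. *)
Lemma orthogonal_sigma_bits Z (X : Omega -> R) (C : R) :
  measurable_fun setT X -> (forall om, `|X om| <= C) ->
  (forall A, cylinders Z A -> \int[P]_om (X om * \1_A om) = 0) ->
  forall A, sigma_bits beta Z A -> \int[P]_om (X om * \1_A om) = 0.
Proof.
move=> mX XC cyl0.
pose H := [set A : set Omega | measurable A /\ \int[P]_om (X om * \1_A om) = 0].
have mcyl A : cylinders Z A -> measurable A.
  move=> [S SZ [phi dphi ->]].
  exact: (sigma_bits_measurable (sigma_bits_event SZ dphi)).
suff sub : <<s cylinders Z >> `<=` H by move=> A /sigma_bits_cylinders/sub[].
have Xi A mA := @bounded_mul_indic_integrable X C A mA mX XC.
apply: (lambda_system_subset (@cylinders_setI Z)) => //.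
- split => //.
  + split=> //; apply: cyl0; exists [::] => //; exists (fun=> true) => //.
    by apply/seteqP; split.
  + move=> A B BA [mA A0] [mB B0]; split; first exact: measurableD.
    rewrite -[RHS](subrr 0) -{1}A0 -B0 -RintegralB//; [|exact: Xi..].
    apply: eq_Rintegral => om _; rewrite -mulrBr; congr (_ * _); rewrite !indicE in_setD.
    have [xB|] := boolP (om \in B); last by rewrite subr0 andbT.
    by rewrite (_ : om \in A) ?subrr//; apply/mem_set/BA; rewrite -inE.
  + move=> F ndF HF; have mF n : measurable (F n) := (HF n).1.
    have mU : measurable (\bigcup_n F n) by exact: bigcup_measurable.
    split => //.
    have : \int[P]_om (X om * \1_(F n) om) @[n --> \oo] -->
        \int[P]_om (X om * \1_(\bigcup_n F n) om).
      apply: (@Rintegral_cvg _ _ _ P _ _ (fun=> C)).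
      * by move=> n; apply: measurable_funM => //; exact: measurable_indic.
      * exact: finite_measure_integrable_cst.
      * by move=> n om; rewrite normrM -[leRHS]mulr1 ler_pM// ger0_norm.
      * move=> om; apply: cvgMr; have [[n _ xF]|xF] := pselect ((\bigcup_n F n) om).
          apply: cvg_near_cst; exists n => // k /= nk; rewrite !indicE !mem_set//.
            by exists n.
          by have /subsetPset := ndF _ _ nk; exact.
        apply: cvg_near_cst; apply: nearW => k; rewrite !indicE !memNset//.
        by move=> xk; apply: xF; exists k.
    under eq_fun do rewrite (HF _).2.
    by move/(cvg_lim (@Rhausdorff R)) => <-; rewrite lim_cst.
- move=> A cA; split; [exact: mcyl | exact: cyl0].
Qed.

(** Averaging over the bits j <= k is a version of the conditional expectation
    given the other bits, and any other version Y agrees with it almost surely: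
    the difference is measurable for the sigma-algebra of these bits and
    orthogonal to it, in particular to the event where it is positive. *)
Lemma cond_exp_cond_avg (k : int) (F : bits N -> R) (Y : Omega -> R) : tame setT F ->
  is_cond_exp P (sigma_bits beta [set j | k < j]) (fun om => F (bits_of beta om)) Y ->
  {ae P, forall om, Y om = cond_avg k F (bits_of beta om)}.
Proof.
move=> tF [mY iY YF]; set Z := [set j | k < j] in mY YF *.
have tc : tame Z (cond_avg k F).
  by apply: tame_sub (tame_cond_avg beta k tF) => j [].
pose c om := cond_avg k F (bits_of beta om).
pose X om := F (bits_of beta om) - c om.
have mX : measurable_fun setT X.
  by apply: measurable_funB; [exact: (tame_measurable beta tF) | exact: (tame_measurable beta tc)].
have [C XC] : exists C : R, forall om, `|X om| <= C.
  have [C1 h1] := tame_bounded tF; have [C2 h2] := tame_bounded tc.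
  exists (C1 + C2) => om; apply: (le_trans (ler_normB _ _)).
  by apply: lerD; [exact: h1 | exact: h2].
have iF : P.-integrable setT (EFin \o (fun om => F (bits_of beta om))).
  exact: (tame_integrable beta tF).
have ic : P.-integrable setT (EFin \o c) by exact: (tame_integrable beta tc).
have X0 A : sigma_bits beta Z A -> \int[P]_om (X om * \1_A om) = 0.
  apply: (orthogonal_sigma_bits mX XC) => {}A [S SZ [phi dphi ->]].
  have tphi : tame Z (fun b => (phi b)%:R : R).
    apply: (tame_depends (S := S) (C := 1)) => //.
      by move=> b b' h; rewrite (dphi b b').
    by move=> b; case: (phi b); rewrite ?normr1 ?normr0.
  have := Ex_condM beta_unif beta_indep tF tphi.
  move/eqP; rewrite -subr_eq0 => /eqP <-; rewrite /Ex -RintegralB//; last 2 first.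
  - exact: (tame_integrable beta (tameM tF (tame_sub (@subsetT _ Z) tphi))).
  - exact: (tame_integrable beta (tameM tc tphi)).
  apply: eq_Rintegral => om _; rewrite -mulrBl; congr (_ * _).
  by rewrite indicE; congr ((nat_of_bool _)%:R); apply/idP/idP; rewrite inE.
pose D om := Y om - c om.
pose G := [set A | exists2 j, Z j & exists2 B, measurable B & A = beta j @^-1` B].
have mYG : measurable_fun [set: g_sigma_algebraType G] Y.
  by move=> _ B mB; rewrite setTI; exact: mY.
have mcG : measurable_fun [set: g_sigma_algebraType G] c.
  have mc : forall B, measurable B -> sigma_bits beta Z (c @^-1` B).
    exact: tame_sigma_measurable tc.
  by move=> _ B mB; rewrite setTI; exact: mc.
have mDG : measurable_fun [set: g_sigma_algebraType G] D by exact: measurable_funB.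
have mYo : measurable_fun [set: Omega] Y.
  by move=> _ B mB; rewrite setTI; exact: sigma_bits_measurable (mY B mB).
have mD : measurable_fun [set: Omega] D.
  by apply: measurable_funB => //; exact: (tame_measurable beta tc).
have iD : P.-integrable setT (EFin \o D).
  by have := integrableB measurableT iY ic; apply: eq_integrable.
have iDA A : measurable A -> P.-integrable setT (EFin \o (fun om => D om * \1_A om)).
  move=> mA; apply: (le_integrableR _ (integrable_norm iD)).
    by apply: measurable_funM => //; exact: measurable_indic.
  by move=> om; rewrite /= normrM -[leRHS]mulr1 ler_pM// ger0_norm.
have D0 A : sigma_bits beta Z A -> \int[P]_om (D om * \1_A om) = 0.
  move=> sA; have mA := sigma_bits_measurable sA.
  have EA (V : Omega -> R) : \int[P]_om (V om * \1_A om) = \int[P]_(om in A) V om.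
    by rewrite [RHS]Rintegral_mkcond patch_indic.
  have := X0 A sA; rewrite !EA /X /D => /eqP.
  have sub (V : Omega -> R) : P.-integrable setT (EFin \o V) -> P.-integrable A (EFin \o V).
    by apply: integrableS.
  rewrite !RintegralB//; try exact: sub.
  move=> /eqP <-; congr (_ - _); exact: (congr1 fine (YF A sA)).
pose A1 := [set om | 0 < D om].
have sA1 : sigma_bits beta Z A1.
  have := mDG measurableT `]0, +oo[%classic (measurable_itv _); rewrite setTI.
  by congr (sigma_bits beta Z _); apply/seteqP; split => om /=; rewrite in_itv/= andbT.
have mA1 := sigma_bits_measurable sA1.
have sT : sigma_bits beta Z setT by have := measurableT (s := g_sigma_algebraType G).
have : \int[P]_om `|D om| = 0.
  rewrite (_ : 0 = 2 * 0 - 0); last by rewrite mulr0 subr0.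
  rewrite -{1}(D0 _ sA1) -{1}(D0 _ sT) -RintegralZl//; last exact: iDA.
  rewrite -RintegralB//; last exact: iDA.
    apply: eq_Rintegral => om _; rewrite !indicE in_setT mulr1.
    have [|] := boolP (om \in A1).
      by rewrite inE /A1/= => Dp; rewrite gtr0_norm//; ring.
    by rewrite notin_setE /A1/= => /negP; rewrite -leNgt => Dn; rewrite ler0_norm//; ring.
  by apply: integrableZR; exact: iDA.
move=> i0; have : (\int[P]_om `|(EFin \o D) om| = 0)%E.
  have h : P.-integrable setT (EFin \o (fun om => `|D om|)) := integrable_norm iD.
  by rewrite -[LHS](fineK (integrable_fin_num measurableT h)); congr (_%:E).
move=> i1; have mDE : measurable_fun setT (EFin \o D) by exact/measurable_EFinP.
have := (ae_eq_integral_abs P measurableT mDE).1 i1.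
by apply: filterS => om /(_ Logic.I) [] /eqP; rewrite subr_eq0 => /eqP.
Qed.

End conditional_expectation.

(** * Goodness as a function of the bits *)

Section similarities.
Context {R : realType} {N : nat}.
Implicit Types (x y v : Rn R N) (Q K : cube R N) (l : R).

Definition sim_pt l v x : Rn R N := [tuple l * coor x i + coor v i | i < N].

Definition sim_cube l v Q : cube R N := (sim_pt l v (corner Q), l * side Q).

Lemma inf_scale (S S' : set R) l : 0 < l -> (forall s, S s -> 0 <= s) ->
  (forall s, S' s <-> exists2 t, S t & s = l * t) -> inf S' = l * inf S.
Proof.
move=> l0 S0 SS'.
have [S00|/set0P[s0 s0S]] := eqVneq S set0.
  rewrite S00 (_ : S' = set0) ?inf0 ?mulr0//.
  by apply/seteqP; split => // s /SS'[t]; rewrite S00.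
have lbS : has_lbound S by exists 0 => s; exact: S0.
have lbS' : has_lbound S'.
  by exists 0 => _ /SS'[t tS ->]; apply: mulr_ge0; [exact: ltW | exact: S0].
apply/eqP; rewrite eq_le; apply/andP; split.
  rewrite -ler_pdivrMl//; apply: lb_le_inf; first by exists s0.
  by move=> s sS; rewrite ler_pdivrMl//; apply: ge_inf => //; apply/SS'; exists s.
apply: lb_le_inf; first by exists (l * s0); apply/SS'; exists s0.
by move=> _ /SS'[t tS ->]; rewrite ler_pM2l//; exact: ge_inf.
Qed.

Section fixed_similarity.
Variables (l : R) (v : Rn R N).
Hypothesis l0 : 0 < l.

Definition sim_inv x : Rn R N := [tuple l^-1 * (coor x i - coor v i) | i < N].

Lemma sim_invK x : sim_pt l v (sim_inv x) = x.
Proof.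
apply: eq_from_tnth => i; rewrite tnth_mktuple coor_tuple mulrA divff ?gt_eqF//.
by rewrite mul1r subrK.
Qed.

Lemma cube_set_sim Q x : cube_set (sim_cube l v Q) (sim_pt l v x) <-> cube_set Q x.
Proof.
have E i : (coor (corner (sim_cube l v Q)) i <= coor (sim_pt l v x) i <
    coor (corner (sim_cube l v Q)) i + side (sim_cube l v Q)) =
    (coor (corner Q) i <= coor x i < coor (corner Q) i + side Q).
  rewrite /sim_cube/sim_pt {1 3}/corner {1}/side/= !coor_tuple lerD2r ler_pM2l//.
  by rewrite addrAC ltrD2r -mulrDr ltr_pM2l.
by split => h i; [rewrite -E|rewrite E].
Qed.

Lemma eucl_dist_sim x y : eucl_dist (sim_pt l v x) (sim_pt l v y) = l * eucl_dist x y.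
Proof.
rewrite /eucl_dist; under eq_bigr => i _.
  rewrite !coor_tuple opprD addrACA subrr addr0 -mulrBr exprMn; over.
by rewrite -mulr_sumr sqrtrM ?sqr_ge0// sqrtr_sqr gtr0_norm.
Qed.

Lemma frontier_sim Q y : frontier (cube_set (sim_cube l v Q)) (sim_pt l v y) <->
  frontier (cube_set Q) y.
Proof.
split=> fQ e e0.
  have [[x xQ xy] [x' x'Q x'y]] := fQ (l * e) (mulr_gt0 l0 e0); split.
    exists (sim_inv x); first by rewrite -cube_set_sim sim_invK.
    by rewrite -(ltr_pM2l l0) -eucl_dist_sim sim_invK.
  exists (sim_inv x'); first by rewrite -cube_set_sim sim_invK.
  by rewrite -(ltr_pM2l l0) -eucl_dist_sim sim_invK.
have le0 : 0 < l^-1 * e by rewrite mulr_gt0// invr_gt0.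
have [[x xQ xy] [x' x'Q x'y]] := fQ _ le0.
split.
  by exists (sim_pt l v x); [exact/cube_set_sim | rewrite eucl_dist_sim -ltr_pdivlMl].
by exists (sim_pt l v x'); [rewrite cube_set_sim | rewrite eucl_dist_sim -ltr_pdivlMl].
Qed.

Lemma setdist_sim Q K :
  setdist (cube_set (sim_cube l v Q)) (frontier (cube_set (sim_cube l v K))) =
  l * setdist (cube_set Q) (frontier (cube_set K)).
Proof.
apply: inf_scale => // [s [x [y [_ _ ->]]]|s]; first exact: sqrtr_ge0.
split.
  move=> [x [y [xQ yK ->]]]; exists (eucl_dist (sim_inv x) (sim_inv y)).
    exists (sim_inv x), (sim_inv y); split => //.
      by rewrite -cube_set_sim sim_invK.
    by rewrite -frontier_sim sim_invK.
  by rewrite -eucl_dist_sim !sim_invK.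
move=> [_ [x [y [xQ yK ->]]] ->].
exists (sim_pt l v x), (sim_pt l v y); split; last by rewrite eucl_dist_sim.
  exact/cube_set_sim.
exact/frontier_sim.
Qed.

(** The distance and the threshold l(Q)^gamma l(K)^(1 - gamma) are both
    homogeneous of degree one. *)
Lemma close_to_frontier_sim (gamma : R) Q K : 0 <= side Q -> 0 <= side K ->
  close_to_frontier gamma (sim_cube l v Q) (sim_cube l v K) <->
  close_to_frontier gamma Q K.
Proof.
move=> Q0 K0; rewrite /close_to_frontier setdist_sim {1 2}/side/=.
rewrite !powRM ?(ltW l0)// mulrACA -powRD; last by rewrite (gt_eqF l0) implybT.
by rewrite addrC subrK powRr1 ?(ltW l0)// ler_pM2l.
Qed.

End fixed_similarity.
End similarities.

Section goodness.
Context {R : realType} {N : nat}.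
Variables (r : nat) (gamma : R).
Implicit Types (b : bits N) (k : int) (I J : dyadic N).

(** The integer with binary digits b k, b (k - 1), ... in each coordinate: the
    shift, in units of cubes of generation k, of the grid n generations coarser
    relative to the grid of generation k. *)
Definition low_bits (n : nat) k b (i : 'I_N) : int :=
  \sum_(p < n) (tnth (b (k - p%:Z)) i)%:Z * 2 ^+ p.

Lemma low_bitsS n k b i :
  low_bits n.+1 k b i = low_bits n k b i + (tnth (b (k - n%:Z)) i)%:Z * 2 ^+ n.
Proof. by rewrite /low_bits big_ord_recr. Qed.

Lemma low_bits_add L n k b i :
  low_bits (L + n) k b i = low_bits L k b i + 2 ^+ L * low_bits n (k - L%:Z) b i.
Proof.
elim: n => [|n ih]; first by rewrite addn0 /low_bits [X in _ * X]big_ord0 mulr0 addr0.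
rewrite addnS !low_bitsS ih -addrA mulrDr; congr (_ + (_ + _)).
rewrite exprD mulrCA; congr (_ * (_ * _)); congr ((nat_of_bool (tnth (b _) i))%:Z).
by lia.
Qed.

Lemma depends_low_bits n k :
  depends [seq k - p%:Z | p <- iota 0 n] (fun b => low_bits n k b).
Proof.
move=> b b' h; apply/funext => i; apply: eq_bigr => p _; rewrite h//.
by apply/mapP; exists (val p) => //; rewrite mem_iota/=.
Qed.

Lemma bit_shift_low_bits (n : nat) k b i :
  bit_shift (k - n%:Z) b i = 2 ^ (- k) * (low_bits n k b i)%:~R + bit_shift k b i :> R.
Proof.
elim: n => [|n ih]; first by rewrite /low_bits big_ord0 mulr0 add0r subr0.
rewrite bit_shift_rec (_ : k - n.+1%:Z + 1 = k - n%:Z); last by lia.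
have -> : (2 : R) ^ (- (k - n%:Z)) = 2 ^ (- k) * 2 ^+ n.
  by rewrite opprB addrC pow2D -exprnP.
rewrite ih low_bitsS intrD intrM rmorphXn/=.
have E (c : bool) : (c%:Z)%:~R = c%:R :> R by [].
by rewrite E; ring.
Qed.

Definition int_cube (v : 'I_N -> int) (L : nat) : cube R N :=
  ([tuple (v i)%:~R | i < N], 2 ^+ L).

Definition close_int v v' L := close_to_frontier gamma (int_cube v 0) (int_cube v' L).

Lemma close_int_translate v v' t L :
  close_int (fun i => v i + t i) (fun i => v' i + t i) L <-> close_int v v' L.
Proof.
have E u n : int_cube (fun i => u i + t i) n =
    sim_cube 1 ([tuple (t i)%:~R | i < N] : Rn R N) (int_cube u n).
  rewrite /sim_cube /side/= mul1r; congr pair.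
  by apply: eq_from_tnth => i; rewrite !tnth_mktuple !coor_tuple mul1r intrD.
rewrite /close_int !E; apply: close_to_frontier_sim => //; rewrite /side/= exprn_ge0//.
Qed.

(** Seen from a cube of generation k rescaled to the unit cube, the position of a
    cube L generations coarser only depends on the L bits in between. *)
Lemma close_dshift k (m M : N.-tuple int) (L : nat) b :
  close_to_frontier gamma (dshift (k, m) b) (dshift (k - L%:Z, M) b) <->
  close_int (tnth m) (fun i => 2 ^+ L * tnth M i + low_bits L k b i) L.
Proof.
pose v : Rn R N := [tuple bit_shift k b i | i < N].
have E1 : dshift (k, m) b = sim_cube (2 ^ (- k)) v (int_cube (tnth m) 0).
  rewrite /sim_cube /dshift /dside /side/= mulr1; congr pair.
  by apply: eq_from_tnth => i; rewrite !tnth_mktuple !coor_tuple.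
have p2 : (2 : R) ^ (- (k - L%:Z)) = 2 ^ (- k) * 2 ^+ L.
  by rewrite opprB addrC pow2D -exprnP.
have E2 : dshift (k - L%:Z, M) b = sim_cube (2 ^ (- k)) v
    (int_cube (fun i => 2 ^+ L * tnth M i + low_bits L k b i) L).
  rewrite /sim_cube /dshift /dside /side/= p2; congr pair.
  apply: eq_from_tnth => i; rewrite !tnth_mktuple !coor_tuple bit_shift_low_bits.
  by rewrite intrD intrM rmorphXn/= mulrDr -!mulrA addrA.
rewrite E1 E2; apply: close_to_frontier_sim; first exact: pow2_gt0.
  by rewrite /side/= exprn_ge0.
by rewrite /side/= exprn_ge0.
Qed.

(** These approximations depend on finitely many bits and decrease to goodness as
    n grows. *)
Definition good_upto (n : nat) I b : bool :=
  `[< forall L M, (r <= L <= n)%N ->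
      ~ close_to_frontier gamma (dshift I b) (dshift (I.1 - L%:Z, M) b) >].

Lemma good_uptoE n k m b : good_upto n (k, m) b =
  `[< forall L (M : N.-tuple int), (r <= L <= n)%N ->
      ~ close_int (tnth m) (fun i => 2 ^+ L * tnth M i + low_bits L k b i) L >].
Proof.
apply: asbool_equiv_eq; split => h L M rL; first by rewrite -close_dshift; exact: h.
by rewrite close_dshift; exact: h.
Qed.

Lemma side_cmp (I K : dyadic N) (n : nat) :
  (2 ^+ n * dside R I <= dside R K) = (K.1 <= I.1 - n%:Z).
Proof. by rewrite /dside exprnP -pow2D ler_pow2; apply/idP/idP; lia. Qed.

Lemma goodP I b : good r gamma b (dshift I b) <-> forall n, good_upto n I b.
Proof.
split=> [[_ nK] n|h].
  apply/asboolP => L M /andP[rL _] cl; apply: nK.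
  exists (dshift (I.1 - L%:Z, M) b); split => //; first by exists (I.1 - L%:Z, M).
  have := side_cmp I (I.1 - L%:Z, M) r; rewrite /dshift/side/= => ->.
  by lia.
split; first by exists I.
move=> [_ [[K _ <-] sK cl]].
move: sK; have := side_cmp I K r; rewrite {1 2}/dshift/side/= => -> KI.
have KL : K.1 = I.1 - `|I.1 - K.1|%N%:Z by lia.
have /asboolP/(_ `|I.1 - K.1|%N K.2) := h `|I.1 - K.1|%N.
by rewrite -KL -surjective_pairing; apply => //; lia.
Qed.

(** The cubes with side length between 2^r l(I) and l(J) are those of the
    generations I.1 - L with r <= L <= I.1 - J.1. *)
Lemma good_wrtP I J b : J.1 <= I.1 ->
  good_wrt r gamma b (dshift I b) (dshift J b) <-> good_upto `|I.1 - J.1|%N I b.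
Proof.
move=> JI; split=> [gw|/asboolP gu].
  apply/asboolP => L M /andP[rL LJ]; apply: gw; first by exists (I.1 - L%:Z, M).
  have := side_cmp I (I.1 - L%:Z, M) r; have := side_cmp (I.1 - L%:Z, M) J 0.
  rewrite expr0 mul1r subr0 /dshift /side/= => -> ->.
  by apply/andP; split; lia.
move=> _ [K _ <-]; have := side_cmp I K r; have := side_cmp K J 0.
rewrite expr0 mul1r subr0 {3 4 5}/dshift /side/= => -> -> /andP[IK KJ].
have KL : K.1 = I.1 - `|I.1 - K.1|%N%:Z by lia.
have := gu `|I.1 - K.1|%N K.2.
by rewrite -KL -surjective_pairing; apply; lia.
Qed.

Definition good_ind I b : R := \1_(good r gamma b) (dshift I b).

Lemma good_ind_cvg I b : (good_upto n I b)%:R @[n --> \oo] --> good_ind I b.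
Proof.
apply: cvg_near_cst; rewrite /good_ind indicE.
have [g|ng] := pselect (good r gamma b (dshift I b)).
  by apply: nearW => n; rewrite mem_set// (goodP _ _).1.
have [n0 n0g] : exists n, ~~ good_upto n I b.
  by apply: contrapT => h; apply/ng/goodP => n; apply: contrapT => /negP hn; apply: h; exists n.
exists n0 => // n /= n0n; rewrite memNset//; apply/eqP; rewrite pnatr_eq0 eqb0.
apply: contra n0g => /asboolP h; apply/asboolP => L M /andP[rL Ln].
by apply: h; rewrite rL (leq_trans Ln).
Qed.

Lemma depends_good_upto n k m :
  depends [seq k - p%:Z | p <- iota 0 n] (good_upto n (k, m)).
Proof.
move=> b b' h; rewrite !good_uptoE.
have E L : (L <= n)%N -> low_bits L k b = low_bits L k b'.
  move=> Ln; apply: depends_low_bits => j /mapP[p]; rewrite mem_iota => pL ->.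
  by apply: h; apply/mapP; exists p => //; rewrite mem_iota; lia.
by apply: asbool_equiv_eq; split => H L M rL; have := H L M rL;
  have /andP[_ Ln] := rL; rewrite (E L Ln).
Qed.

Lemma tame_good_ind I : tame [set j | j <= I.1] (good_ind I).
Proof.
case: I => k m; exists (fun n b => (good_upto n (k, m) b)%:R), 1; split.
- move=> n; exists [seq k - p%:Z | p <- iota 0 n].
    by move=> j /mapP[p _ ->] /=; lia.
  by move=> b b' h; rewrite (depends_good_upto m h).
- by move=> n b; case: good_upto; rewrite ?normr1 ?normr0.
- by move=> b; exact: good_ind_cvg.
Qed.

Lemma good_ind_itv I b : 0 <= good_ind I b <= 1.
Proof. by rewrite /good_ind indicE; case: (_ \in _); rewrite /= lexx ?ler01. Qed.

End goodness.

(** * The probability of being good *)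

Section good_probability.
Context {d : measure_display} {Omega : measurableType d} {R : realType}.
Variables (P : probability Omega R) (N : nat) (beta : int -> {RV P >-> N.-tuple bool}).
Hypotheses (beta_unif : uniform_bits beta) (beta_indep : independent_bits beta).
Local Notation Ex := (Ex beta).
Variables (r : nat) (gamma : R).
Local Notation good_ind := (good_ind r gamma).
Local Notation good_upto := (@good_upto R N r gamma).

Definition flip (M : int) (e : bool) : bool := e (+) ((M %% 2)%Z == 1).

Lemma flipK M : involutive (flip M).
Proof. by move=> e; rewrite /flip addbK. Qed.

Lemma flip_half (M : int) (e : bool) :
  M - e%:Z = 2 * ((M - e%:Z + (flip M e)%:Z) %/ 2)%Z - (flip M e)%:Z.
Proof.
rewrite /flip; have := divz_eq M 2; have := @modz_ge0 M 2 isT; have := @ltz_pmod M 2 isT.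
case: eqVneq => M2; case: e => /=; lia.
Qed.

(** Subtracting independent uniform digits equidistributes modulo powers of two: the
    expectation does not see the starting point, and induction on the number of
    digits averages a function of period 2^n.+1 into one of period 2^n. *)
Lemma Ex_periodic n (g : ('I_N -> int) -> R) (C : R) :
  (forall v M, g (fun i => v i + 2 ^+ n * M i) = g v) -> (forall v, `|g v| <= C) ->
  exists c, forall k v, Ex (fun b => g (fun i => v i - low_bits n k b i)) = c.
Proof.
elim: n g => [|n ih] g per gC.
  exists (g (fun=> 0)) => k v; rewrite -[RHS](@Ex_cst _ _ _ P N beta).
  congr Ex; apply/funext => b; rewrite -[RHS](per _ v); congr g; apply/funext => i.
  by rewrite /low_bits big_ord0 subr0 add0r mul1r.
pose g' v := (2 ^+ N)^-1 * \sum_(e : N.-tuple bool) g (fun i => v i - 2 ^+ n * (tnth e i)%:Z).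
have per' v M : g' (fun i => v i + 2 ^+ n * M i) = g' v.
  rewrite /g'; congr (_ * _).
  pose fl (e : N.-tuple bool) : N.-tuple bool := [tuple flip (M i) (tnth e i) | i < N].
  have flK : involutive fl.
    by move=> e; apply: eq_from_tnth => i; rewrite !tnth_mktuple flipK.
  rewrite [RHS](reindex_inj (inv_inj flK)); apply: eq_bigr => e _.
  rewrite -[RHS](per _ (fun i => ((M i - (tnth e i)%:Z + (flip (M i) (tnth e i))%:Z) %/ 2)%Z)).
  congr g; apply/funext => i; rewrite tnth_mktuple.
  have := flip_half (M i) (tnth e i); move: (_ %/ 2)%Z => q h.
  rewrite -addrA -mulrBr h exprS; ring.
have g'C v : `|g' v| <= C.
  rewrite /g' normrM ger0_norm ?pow2N_ge0// -[leRHS](@avg_cst N) ler_wpM2l ?pow2N_ge0//.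
  by apply: (le_trans (ler_norm_sum _ _ _)); apply: ler_sum => e _.
have [c hc] := ih g' per' g'C; exists c => k v; rewrite -(hc k v).
have dg : depends [seq k - p%:Z | p <- iota 0 n.+1]
    (fun b => g (fun i => v i - low_bits n.+1 k b i)).
  by move=> b b' /depends_low_bits ->.
rewrite -(Ex_avg_bit beta_unif beta_indep (k - n%:Z) dg (fun b => gC _)).
congr Ex; apply/funext => b; rewrite /avg_bit /g'; congr (_ * _); apply: eq_bigr => e _.
congr g; apply/funext => i; rewrite low_bitsS /set_bit eqxx opprD addrA.
rewrite [X in _ - X]mulrC; congr (_ - _ - _).
apply: eq_bigr => p _; case: eqP => // kp; exfalso.
by have := ltn_ord p; lia.
Qed.

(** Goodness of the unit cube at v with respect to the unshifted grid. *)
Definition good_pos (n : nat) (v : 'I_N -> int) : bool :=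
  `[< forall L (M : N.-tuple int), (r <= L <= n)%N ->
      ~ close_int gamma v (fun i => 2 ^+ L * tnth M i) L >].

(** Translating the coarser grids back to the unshifted one turns the random grid
    into a random translation of the cube. *)
Lemma good_upto_pos n k m b :
  good_upto n (k, m) b = good_pos n (fun i => tnth m i - low_bits n k b i).
Proof.
rewrite good_uptoE; apply: asbool_equiv_eq.
pose q L i := low_bits (n - L) (k - L%:Z) b i.
have E L i : (L <= n)%N -> low_bits n k b i = low_bits L k b i + 2 ^+ L * q L i.
  by move=> Ln; rewrite -{1}(subnKC Ln) low_bits_add.
split=> H L M rL; have /andP[_ Ln] := rL.
  have := H L [tuple tnth M i + q L i | i < N] rL.
  rewrite -(close_int_translate _ _ _ (fun i => - low_bits n k b i)).
  rewrite [X in close_int _ _ X](_ : _ = (fun i => 2 ^+ L * tnth M i))//.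
  by apply/funext => i; rewrite tnth_mktuple (E L)//; ring.
have := H L [tuple tnth M i - q L i | i < N] rL.
rewrite -(close_int_translate _ _ _ (fun i => low_bits n k b i)).
rewrite [X in close_int _ X](_ : _ = tnth m); last by apply/funext => i; rewrite subrK.
rewrite [X in close_int _ _ X](_ : _ = (fun i => 2 ^+ L * tnth M i + low_bits L k b i))//.
by apply/funext => i; rewrite tnth_mktuple (E L)//; ring.
Qed.

Lemma good_pos_periodic n v (M0 : 'I_N -> int) :
  good_pos n (fun i => v i + 2 ^+ n * M0 i) = good_pos n v.
Proof.
have E L i : (L <= n)%N -> 2 ^+ n * M0 i = 2 ^+ L * (2 ^+ (n - L) * M0 i).
  by move=> Ln; rewrite mulrA -exprD subnKC.
apply: asbool_equiv_eq; split=> H L M rL; have /andP[_ Ln] := rL.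
  have := H L [tuple tnth M i + 2 ^+ (n - L) * M0 i | i < N] rL.
  rewrite -(close_int_translate _ _ _ (fun i => - (2 ^+ n * M0 i))).
  rewrite [X in close_int _ X](_ : _ = v); last by apply/funext => i; rewrite addrK.
  rewrite [X in close_int _ _ X](_ : _ = (fun i => 2 ^+ L * tnth M i))//.
  by apply/funext => i; rewrite tnth_mktuple (E L)//; ring.
have := H L [tuple tnth M i - 2 ^+ (n - L) * M0 i | i < N] rL.
rewrite -(close_int_translate _ _ _ (fun i => 2 ^+ n * M0 i)).
rewrite [X in close_int _ _ X](_ : _ = (fun i => 2 ^+ L * tnth M i))//.
by apply/funext => i; rewrite tnth_mktuple (E L)//; ring.
Qed.

(** The translation that the bits produce is uniform modulo 2^n, and goodness up
    to n generations has that period; hence its probability does not see the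
    starting position. *)
Lemma Ex_good_ind (I J : dyadic N) : Ex (good_ind I) = Ex (good_ind J).
Proof.
have cvg (K : dyadic N) : Ex (fun b => (good_upto n K b)%:R) @[n --> \oo] --> Ex (good_ind K).
  apply: (@Ex_cvg _ _ _ _ _ beta (fun n b => (good_upto n K b)%:R) _ 1).
  - move=> n; case: K => k m.
    have dg : depends [seq k - p%:Z | p <- iota 0 n] (fun b => (good_upto n (k, m) b)%:R : R).
      by move=> b b' h; rewrite (depends_good_upto _ _ _ h).
    exact: (measurable_bits beta dg).
  - by move=> n b; case: good_upto; rewrite ?normr1 ?normr0.
  - exact: good_ind_cvg.
suff E n : Ex (fun b => (good_upto n I b)%:R) = Ex (fun b => (good_upto n J b)%:R).
  have cI := cvg I.
  rewrite (_ : (fun n => _) = (fun n => Ex (fun b => (good_upto n J b)%:R))) in cI.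
    exact: (cvg_unique (@Rhausdorff R) cI (cvg J)).
  exact/funext.
have [v M|v|c hc] := @Ex_periodic n (fun v => (good_pos n v)%:R) 1.
- by rewrite good_pos_periodic.
- by case: good_pos; rewrite ?normr1 ?normr0.
have {}hc K : Ex (fun b => (good_upto n K b)%:R) = c.
  case: K => k m; rewrite -(hc k (tnth m)); congr Ex; apply/funext => b.
  by rewrite good_upto_pos.
by rewrite !hc.
Qed.

(** Badness of the pair is decided by the bits j > J.1, which the conditional
    average keeps: no choice of the other bits makes the smaller cube good. *)
Lemma cond_good_bad_pair (I J : dyadic N) b : J.1 <= I.1 ->
  ~~ good_upto `|I.1 - J.1|%N I b -> cond_avg beta J.1 (good_ind I) b = 0.
Proof.
move=> JI bad; rewrite -[RHS](@Ex_cst _ _ _ P N beta); congr Ex; apply/funext => b'.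
rewrite /good_ind indicE memNset// => /goodP gd; case/negP: bad.
case: I JI gd => k m /= JI gd.
rewrite -(depends_good_upto r gamma m (b := merge J.1 b b')); first exact: gd.
move=> j /mapP[p]; rewrite mem_iota => pL ->; rewrite /merge ifT//.
by lia.
Qed.

End good_probability.

(** * The averaging argument *)

Section averaging_argument.
Context {d : measure_display} {Omega : measurableType d} {R : realType}.
Variables (P : probability Omega R) (N : nat) (beta : int -> {RV P >-> N.-tuple bool}).
Hypotheses (beta_unif : uniform_bits beta) (beta_indep : independent_bits beta).
Local Notation Ex := (Ex beta).
Local Notation cond_avg := (cond_avg beta).
Local Notation above k := [set j : int | k < j].
Local Notation upto k := [set j : int | j <= k].

Variables (G : dyadic N -> bits N -> R) (pi : R).
Hypothesis tG : forall I, tame (upto I.1) (G I).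
Hypothesis EG : forall I, Ex (G I) = pi.

Variables (s : seq (dyadic N)) (t : dyadic N -> dyadic N -> bits N -> R).
Hypothesis t_le : forall I J, J.1 <= I.1 -> tame (above J.1) (t J I).
Hypothesis t_lt : forall I J, I.1 < J.1 -> tame (above I.1) (t J I).
Hypothesis sumJ : forall I, I \in s -> tame (above I.1) (fun b => \sum_(J <- s) t J I b).
Hypothesis sumI : forall J, J \in s -> tame (above J.1) (fun b => \sum_(I <- s) t J I b).

Lemma tameT Z Phi : tame Z Phi -> @tame R N setT Phi.
Proof. exact: tame_sub. Qed.

Lemma tame_t I J : tame setT (t J I).
Proof.
by have [IJ|IJ] := leP J.1 I.1; apply: tameT; [exact: t_le IJ | exact: t_lt IJ].
Qed.

(** The heart of the averaging.  Goodness of I depends on the bits j <= I.1, so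
    it is independent of the position of I and of all finer cubes, but not of
    the position of a coarser cube J.  The full sum over J only depends on the
    bits j > I.1, so that the factor pi comes out of it; it also comes out of
    each term with a finer J, and subtracting these terms leaves the coarser
    ones. *)
Lemma sum_good_finer I : I \in s ->
  \sum_(J <- s | J.1 <= I.1) Ex (fun b => t J I b * G I b) =
  pi * \sum_(J <- s | J.1 <= I.1) Ex (t J I).
Proof.
move=> Is.
have full : \sum_(J <- s) Ex (fun b => t J I b * G I b) = pi * \sum_(J <- s) Ex (t J I).
  rewrite -(Ex_tame_sum beta (Z := setT)); last first.
    by move=> J; apply: tameM; [exact: tame_t | exact: tameT (tG I)].
  rewrite -(Ex_tame_sum beta (Z := setT)); last by move=> J; exact: tame_t.
  under [in LHS]eq_fun do rewrite -mulr_suml mulrC.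
  by rewrite (Ex_indep beta_unif beta_indep (tG I) (sumJ Is)) EG.
apply: (@addIr _ (\sum_(J <- s | ~~ (J.1 <= I.1)) Ex (fun b => t J I b * G I b))).
rewrite (bigID (fun J : dyadic N => J.1 <= I.1))/= in full; rewrite full.
rewrite [in LHS](bigID (fun J : dyadic N => J.1 <= I.1))/= mulrDr; congr (_ + _).
rewrite mulr_sumr; apply: eq_bigr => J; rewrite -ltNge => IJ.
under [in RHS]eq_fun do rewrite mulrC.
by rewrite (Ex_indep beta_unif beta_indep (tG I) (t_lt IJ)) EG.
Qed.

Lemma sum_good_coarser J : J \in s ->
  \sum_(I <- s | I.1 < J.1) Ex (fun b => t J I b * G J b) =
  pi * \sum_(I <- s | I.1 < J.1) Ex (t J I).
Proof.
move=> Js.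
have full : \sum_(I <- s) Ex (fun b => t J I b * G J b) = pi * \sum_(I <- s) Ex (t J I).
  rewrite -(Ex_tame_sum beta (Z := setT)); last first.
    by move=> I; apply: tameM; [exact: tame_t | exact: tameT (tG J)].
  rewrite -(Ex_tame_sum beta (Z := setT)); last by move=> I; exact: tame_t.
  under [in LHS]eq_fun do rewrite -mulr_suml mulrC.
  by rewrite (Ex_indep beta_unif beta_indep (tG J) (sumI Js)) EG.
apply: (@addIr _ (\sum_(I <- s | ~~ (I.1 < J.1)) Ex (fun b => t J I b * G J b))).
rewrite (bigID (fun I : dyadic N => I.1 < J.1))/= in full; rewrite full.
rewrite [in LHS](bigID (fun I : dyadic N => I.1 < J.1))/= mulrDr; congr (_ + _).
rewrite mulr_sumr; apply: eq_bigr => I; rewrite -leNgt => JI.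
under [in RHS]eq_fun do rewrite mulrC.
by rewrite (Ex_indep beta_unif beta_indep (tG J) (t_le JI)) EG.
Qed.

Lemma tame_cond_above I k : tame (above k) (cond_avg k (G I)).
Proof. by apply: tame_sub (tame_cond_avg beta k (tG I)) => j []. Qed.

(** Goodness of the coarser cube J depends on the bits j <= J.1 and the other two
    factors on the bits j > J.1.  Once G J has been replaced by pi, the
    conditional average may be replaced by G I. *)
Lemma Ex_term_le I J : J.1 <= I.1 ->
  Ex (fun b => t J I b * cond_avg J.1 (G I) b * G J b) =
  pi * Ex (fun b => t J I b * G I b).
Proof.
move=> JI; under [in LHS]eq_fun do rewrite mulrC.
rewrite (Ex_indep beta_unif beta_indep (tG J)); last first.
  by apply: tameM; [exact: t_le | exact: tame_cond_above].
rewrite EG; congr (_ * _); under [in RHS]eq_fun do rewrite mulrC.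
rewrite (Ex_condM beta_unif beta_indep (tG I) (t_le JI)).
by congr Ex; apply/funext => b; rewrite mulrC.
Qed.

Lemma Ex_term_lt I J : I.1 < J.1 ->
  Ex (fun b => t J I b * G I b * cond_avg I.1 (G J) b) =
  pi * Ex (fun b => t J I b * G J b).
Proof.
move=> IJ; under [in LHS]eq_fun do rewrite mulrAC mulrC.
rewrite (Ex_indep beta_unif beta_indep (tG I)); last first.
  by apply: tameM; [exact: t_lt | exact: tame_cond_above].
rewrite EG; congr (_ * _); under [in RHS]eq_fun do rewrite mulrC.
rewrite (Ex_condM beta_unif beta_indep (tG J) (t_lt IJ)).
by congr Ex; apply/funext => b; rewrite mulrC.
Qed.

Definition weighted_sum b : R :=
  \sum_(I <- s) \sum_(J <- s | J.1 <= I.1) t J I b * cond_avg J.1 (G I) b * G J b +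
  \sum_(I <- s) \sum_(J <- s | I.1 < J.1) t J I b * G I b * cond_avg I.1 (G J) b.

Lemma tame_if Z (c : bool) Phi : @tame R N Z Phi -> tame Z (fun b => if c then Phi b else 0).
Proof. by case: c => // _; exact: tame_cst. Qed.

Lemma tame_term_le I J : tame setT (fun b => t J I b * cond_avg J.1 (G I) b * G J b).
Proof.
apply: tameM; last exact: tameT (tG J).
by apply: tameM; [exact: tame_t | exact: tameT (tame_cond_above I J.1)].
Qed.

Lemma tame_term_lt I J : tame setT (fun b => t J I b * G I b * cond_avg I.1 (G J) b).
Proof.
apply: tameM; last exact: tameT (tame_cond_above J I.1).
by apply: tameM; [exact: tame_t | exact: tameT (tG I)].
Qed.

Lemma tame_weighted_sum : tame setT weighted_sum.
Proof.
apply: tameD; apply: tame_sum => I; under eq_fun do rewrite big_mkcond;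
  apply: tame_sum => J; apply: tame_if; [exact: tame_term_le | exact: tame_term_lt].
Qed.

Lemma Ex_sum_cond (c : dyadic N -> bool) (Phi : dyadic N -> bits N -> R) :
  (forall J, tame setT (Phi J)) ->
  Ex (fun b => \sum_(J <- s | c J) Phi J b) = \sum_(J <- s | c J) Ex (Phi J).
Proof.
move=> tP; under [in LHS]eq_fun do rewrite big_mkcond.
rewrite (Ex_tame_sum beta (Z := setT)); last by move=> J; exact: tame_if.
rewrite [RHS]big_mkcond; apply: eq_bigr => J _; case: (c J) => //; exact: Ex_cst.
Qed.

Lemma tame_sum_cond (c : dyadic N -> bool) (Phi : dyadic N -> bits N -> R) :
  (forall J, tame setT (Phi J)) -> tame setT (fun b => \sum_(J <- s | c J) Phi J b).
Proof.
move=> tP; under eq_fun do rewrite big_mkcond.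
by apply: tame_sum => J; exact: tame_if.
Qed.

(** One factor pi comes from the larger cube of each pair and is extracted term by
    term; the other one comes from the smaller cube and can only be extracted
    from the sums. *)
Theorem Ex_weighted_sum :
  Ex weighted_sum = pi ^+ 2 * Ex (fun b => \sum_(I <- s) \sum_(J <- s) t J I b).
Proof.
pose A b := \sum_(I <- s) \sum_(J <- s | J.1 <= I.1) t J I b * cond_avg J.1 (G I) b * G J b.
pose B b := \sum_(I <- s) \sum_(J <- s | I.1 < J.1) t J I b * G I b * cond_avg I.1 (G J) b.
have tA : tame setT A.
  by apply: tame_sum => I; apply: tame_sum_cond => J; exact: tame_term_le.
have tB : tame setT B.
  by apply: tame_sum => I; apply: tame_sum_cond => J; exact: tame_term_lt.
have -> : Ex weighted_sum = Ex A + Ex B.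
  rewrite /Ex -RintegralD//; first exact: (tame_integrable beta tA).
  exact: (tame_integrable beta tB).
have -> : Ex A = pi * \sum_(I <- s) \sum_(J <- s | J.1 <= I.1) Ex (fun b => t J I b * G I b).
  rewrite (Ex_tame_sum beta (Z := setT)); last first.
    by move=> I; apply: tame_sum_cond => J; exact: tame_term_le.
  rewrite mulr_sumr; apply: eq_bigr => I _; rewrite Ex_sum_cond; last first.
    by move=> J; exact: tame_term_le.
  by rewrite mulr_sumr; apply: eq_bigr => J; exact: Ex_term_le.
have -> : Ex B = pi * \sum_(J <- s) \sum_(I <- s | I.1 < J.1) Ex (fun b => t J I b * G J b).
  rewrite (Ex_tame_sum beta (Z := setT)); last first.
    by move=> I; apply: tame_sum_cond => J; exact: tame_term_lt.
  rewrite [in RHS](exchange_big_dep predT)//= mulr_sumr; apply: eq_bigr => I _.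
  rewrite Ex_sum_cond; last by move=> J; exact: tame_term_lt.
  by rewrite mulr_sumr; apply: eq_bigr => J; exact: Ex_term_lt.
have -> : \sum_(I <- s) \sum_(J <- s | J.1 <= I.1) Ex (fun b => t J I b * G I b) =
    pi * \sum_(I <- s) \sum_(J <- s | J.1 <= I.1) Ex (t J I).
  rewrite mulr_sumr big_seq [RHS]big_seq; apply: eq_bigr => I; exact: sum_good_finer.
have -> : \sum_(J <- s) \sum_(I <- s | I.1 < J.1) Ex (fun b => t J I b * G J b) =
    pi * \sum_(J <- s) \sum_(I <- s | I.1 < J.1) Ex (t J I).
  rewrite mulr_sumr big_seq [RHS]big_seq; apply: eq_bigr => J; exact: sum_good_coarser.
rewrite -!mulrDr mulrA -expr2; congr (_ * _).
rewrite (Ex_tame_sum beta (Z := setT)); last first.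
  by move=> I; apply: tame_sum => J; exact: tame_t.
rewrite [X in _ + X](exchange_big_dep predT)//= -big_split/=; apply: eq_bigr => I _.
rewrite (Ex_tame_sum beta (Z := setT)); last by move=> J; exact: tame_t.
rewrite [RHS](bigID (fun J => J.1 <= I.1))/=; congr (_ + _).
by apply: eq_bigl => J; rewrite ltNge.
Qed.

End averaging_argument.

(** * Finite index sets and telescoping sums *)

Section index_boxes.
Context {N : nat}.

Definition ibox (B : nat) : seq (N.-tuple int) :=
  undup [seq [tuple (f i : nat)%:Z - B%:Z | i < N] | f : {ffun 'I_N -> 'I_(2 * B).+1}].

Lemma ibox_uniq B : uniq (ibox B).
Proof. exact: undup_uniq. Qed.

Lemma mem_ibox B (t : N.-tuple int) :
  (t \in ibox B) = [forall i : 'I_N, - B%:Z <= tnth t i <= B%:Z].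
Proof.
rewrite mem_undup; apply/mapP/forallP => [[f _ ->] i|h].
  rewrite tnth_mktuple; have := ltn_ord (f i); move: (nat_of_ord (f i)) => v.
  by move=> vB; apply/andP; split; lia.
exists [ffun i => inord (absz (tnth t i + B%:Z))]; first by rewrite mem_enum.
apply: eq_from_tnth => i; have /andP[h1 h2] := h i.
by rewrite [RHS]tnth_mktuple ffunE inordK; move: (tnth t i) h1 h2 => z; lia.
Qed.

End index_boxes.

Section index_levels.
Context {N : nat}.
Variables (m : int) (F : seq (N.-tuple int)).

Definition levels (q : nat) : seq (dyadic N) :=
  [seq (m + p%:Z, t) | p <- iota 0 q, t <- F].

Lemma levels_uniq q : uniq F -> uniq (levels q).
Proof.
move=> uF; apply: allpairs_uniq => //; first exact: iota_uniq.
by move=> [p t] [p' t'] _ _ /= [/eqP]; rewrite (inj_eq (addrI m)) => /eqP[->] ->.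
Qed.

Lemma mem_levels q (I : dyadic N) :
  (I \in levels q) = (m <= I.1 < m + q%:Z) && (I.2 \in F).
Proof.
apply/allpairsP/andP => [[[p t] /= [+ tF ->]]|[mI IF]] /=.
  by rewrite mem_iota => pq; split => //; lia.
exists (`|I.1 - m|%N, I.2) => /=; split => //; first by rewrite mem_iota; lia.
by case: I mI IF => k t /= mI _; congr pair; lia.
Qed.

End index_levels.

Section telescoping.
Context {R : realType} {N : nat}.
Local Notation mu := (leb R N).
Implicit Types (b : bits N) (x y : Rn R N).

Lemma loc_ibox b (k : int) (n : int) (M : R) (B : nat) x : 0 <= M -> k <= n ->
  2 ^ n * M + 2 <= B%:R -> loc b k x \notin ibox B -> exists i, M < `|coor x i|.
Proof.
move=> M0 kn MB; rewrite mem_ibox => /forallPn[i hi]; exists i.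
rewrite ltNge; apply: contra hi => xM.
have /andP[l1 l2] := loc_bound b k x i.
have p0 := @pow2_gt0 R k.
have kM : 2 ^ k * M <= 2 ^ n * M by rewrite ler_wpM2r// ler_pow2.
have : `|2 ^ k * coor x i| <= 2 ^ k * M.
  by rewrite normrM gtr0_norm// ler_pM2l.
rewrite ler_norml => /andP[x1 x2].
rewrite -!(ler_int R) mulrNz; apply/andP; split.
  by rewrite lerNl; move: l1 MB; rewrite -[(B%:Z)%:~R]/(B%:R); lra.
by move: l2 MB; rewrite -[(B%:Z)%:~R]/(B%:R); lra.
Qed.

Lemma ibox_loc b (k : int) (B : nat) x i : loc b k x \in ibox B ->
  `|coor x i| <= 2 ^ (- k) * (B%:R + 2).
Proof.
rewrite mem_ibox => /forallP/(_ i); rewrite -!(ler_int R) mulrNz.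
have /andP[l1 l2] := loc_bound b k x i; rewrite -[(B%:Z)%:~R]/(B%:R) => /andP[h1 h2].
rewrite pow2N ler_pdivlMl ?pow2_gt0// -[X in X * _]gtr0_norm ?pow2_gt0// -normrM.
by rewrite ler_norml; lra.
Qed.

Section fixed_function.
Variables (g : Rn R N -> R) (M : R).
Hypothesis mg : measurable_fun setT g.
Hypothesis g_supp : {ae mu, forall x, (exists i, M < `|coor x i|) -> g x = 0}.

Lemma avg_outside (Q : cube R N) :
  (forall y, cube_set Q y -> exists i, M < `|coor y i|) -> avg g Q = 0.
Proof.
move=> out; rewrite /avg Rintegral_cube (ae_eq_Rintegral (h := fun=> 0)).
- by rewrite Rintegral_cst// mul0r mulr0.
- by apply: measurable_funM => //; exact: indic_cube_measurable.
- exact: measurable_cst.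
- apply: filterS g_supp => x gx.
  have [xQ|xQ] := pselect (cube_set Q x); first by rewrite gx ?mul0r//; exact: out.
  by rewrite indicE memNset// mulr0.
Qed.

Variables (b : bits N) (m n : int) (F : seq (N.-tuple int)).
Hypothesis capF : forall (k : int) (x : Rn R N), m <= k -> k <= n -> loc b k x \notin F ->
  exists i, M < `|coor x i|.

Let parity (l : N.-tuple int) (k : int) : N.-tuple bool :=
  [tuple ((tnth l i - (tnth (b (k + 1)) i)%:Z) %% 2)%Z == 1 | i < N].

Let child_index (k : int) (t : N.-tuple int) (e : N.-tuple bool) : N.-tuple int :=
  [tuple 2 * tnth t i + (tnth (b (k + 1)) i)%:Z + (tnth e i)%:Z | i < N].

(** A point lies in exactly one child of the cube of generation k around it, the
    one given by the parities of its index of generation k + 1. *)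
Lemma child_index_loc (k : int) t e x :
  (child_index k t e == loc b (k + 1) x) =
  (t == loc b k x) && (e == parity (loc b (k + 1) x) k).
Proof.
apply/eqP/andP => [E|[/eqP -> /eqP ->]]; last first.
  apply: eq_from_tnth => i; rewrite [LHS]tnth_mktuple locS.
  move: (loc b (k + 1) x) => l; rewrite [tnth (parity _ _) _]tnth_mktuple.
  set z := tnth l i - _; have -> : tnth l i = z + (tnth (b (k + 1)) i)%:Z.
    by rewrite /z subrK.
  have := divz_eq z 2; have := @modz_ge0 z 2 isT; have := @ltz_pmod z 2 isT.
  by case: eqP => /= *; lia.
split; apply/eqP; apply: eq_from_tnth => i.
  by rewrite locS -E tnth_mktuple; case: (tnth e i) => /=; lia.
rewrite -E [RHS]tnth_mktuple [in RHS]tnth_mktuple.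
by case: (tnth e i) => /=; symmetry; [apply/eqP|apply/negbTE]; lia.
Qed.

Hypothesis uF : uniq F.

Lemma sum_child_avg (k : int) x : m <= k -> k + 1 <= n ->
  \sum_(t <- F) \sum_e cube_avg g (child (dshift (k, t) b) e) x =
  level_avg b (k + 1) F g x.
Proof.
move=> mk kn; set l := loc b (k + 1) x.
have E t e : cube_avg g (child (dshift (k, t) b) e) x =
    if child_index k t e == l then avg g (dshift (k + 1, l) b) else 0.
  rewrite child_dshift cube_avgE ?side_dshift_gt0// indic_dshift -/l -/(child_index k t e).
  by case: eqP => [->|_]; rewrite ?mulr1 ?mulr0.
rewrite level_avgE// -/l (sum_delta (l := loc b k x))//; last first.
  move=> t /negbTE tx; rewrite big1// => e _.
  by rewrite E child_index_loc tx.
have Ee : \sum_e cube_avg g (child (dshift (k, loc b k x) b) e) x =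
    avg g (dshift (k + 1, l) b).
  rewrite (bigD1 (parity l k))//= E child_index_loc !eqxx/= big1 ?addr0// => e /negbTE ne.
  by rewrite E child_index_loc ne andbF.
have out (c : int) : m <= c -> c <= k + 1 -> loc b c x \notin F ->
    avg g (dshift (k + 1, l) b) = 0.
  move=> mc ck cF; apply: avg_outside => y /dshiftP/= yl.
  apply: (capF mc); first by lia.
  by rewrite (loc_coarser ck yl).
rewrite Ee; case: ifPn => kF; case: ifPn => lF //.
  by rewrite (out (k + 1))//; lia.
by rewrite (out k)//; lia.
Qed.

Lemma sum_mart_diff (k : int) x : m <= k -> k + 1 <= n ->
  \sum_(t <- F) mart_diff m g (dshift (k, t) b) x =
  level_avg b (k + 1) F g x - (if k == m then 0 else level_avg b k F g x).
Proof.
move=> mk kn; rewrite -sum_child_avg//.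
have E : ((2 : R) ^ (- k) == 2 ^ (- m)) = (k == m).
  by apply/eqP/eqP => [/pow2_inj/oppr_inj|->].
rewrite /mart_diff /side/= /dside/= E; case: eqP => _; first by rewrite subr0.
by rewrite sumrB.
Qed.

(** At the coarsest generation m the difference operator retains the average over
    the cube itself, so that nothing remains at the lower end. *)
Lemma telescope_mart_diff (q : nat) x : m + q.+1%:Z <= n ->
  \sum_(I <- levels m F q.+1) mart_diff m g (dshift I b) x =
  level_avg b (m + q.+1%:Z) F g x.
Proof.
rewrite /levels big_allpairs_dep; elim: q => [|q ih] qn.
  rewrite /= big_seq1 sum_mart_diff ?addr0 ?eqxx ?subr0//.
rewrite -addn1 iotaD big_cat/= ih; last by lia.
rewrite big_seq1 add0n sum_mart_diff; [|lia..].
rewrite ifF; last by apply/negbTE; lia.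
rewrite addrCA subrr addr0; congr (level_avg b _ F g x); lia.
Qed.

Lemma mart_diff_out (I : dyadic N) : m <= I.1 -> I.1 <= n -> I.2 \notin F ->
  mart_diff m g (dshift I b) = (fun=> 0).
Proof.
clear uF; case: I => k t /= mk kn tF; apply/funext => x.
have out y : cube_set (dshift (k, t) b) y -> exists i, M < `|coor y i|.
  by move=> /dshiftP/= yt; apply: (capF mk kn); rewrite yt.
have a0 : cube_avg g (dshift (k, t) b) x = 0.
  by rewrite cube_avgE ?side_dshift_gt0// avg_outside// mul0r.
have ch0 e : cube_avg g (child (dshift (k, t) b) e) x = 0.
  rewrite child_dshift cube_avgE ?side_dshift_gt0// -/(child_index k t e).
  rewrite avg_outside ?mul0r// => y /dshiftP/= yt; apply: out; apply/dshiftP => /=.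
  by move/eqP: yt; rewrite eq_sym child_index_loc => /andP[/eqP ->].
by rewrite /mart_diff big1 ?a0 ?subr0 ?if_same// => e _; exact: ch0.
Qed.

End fixed_function.
End telescoping.

Section capturing_boxes.
Context {R : realType} {N : nat}.
Local Notation mu := (leb R N).
Variables (m : int) (M : R).
Hypothesis M0 : 0 <= M.

Definition start_box : nat := Num.bound (2 ^ m * M + 2).

Definition big_radius : R := 2 ^ (- m) * (start_box%:R + 2).

(** Contains the indices of all cubes of generation at most n that meet the
    support, for every value of the random shift. *)
Definition index_box (n : nat) : seq (N.-tuple int) :=
  ibox (Num.bound (2 ^ n%:Z * big_radius + 2)).

Lemma le_big_radius : M <= big_radius.
Proof.
rewrite /big_radius pow2N ler_pdivlMl ?pow2_gt0//.
have := @archi_boundP R (2 ^ m * M + 2); rewrite -/start_box => h.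
have : 0 <= 2 ^ m * M + 2 by rewrite addr_ge0// mulr_ge0// ltW// pow2_gt0.
by move=> /h; lra.
Qed.

Lemma big_radius_ge0 : 0 <= big_radius.
Proof. exact: le_trans le_big_radius. Qed.

Lemma index_box_big b (k : int) (n : nat) (x : Rn R N) : k <= n%:Z ->
  loc b k x \notin index_box n -> exists i, big_radius < `|coor x i|.
Proof.
move=> kn; apply: (loc_ibox big_radius_ge0 kn); apply/ltW/archi_boundP.
by rewrite addr_ge0// mulr_ge0 ?big_radius_ge0// ltW// pow2_gt0.
Qed.

Lemma index_box_cap b (k : int) (n : nat) (x : Rn R N) : k <= n%:Z ->
  loc b k x \notin index_box n -> exists i, M < `|coor x i|.
Proof.
move=> kn xk; have [i xi] := index_box_big kn xk.
by exists i; exact: le_lt_trans le_big_radius xi.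
Qed.

Variables (w : Rn R N -> R) (K : R).
Hypothesis A2 : A2w w K.
Variable f : Rn R N -> R.
Hypothesis Lf : wL2 mu w f.
Hypothesis f_supp : {ae mu, forall x, (exists i, M < `|coor x i|) -> f x = 0}.

(** The function agrees almost everywhere with its restriction to the cubes of
    generation m that meet the support, to which the convergence of averages
    applies. *)
Lemma level_avg_cvg b :
  sqnorm mu w (fun x => level_avg b n%:Z (index_box n) f x - f x) @[n --> \oo] --> 0.
Proof.
pose G : seq (N.-tuple int) := ibox start_box.
pose U : set (Rn R N) := [set x | loc b m x \in G].
have GF (n : nat) (x : Rn R N) : m <= n%:Z -> loc b m x \in G -> loc b n%:Z x \in index_box n.
  move=> _ xG; apply: contraT => /(index_box_big (lexx _))[i].
  by rewrite ltNge (ibox_loc _ xG).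
have outU x : ~ U x -> exists i, M < `|coor x i|.
  move=> /negP; apply: (loc_ibox M0 (lexx m)); apply/ltW/archi_boundP.
  by rewrite addr_ge0// mulr_ge0// ltW// pow2_gt0.
have mU : measurable U := measurable_U b m G.
have L1 := wL2_indic_mul A2 mU Lf; set f1 := fun x => f x * \1_U x in L1.
have ae1 : {ae mu, forall x, f1 x = f x}.
  apply: filterS f_supp => x fx; rewrite /f1.
  have [xU|xU] := pselect (U x); first by rewrite indicE mem_set// mulr1.
  by rewrite indicE memNset// mulr0 fx//; exact: outU.
have f1U x : ~ U x -> f1 x = 0 by move=> xU; rewrite /f1 indicE memNset// mulr0.
have [_] := recovered_supported A2 (fun n => ibox_uniq _) GF L1 f1U.
apply: cvg_trans; apply: near_eq_cvg; apply: nearW => n.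
have El : level_avg b n%:Z (index_box n) f1 = level_avg b n%:Z (index_box n) f.
  apply/funext => x; apply: eq_bigr => t _; rewrite !cube_avgE ?side_dshift_gt0//.
  congr (_ * _); rewrite /avg !Rintegral_cube; congr (_ * _).
  apply: ae_eq_Rintegral.
  - by apply: measurable_funM; [exact: L1.1|exact: indic_cube_measurable].
  - by apply: measurable_funM; [exact: Lf.1|exact: indic_cube_measurable].
  - by apply: filterS ae1 => y ->.
rewrite El /sqnorm; have La := wL2_level_avg A2 b n%:Z (index_box n) f.
apply: ae_eq_Rintegral.
- apply: (measurable_sqw (A2w_measurable A2)).
  by apply: measurable_funB; [exact: La.1 | exact: L1.1].
- apply: (measurable_sqw (A2w_measurable A2)).
  by apply: measurable_funB; [exact: La.1 | exact: Lf.1].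
- by apply: filterS ae1 => y ->.
Qed.

End capturing_boxes.

(** * The averaged expansions of the operator *)

Lemma ae_forall_count {d} {Omega : measurableType d} {R : realType}
    (P : {measure set Omega -> \bar R}) {A : countType} (Q : A -> Omega -> Prop) :
  (forall a, {ae P, forall om, Q a om}) -> {ae P, forall om, forall a, Q a om}.
Proof.
move=> h; have : {ae P, forall om, forall n : nat,
    if choice.unpickle n is Some a then Q a om else True}.
  apply: ae_foralln => n; case: (choice.unpickle n) => [a|]; first exact: h.
  exact: filterE.
by apply: filterS => om hom a; have := hom (choice.pickle a); rewrite choice.pickleK.
Qed.

Lemma fsbig_pairs {A : choiceType} {V : nmodType} (l : seq A) (B : set (A * A))
    (c : rel A) (H : A * A -> V) : uniq l ->
  (forall x y, B (x, y) -> ~ (x \in l /\ y \in l) -> H (x, y) = 0) ->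
  (forall x y, x \in l -> y \in l -> B (x, y) <-> c x y) ->
  \sum_(xy \in B) H xy = \sum_(x <- l) \sum_(y <- l | c x y) H (x, y).
Proof.
move=> ul out inB.
pose L := [seq xy <- [seq (x, y) | x <- l, y <- l] | c xy.1 xy.2].
have mL x y : ((x, y) \in L) = [&& c x y, x \in l & y \in l].
  by rewrite mem_filter/=; congr (_ && _); apply/allpairsP/andP =>
    [[[x' y'] /= [xl yl [-> ->]]]|[xl yl]]; last exists (x, y).
have uL : uniq L.
  by apply: filter_uniq; apply: allpairs_uniq => // -[? ?] [? ?] _ _ /=.
rewrite -(fsbig_widen [set` L]); first last.
- move=> [x y] [Bxy /= nL]; apply: out => // -[xl yl]; apply: nL.
  by rewrite mL xl yl !andbT; apply/(inB x y xl yl).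
- by move=> [x y] /=; rewrite mL => /and3P[cxy xl yl]; apply/(inB x y xl yl).
rewrite -fsbig_seq// /L big_filter big_mkcond big_allpairs.
by apply: eq_bigr => x _; rewrite [RHS]big_mkcond.
Qed.

Section main_identity.
Context {d : measure_display} {Omega : measurableType d} {R : realType}.
Variables (P : probability Omega R) (N : nat) (beta : int -> {RV P >-> N.-tuple bool}).
Hypotheses (beta_unif : uniform_bits beta) (beta_indep : independent_bits beta).
Variables (r : nat) (gamma : R).
Local Notation mu := (leb R N).
Local Notation Ex := (Ex beta).
Local Notation good_ind := (good_ind r gamma).
Local Notation above k := [set j : int | k < j].

Variables (w : Rn R N -> R) (K : R).
Hypothesis A2 : A2w w K.
Let A2s := A2wV A2.
Local Notation L2w := (wL2 mu w).
Local Notation L2s := (wL2 mu (fun x => (w x)^-1)).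

Variables (T : (Rn R N -> R) -> (Rn R N -> R)) (C : R).
Hypothesis C0 : 0 <= C.
Hypothesis TL2 : forall f, L2w f -> L2w (T f).
Hypothesis Tlin : forall (c : R) f h, L2w f -> L2w h ->
  {ae mu, forall x, T (fun y => c * f y + h y) x = c * T f x + T h x}.
Hypothesis Tbnd : forall f, L2w f -> sqnorm mu w (T f) <= C * sqnorm mu w f.

Lemma tame_pairing (k : int) (a h : bits N -> Rn R N -> R) :
  trunc_cont a -> trunc_cont h ->
  (forall b b', (forall j, k < j -> b j = b' j) -> a b = a b') ->
  (forall b b', (forall j, k < j -> b j = b' j) -> h b = h b') ->
  tame (above k) (fun b => pairing (a b) (T (h b))).
Proof.
move=> ca ch da dh.
have [[Ba hBa] cva] := trunc_cont_sqnorm A2s ca.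
have [[Bh hBh] cvh] := trunc_cont_sqnorm A2 ch.
have La b := trunc_cont_wL2 b A2s ca.
have Lh b := trunc_cont_wL2 b A2 ch.
exists (fun p b => pairing (a (trunc_bits p%:Z b)) (T (h (trunc_bits p%:Z b)))).
exists (1 + C * (Ba * Bh)); split.
- move=> p; exists [seq k + i.+1%:Z | i <- iota 0 (absz (p%:Z - k))].
    by move=> j /mapP[i _ ->] /=; lia.
  move=> b b' e; have tb j : k < j -> trunc_bits p%:Z b j = trunc_bits p%:Z b' j.
    move=> kj; rewrite /trunc_bits; case: ifP => // jp; apply: e.
    by apply/mapP; exists (absz (j - k)).-1; [rewrite mem_iota|]; lia.
  by rewrite (da _ _ tb) (dh _ _ tb).
- move=> p b; set x := pairing _ _.
  have x2 : x ^+ 2 <= C * (Ba * Bh).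
    apply: (le_trans (pairing_bound A2 TL2 Tbnd (La _) (Lh _))).
    rewrite ler_wpM2l// ler_pM//; first exact: (sqnorm_ge0 mu (A2w_gt0 A2s)).
    exact: (sqnorm_ge0 mu (A2w_gt0 A2)).
  by rewrite -(real_normK (num_real x)) in x2; have := sqr_ge0 (`|x| - 1); nra.
- by move=> b; apply: (pairing_cvg A2 C0 TL2 Tlin Tbnd).
Qed.

Variables (m : int) (f g : Rn R N -> R) (M : R).
Hypothesis M0 : 0 <= M.
Hypotheses (Lf : L2w f) (Lg : L2s g).
Hypothesis f_supp : {ae mu, forall x, (exists i, M < `|coor x i|) -> f x = 0}.
Hypothesis g_supp : {ae mu, forall x, (exists i, M < `|coor x i|) -> g x = 0}.

Let if_ Q : 0 < side Q -> mu.-integrable (cube_set Q) (EFin \o f).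
Proof. by move=> Q0; exact: (wL2_integrable A2). Qed.

Let ig Q : 0 < side Q -> mu.-integrable (cube_set Q) (EFin \o g).
Proof. by move=> Q0; exact: (wL2_integrable A2s). Qed.

Let F n : seq (N.-tuple int) := index_box m M n.

Let coef (J I : dyadic N) (b : bits N) : R := Tcoef T m f g (dshift J b) (dshift I b).

Lemma tame_coef (k : int) I J : k <= I.1 -> k <= J.1 -> tame (above k) (coef J I).
Proof.
move=> kI kJ; apply: tame_pairing.
- exact: trunc_cont_mart_diff ig Lg.1 m J.
- exact: trunc_cont_mart_diff if_ Lf.1 m I.
- by move=> b b' e; rewrite (eq_dshift (b' := b'))// => j Jj; apply: e; exact: le_lt_trans kJ Jj.
- by move=> b b' e; rewrite (eq_dshift (b' := b'))// => j Jj; apply: e; exact: le_lt_trans kI Jj.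
Qed.

Lemma L2_mart_diff_f I b : L2w (mart_diff m f (dshift I b)).
Proof. exact: (trunc_cont_wL2 b A2 (trunc_cont_mart_diff if_ Lf.1 m I)). Qed.

Lemma L2_mart_diff_g J b : L2s (mart_diff m g (dshift J b)).
Proof. exact: (trunc_cont_wL2 b A2s (trunc_cont_mart_diff ig Lg.1 m J)). Qed.

Section fixed_depth.
Variable q : nat.
Variable n : nat.
Hypothesis mqn : n%:Z = m + q.+1%:Z.

Let cap b (k : int) (x : Rn R N) : m <= k -> k <= n%:Z -> loc b k x \notin F n ->
  exists i, M < `|coor x i|.
Proof. by move=> _; exact: (index_box_cap M0). Qed.

Let s := levels m (F n) q.+1.

Let telescope_f b : (fun x => \sum_(I <- s) mart_diff m f (dshift I b) x) =
  level_avg b n%:Z (F n) f.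
Proof.
apply/funext => x; rewrite mqn.
apply: (telescope_mart_diff Lf.1 f_supp (n := n%:Z) (@cap b) (ibox_uniq _)).
by rewrite mqn.
Qed.

Let telescope_g b : (fun x => \sum_(I <- s) mart_diff m g (dshift I b) x) =
  level_avg b n%:Z (F n) g.
Proof.
apply/funext => x; rewrite mqn.
apply: (telescope_mart_diff Lg.1 g_supp (n := n%:Z) (@cap b) (ibox_uniq _)).
by rewrite mqn.
Qed.

Lemma sum_coef_J I b : \sum_(J <- s) coef J I b =
  pairing (level_avg b n%:Z (F n) g) (T (mart_diff m f (dshift I b))).
Proof.
rewrite -telescope_g (pairing_suml A2 TL2)//; last exact: L2_mart_diff_f.
by move=> J; exact: L2_mart_diff_g.
Qed.

Lemma sum_coef_I J b : \sum_(I <- s) coef J I b =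
  pairing (mart_diff m g (dshift J b)) (T (level_avg b n%:Z (F n) f)).
Proof.
rewrite -telescope_f (pairing_sumr A2 TL2 Tlin)//; first exact: L2_mart_diff_g.
by move=> I; exact: L2_mart_diff_f.
Qed.

Lemma sum_coef b : \sum_(I <- s) \sum_(J <- s) coef J I b =
  pairing (level_avg b n%:Z (F n) g) (T (level_avg b n%:Z (F n) f)).
Proof.
under eq_bigr do rewrite sum_coef_J.
rewrite -telescope_f (pairing_sumr A2 TL2 Tlin)//; first exact: (wL2_level_avg A2s).
by move=> I; exact: L2_mart_diff_f.
Qed.

Lemma mem_pair_range I : (I \in s) = (m <= I.1 < n%:Z) && (I.2 \in F n).
Proof. by rewrite /s mem_levels mqn. Qed.

Let n_above I : I \in s -> I.1 < n%:Z.
Proof. by rewrite mem_pair_range => /andP[/andP[]]. Qed.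

(** Summing over all cubes J replaces the martingale differences of g by its
    average over the smallest cubes: the sum no longer depends on the position of
    the cubes coarser than I, although its terms do. *)
Lemma tame_sum_coef_J I : I \in s -> tame (above I.1) (fun b => \sum_(J <- s) coef J I b).
Proof.
move=> /n_above In.
have -> : (fun b => \sum_(J <- s) coef J I b) = (fun b => \sum_(t <- F n)
    pairing (cube_avg g (dshift (n%:Z, t) b)) (T (mart_diff m f (dshift I b)))).
  apply/funext => b; rewrite sum_coef_J /level_avg (pairing_suml A2 TL2)//.
    by move=> t; apply: (wL2_cube_avg A2s); exact: side_dshift_gt0.
  exact: L2_mart_diff_f.
apply: tame_sum => t; apply: tame_pairing.
- exact: trunc_cont_cube_avg ig Lg.1 _.
- exact: trunc_cont_mart_diff if_ Lf.1 m I.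
- by move=> b b' e; rewrite (eq_dshift (b' := b'))// => j /= Jj; apply: e; exact: lt_trans Jj.
- by move=> b b' e; rewrite (eq_dshift (b' := b'))// => j Jj; apply: e; exact: Jj.
Qed.

Lemma tame_sum_coef_I J : J \in s -> tame (above J.1) (fun b => \sum_(I <- s) coef J I b).
Proof.
move=> /n_above Jn.
have -> : (fun b => \sum_(I <- s) coef J I b) = (fun b => \sum_(t <- F n)
    pairing (mart_diff m g (dshift J b)) (T (cube_avg f (dshift (n%:Z, t) b)))).
  apply/funext => b; rewrite sum_coef_I /level_avg (pairing_sumr A2 TL2 Tlin)//.
    exact: L2_mart_diff_g.
  by move=> t; apply: (wL2_cube_avg A2); exact: side_dshift_gt0.
apply: tame_sum => t; apply: tame_pairing.
- exact: trunc_cont_mart_diff ig Lg.1 m J.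
- exact: trunc_cont_cube_avg if_ Lf.1 _.
- by move=> b b' e; rewrite (eq_dshift (b' := b'))// => j Jj; apply: e; exact: Jj.
- by move=> b b' e; rewrite (eq_dshift (b' := b'))// => j /= Jj; apply: e; exact: lt_trans Jj.
Qed.

Lemma Ex_good_sum I0 :
  Ex (weighted_sum beta good_ind s coef) =
  Ex (good_ind I0) ^+ 2 *
  Ex (fun b => pairing (level_avg b n%:Z (F n) g) (T (level_avg b n%:Z (F n) f))).
Proof.
rewrite (Ex_weighted_sum beta_unif beta_indep (pi := Ex (good_ind I0))).
- by congr (_ * Ex _); apply/funext => b; exact: sum_coef.
- by move=> I; exact: tame_good_ind.
- by move=> I; exact: (Ex_good_ind beta_unif beta_indep).
- by move=> I J JI; exact: tame_coef.
- by move=> I J IJ; apply: tame_coef => //; exact: ltW.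
- exact: tame_sum_coef_J.
- exact: tame_sum_coef_I.
Qed.

Lemma tame_total : tame setT
  (fun b => pairing (level_avg b n%:Z (F n) g) (T (level_avg b n%:Z (F n) f))).
Proof.
under eq_fun do rewrite -sum_coef; apply: tame_sum => I; apply: tame_sum => J.
have [IJ|IJ] := leP I.1 J.1.
  by apply: tame_sub (tame_coef (lexx _) IJ).
by apply: tame_sub (tame_coef (ltW IJ) (lexx _)).
Qed.

(** Martingale differences vanish on cubes away from the support, so that the
    unrestricted sums over pairs of cubes are finite. *)
Lemma coef_out I J b : m <= I.1 < n%:Z -> m <= J.1 < n%:Z ->
  ~ (I \in s /\ J \in s) -> coef J I b = 0.
Proof.
move=> /andP[mI In] /andP[mJ Jn] nIJ; rewrite /coef /Tcoef.
have [JF|JF] := boolP (J.2 \in F n); last first.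
  rewrite (mart_diff_out Lg.1 g_supp (n := n%:Z) (@cap b) mJ (ltW Jn) JF).
  exact: pairing0l.
have [IF|IF] := boolP (I.2 \in F n); last first.
  rewrite (mart_diff_out Lf.1 f_supp (n := n%:Z) (@cap b) mI (ltW In) IF).
  by apply: (pairing0r A2 TL2 Tlin); exact: L2_mart_diff_g.
by exfalso; apply: nIJ; rewrite !mem_pair_range IF JF mI In mJ Jn.
Qed.

End fixed_depth.

Lemma total_cvg : Ex (fun b => pairing (level_avg b n%:Z (F n) g)
    (T (level_avg b n%:Z (F n) f))) @[n --> \oo] --> pairing g (T f).
Proof.
pose Phi n b := pairing (level_avg b n%:Z (F n) g) (T (level_avg b n%:Z (F n) f)).
(* The averages are sums of coefficients only for n > m, hence the shift. *)
pose n0 := `|m|%N.+1.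
rewrite -(Ex_cst beta (pairing g (T f))); rewrite -(cvg_shiftn n0)/=.
have Ln (h : Rn R N -> R) (v : Rn R N -> R) (Av : A2w v K) n b :
  wL2 mu v (level_avg b n%:Z (F n) h) := wL2_level_avg Av b n%:Z (F n) h.
pose B := C * ((K * sqnorm mu (fun x => (w x)^-1) g) * (K * sqnorm mu w f)).
apply: (@Ex_cvg _ _ _ _ _ beta (fun p => Phi (p + n0)%N) (fun=> pairing g (T f)) (1 + B)).
- move=> p; apply: (tame_measurable beta (Z := setT)).
  have mq : (p + n0)%:Z = m + (absz ((p + n0)%:Z - m - 1)%R).+1%:Z by rewrite /n0; lia.
  exact: tame_total mq.
- move=> p b; set x := Phi _ _.
  have x2 : x ^+ 2 <= B.
    apply: (le_trans (pairing_bound A2 TL2 Tbnd (Ln _ _ A2s _ b) (Ln _ _ A2 _ b))).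
    rewrite ler_wpM2l// ler_pM//; try exact: (sqnorm_ge0 mu (A2w_gt0 A2s)).
    + exact: (sqnorm_ge0 mu (A2w_gt0 A2)).
    + exact: (sqnorm_level_avg A2s b _ (ibox_uniq _) Lg).
    + exact: (sqnorm_level_avg A2 b _ (ibox_uniq _) Lf).
  by rewrite -(real_normK (num_real x)) in x2; have := sqr_ge0 (`|x| - 1); nra.
- move=> b; rewrite (cvg_shiftn n0 (Phi ^~ b)).
  apply: (pairing_cvg A2 C0 TL2 Tlin Tbnd (fun n => Ln g _ A2s n b) (fun n => Ln f _ A2 n b) Lg Lf).
    exact: (level_avg_cvg m M0 A2s Lg g_supp).
  exact: (level_avg_cvg m M0 A2 Lf f_supp).
Qed.

Lemma cond_avg_itv k Phi b : tame setT Phi -> (forall b, 0 <= Phi b <= 1) ->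
  0 <= cond_avg beta k Phi b <= 1.
Proof.
move=> [F_ [B [dF FB cF]]] P01; apply: (@Ex_itv _ _ _ P N beta setT) => [|b'] //.
exists (fun p b' => F_ p (merge k b b')), B; split => // p.
have [S _ dS] := dF p; exists S => // b1 b2 e; apply: dS => j jS.
by rewrite /merge; case: ifP => // _; exact: e.
Qed.

Variables (cgood : dyadic N -> dyadic N -> Omega -> R).
Hypothesis cgoodP : forall I J : dyadic N,
  is_cond_exp P (sigma_bits beta [set j : int | 2 ^ (- j) < dside R J])
    (one_good beta r gamma I) (cgood I J).

Lemma cgood_ae : {ae P, forall om, forall I J : dyadic N,
  cgood I J om = cond_avg beta J.1 (good_ind I) (bits_of beta om)}.
Proof.
suff : {ae P, forall om, forall IJ : dyadic N * dyadic N,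
    cgood IJ.1 IJ.2 om = cond_avg beta IJ.2.1 (good_ind IJ.1) (bits_of beta om)}.
  by apply: filterS => om h I J; exact: (h (I, J)).
apply: ae_forall_count => -[I J] /=.
have tI : tame setT (good_ind I) := tame_sub (@subsetT _ _) (tame_good_ind r gamma I).
apply: (cond_exp_cond_avg beta_unif beta_indep tI).
have := cgoodP I J; congr (is_cond_exp P (sigma_bits beta _) _ _).
by apply/seteqP; split => j /=; rewrite /dside ltr_pow2 ltrN2.
Qed.

Lemma measurable_cgood I J : measurable_fun setT (cgood I J).
Proof.
by have [_ /measurable_int/measurable_EFinP] := cgoodP I J.
Qed.

Section expansions.
(** The two expansions of the operator only differ in the factor u that stands
    for the goodness of the larger cube: in the second one it also requires the
    pair to be good.  This makes no difference, because the conditional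
    probability that the smaller cube is good vanishes for bad pairs. *)
Variable u : dyadic N -> dyadic N -> bits N -> R.
Hypothesis measurable_u : forall I J, measurable_fun setT (fun om => u I J (bits_of beta om)).
Hypothesis uE : forall (I J : dyadic N) b, J.1 <= I.1 ->
  cond_avg beta J.1 (good_ind I) b * u I J b =
  cond_avg beta J.1 (good_ind I) b * good_ind J b.

Definition expansion (s : seq (dyadic N)) (om : Omega) : R :=
  let b := bits_of beta om in
  \sum_(I <- s) \sum_(J <- s | J.1 <= I.1) coef J I b * cgood I J om * u I J b +
  \sum_(I <- s) \sum_(J <- s | I.1 < J.1) coef J I b * u J I b * cgood J I om.

Lemma measurable_coef I J : measurable_fun setT (fun om => coef J I (bits_of beta om)).
Proof.
apply: (tame_measurable beta (Z := setT)); have [IJ|/ltW IJ] := leP I.1 J.1.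
  by apply: tame_sub (tame_coef (lexx _) IJ).
by apply: tame_sub (tame_coef IJ (lexx _)).
Qed.

Lemma measurable_expansion s : measurable_fun setT (expansion s).
Proof.
apply: measurable_funD; apply: measurable_sum => I; under eq_fun do rewrite -big_filter;
  apply: measurable_sum => J; apply: measurable_funM; try exact: measurable_u.
- apply: measurable_funM; [exact: measurable_coef|exact: measurable_cgood].
- apply: measurable_funM; [exact: measurable_coef|exact: measurable_u].
- exact: measurable_cgood.
Qed.

Lemma expansion_ae s : {ae P, forall om,
  expansion s om = weighted_sum beta good_ind s coef (bits_of beta om)}.
Proof.
apply: filterS cgood_ae => om cg; rewrite /expansion /weighted_sum.
congr (_ + _); apply: eq_bigr => I _; apply: eq_bigr => J IJ; rewrite cg.
  by rewrite -!mulrA uE.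
by rewrite -!mulrA; congr (_ * _); rewrite mulrC uE 1?mulrC//; exact: ltW.
Qed.

(** The expansion is almost surely the weighted sum of the averaging argument,
    whose expectation is the square of the probability of being good times the
    expectation of the form applied to averages. *)
Lemma expansion_cvg (X : nat -> Omega -> R) (I0 : dyadic N) :
  (forall n q, n%:Z = m + q.+1%:Z -> forall om,
     X n om = expansion (levels m (F n) q.+1) om) ->
  'E_P[X n]%E @[n --> \oo] --> (pairing g (T f) * pi_good beta r gamma I0 ^+ 2)%:E.
Proof.
move=> XE.
have -> : pi_good beta r gamma I0 = Ex (good_ind I0).
  by rewrite /pi_good unlock.
pose total n := Ex (fun b => pairing (level_avg b n%:Z (F n) g)
    (T (level_avg b n%:Z (F n) f))).
have tc : total n @[n --> \oo] --> pairing g (T f) by exact: total_cvg.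
have : (total n * Ex (good_ind I0) ^+ 2)%:E @[n --> \oo] -->
    (pairing g (T f) * Ex (good_ind I0) ^+ 2)%:E.
  apply/cvg_EFin; first exact: nearW.
  by apply: cvgM => //; exact: cvg_cst.
apply: cvg_trans; apply: near_eq_cvg; near=> n.
have mn : m < n%:Z by near: n; exists `|m|%N.+1 => // k /=; lia.
have mqn : n%:Z = m + (absz (n%:Z - m - 1)%R).+1%:Z by lia.
rewrite mulrC -(Ex_good_sum mqn) unlock.
have mX : measurable_fun setT (X n).
  have -> : X n = expansion (levels m (F n) (absz (n%:Z - m - 1)%R).+1).
    by apply/funext => om; exact: XE.
  exact: measurable_expansion.
have tw : tame setT (weighted_sum beta good_ind (levels m (F n) (absz (n%:Z - m - 1)%R).+1) coef).
  apply: tame_weighted_sum.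
  - by move=> I; exact: tame_good_ind.
  - by move=> I J JI; exact: tame_coef.
  - by move=> I J IJ; apply: tame_coef => //; exact: ltW.
rewrite /Ex /Rintegral fineK; last first.
  apply: (integrable_fin_num measurableT (f := EFin \o _)).
  exact: (tame_integrable beta tw).
apply: ae_eq_integral => //.
- by apply/measurable_EFinP; exact: (tame_measurable beta tw).
- exact/measurable_EFinP.
apply: filterS (expansion_ae (levels m (F n) (absz (n%:Z - m - 1)%R).+1)) => om + _.
by rewrite (XE n _ mqn) => ->.
Unshelve. all: by end_near. Qed.

End expansions.

Lemma side_rangeP (I : dyadic N) (n : nat) :
  side_range m n (dside R I) <-> m <= I.1 < n%:Z.
Proof.
rewrite /side_range /dside ltr_pow2 ler_pow2 ltrN2 lerN2 andbC; by [].
Qed.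

Lemma dside_le (I J : dyadic N) : (dside R I <= dside R J) = (J.1 <= I.1).
Proof. by rewrite /dside ler_pow2 lerN2. Qed.

Lemma dside_lt (I J : dyadic N) : (dside R I < dside R J) = (J.1 < I.1).
Proof. by rewrite /dside ltr_pow2 ltrN2. Qed.

Lemma first_form_cvg (I0 : dyadic N) :
  'E_P[fun om => (let b := bits_of beta om in
         \sum_(IJ \in [set IJ : dyadic N * dyadic N |
             [/\ side_range m n (dside R IJ.1), side_range m n (dside R IJ.2)
               & dside R IJ.2 >= dside R IJ.1]])
           (Tcoef T m f g (dshift IJ.2 b) (dshift IJ.1 b) *
            cgood IJ.1 IJ.2 om * one_good beta r gamma IJ.2 om)
       + \sum_(IJ \in [set IJ : dyadic N * dyadic N |
             [/\ side_range m n (dside R IJ.1), side_range m n (dside R IJ.2)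
               & dside R IJ.2 < dside R IJ.1]])
           (Tcoef T m f g (dshift IJ.2 b) (dshift IJ.1 b) *
            one_good beta r gamma IJ.1 om * cgood IJ.2 IJ.1 om))%R]%E
       @[n --> \oo] -->
       (pairing g (T f) * pi_good beta r gamma I0 ^+ 2)%:E.
Proof.
apply: (@expansion_cvg (fun I J => good_ind J)).
- move=> I J; exact: (tame_measurable beta (tame_good_ind r gamma J)).
- by [].
move=> n q mqn om /=; set b := bits_of beta om.
congr (_ + _).
- apply: (fsbig_pairs (c := fun I J : dyadic N => J.1 <= I.1)).
  + exact: levels_uniq (ibox_uniq _).
  + move=> I J [/= /side_rangeP rI /side_rangeP rJ _] nIJ.
    by rewrite [Tcoef _ _ _ _ _ _](coef_out mqn b rI rJ nIJ) !mul0r.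
  + move=> I J; rewrite !mem_pair_range// => /andP[rI _] /andP[rJ _] /=.
    rewrite dside_le; split => [[]//|IJ].
    by split => //; apply/side_rangeP.
- apply: (fsbig_pairs (c := fun I J : dyadic N => I.1 < J.1)).
  + exact: levels_uniq (ibox_uniq _).
  + move=> I J [/= /side_rangeP rI /side_rangeP rJ _] nIJ.
    by rewrite [Tcoef _ _ _ _ _ _](coef_out mqn b rI rJ nIJ) !mul0r.
  + move=> I J; rewrite !mem_pair_range// => /andP[rI _] /andP[rJ _] /=.
    rewrite dside_lt; split => [[]//|IJ].
    by split => //; apply/side_rangeP.
Qed.

Variable pi_ : Omega -> cube R N -> cube R N -> R.
Hypothesis pi_P : forall (om : Omega) (I J : dyadic N),
  pi_ om (dshift I (bits_of beta om)) (dshift J (bits_of beta om)) =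
  if dside R I <= dside R J then cgood I J om else cgood J I om.

Lemma pi_itv : {ae P, forall om, forall I J : cube R N,
  dsys (bits_of beta om) I -> dsys (bits_of beta om) J -> 0 <= pi_ om I J <= 1}.
Proof.
apply: filterS cgood_ae => om cg _ _ [I _ <-] [J _ <-].
have itv (A B : dyadic N) : 0 <= cgood A B om <= 1.
  rewrite cg; apply: cond_avg_itv; last exact: good_ind_itv.
  exact: tame_sub (@subsetT _ _) (tame_good_ind r gamma A).
by rewrite pi_P; case: ifP.
Qed.

(** Reindexing by the cubes of the unshifted system turns the sum over the random
    system into a sum over pairs of indices. *)
Lemma second_form_cvg (I0 : dyadic N) :
  'E_P[fun om => (let b := bits_of beta om in
         \sum_(IJ \in [set IJ : cube R N * cube R N |
             [/\ dsys b IJ.1 /\ dsys b IJ.2,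
                 side_range m n (side IJ.1) /\ side_range m n (side IJ.2),
                 side IJ.2 >= side IJ.1 -> good r gamma b IJ.2,
                 side IJ.1 > side IJ.2 -> good r gamma b IJ.1
               & good_pair r gamma b IJ.1 IJ.2]])
           (Tcoef T m f g IJ.2 IJ.1 * pi_ om IJ.1 IJ.2))%R]%E
       @[n --> \oo] -->
       (pairing g (T f) * pi_good beta r gamma I0 ^+ 2)%:E.
Proof.
pose u (I J : dyadic N) (b : bits N) : R :=
  good_ind J b * (good_upto r gamma `|I.1 - J.1|%N I b)%:R.
apply: (@expansion_cvg u).
- move=> I J; apply: measurable_funM.
    exact: (tame_measurable beta (tame_good_ind r gamma J)).
  apply: (@measurable_bits _ _ R P N beta [seq I.1 - p%:Z | p <- iota 0 `|I.1 - J.1|%N]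
    (fun b => (good_upto r gamma `|I.1 - J.1|%N I b)%:R)).
  by case: I => k t b b' e; rewrite (depends_good_upto r gamma t e).
- move=> I J b JI; rewrite /u.
  have [gu|bad] := boolP (good_upto r gamma `|I.1 - J.1|%N I b); first by rewrite mulr1.
  by rewrite (cond_good_bad_pair _ JI bad) !mul0r.
move=> n q mqn om /=; set b := bits_of beta om.
set B := [set IJ : cube R N * cube R N | _].
pose ph (IJ : dyadic N * dyadic N) : cube R N * cube R N := (dshift IJ.1 b, dshift IJ.2 b).
rewrite (reindex_fsbig ph (ph @^-1` B)); last first.
  split; first by [].
    move=> [I J] [I' J'] _ _ E; congr pair; apply: (@dshift_inj R N b).
      exact: (f_equal (fun z : cube R N * cube R N => z.1) E).
    exact: (f_equal (fun z : cube R N * cube R N => z.2) E).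
  move=> [Q1 Q2] BQ; have [[[I _ EI] [J _ EJ]] _ _ _ _] := BQ.
  by exists (I, J); rewrite /ph /preimage /= /ph/= EI EJ.
set s := levels m (F n) q.+1.
rewrite (fsbig_pairs (l := s) (c := fun I J => `[< B (ph (I, J)) >])); first last.
- by move=> I J _ _; split => /asboolP.
- move=> I J [/= _ [/side_rangeP rI /side_rangeP rJ] _ _ _] nIJ.
  by rewrite [Tcoef _ _ _ _ _ _](coef_out mqn b rI rJ nIJ) !mul0r.
- exact: levels_uniq (ibox_uniq _).
have range I : I \in s -> side_range m n (dside R I).
  by rewrite mem_pair_range// => /andP[/side_rangeP].
have Ble (I J : dyadic N) : I \in s -> J \in s -> J.1 <= I.1 -> B (ph (I, J)) <->
    good r gamma b (dshift J b) /\ good_upto r gamma `|I.1 - J.1|%N I b.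
  move=> Is Js JI; rewrite -(good_wrtP _ _ _ JI); split.
    case=> _ _ /= gJ _; rewrite /good_pair /side/= dside_le JI => gw; split => //.
    by apply: gJ; rewrite /side/= dside_le.
  case=> gJ gw; split => //=;
    [by split; [exists I|exists J]| |by rewrite /side/= dside_lt ltNge JI|].
    by split; exact: range.
  by rewrite /good_pair /side/= dside_le JI.
have Blt (I J : dyadic N) : I \in s -> J \in s -> I.1 < J.1 -> B (ph (I, J)) <->
    good r gamma b (dshift I b) /\ good_upto r gamma `|J.1 - I.1|%N J b.
  move=> Is Js IJ; rewrite -(good_wrtP _ _ _ (ltW IJ)).
  have nJI : J.1 <= I.1 = false by rewrite leNgt IJ.
  split.
    case=> _ _ /= _ gI; rewrite /good_pair /side/= dside_le nJI => gw; split => //.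
    by apply: gI; rewrite /side/= dside_lt.
  case=> gI gw; split => //=; [by split; [exists I|exists J]| |by rewrite /side/= dside_le nJI|].
    by split; exact: range.
  by rewrite /good_pair /side/= dside_le nJI.
have indE (D : Prop) (J : dyadic N) (c : bool) (x : R) :
    (D <-> good r gamma b (dshift J b) /\ c) ->
    (if `[< D >] then x else 0) = x * (good_ind J b * c%:R).
  move=> DE; rewrite /good_ind indicE; case: asboolP => [/DE[gd ->]|nD].
    by rewrite mem_set// !mulr1.
  have [gd|ngd] := pselect (good r gamma b (dshift J b)).
    by case: c DE => [DE|_]; [exfalso; apply: nD; apply/DE|rewrite !mulr0].
  by rewrite memNset// mul0r mulr0.
rewrite /expansion -big_split/=; apply: eq_big_seq => I Is.
rewrite (bigID (fun J : dyadic N => J.1 <= I.1))/=; congr (_ + _).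
  rewrite big_mkcondl big_seq_cond [RHS]big_seq_cond; apply: eq_bigr => J /andP[Js JI].
  by rewrite (indE _ _ _ _ (Ble I J Is Js JI)) pi_P dside_le JI.
under eq_bigl do rewrite -ltNge.
rewrite big_mkcondl big_seq_cond [RHS]big_seq_cond; apply: eq_bigr => J /andP[Js IJ].
rewrite (indE _ _ _ _ (Blt I J Is Js IJ)) pi_P dside_le leNgt IJ /=.
by rewrite /u mulrAC.
Qed.

End main_identity.

(** * From A2 weights to everywhere positive weights *)

Section positive_representative.
Context {R : realType} {N : nat}.
Local Notation mu := (leb R N).
Implicit Types (f v : Rn R N -> R).

Section comparison.
Variables (v v' : Rn R N -> R).
Hypotheses (mv : measurable_fun setT v) (mv' : measurable_fun setT v').
Hypothesis vv' : {ae mu, forall x, v x = v' x}.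
Hypothesis v'0 : forall x, 0 < v' x.

Let integralE f : measurable_fun setT f ->
  (\int[mu]_x (`|f x| ^+ 2 * v x)%:E = \int[mu]_x (f x ^+ 2 * v' x)%:E)%E.
Proof.
move=> mf; apply: ae_eq_integral => //.
- apply/measurable_EFinP; apply: measurable_funM => //; apply: measurable_funX.
  exact: measurableT_comp.
- by apply/measurable_EFinP; apply: measurable_funM => //; exact: measurable_funX.
- by apply: filterS vv' => x -> _; rewrite real_normK// num_real.
Qed.

Lemma L2E f : L2 v f <-> wL2 mu v' f.
Proof.
have i0 : (0 <= \int[mu]_x (f x ^+ 2 * v' x)%:E)%E.
  by apply: integral_ge0 => x _; rewrite lee_fin mulr_ge0 ?sqr_ge0// ltW.
have mi : measurable_fun setT f ->
    measurable_fun setT (EFin \o (fun x => f x ^+ 2 * v' x)).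
  by move=> mf; apply/measurable_EFinP; apply: measurable_funM => //; exact: measurable_funX.
have absE : (\int[mu]_x `|(f x ^+ 2 * v' x)%:E| = \int[mu]_x (f x ^+ 2 * v' x)%:E)%E.
  by apply: eq_integral => x _; rewrite gee0_abs// lee_fin mulr_ge0 ?sqr_ge0// ltW.
split=> [[mf]|[mf /integrableP[_]]]; last first.
  move=> /= ioo; split => //; rewrite /L2norm integralE//; apply: poweR_lty.
  by rewrite -absE.
rewrite /L2norm integralE// => /lty_poweRy ioo; split => //; apply/integrableP; split; first exact: mi.
by rewrite /= absE ioo// invr_eq0 pnatr_eq0.
Qed.

Lemma L2normE f : wL2 mu v' f -> L2norm v f = (Num.sqrt (sqnorm mu v' f))%:E.
Proof.
move=> [mf iF]; rewrite /L2norm integralE//.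
rewrite -(fineK (integrable_fin_num measurableT iF)) poweR_EFin powR12_sqrt//.
apply: Rintegral_ge0 => x _; by rewrite mulr_ge0 ?sqr_ge0// ltW.
Qed.

End comparison.

(** Equal to w almost everywhere, and positive everywhere so that its inverse is
    an honest weight. *)
Definition posw (w : Rn R N -> R) x : R := if 0 < w x then w x else 1.

Variable w : Rn R N -> R.
Hypothesis hw : weight w.

Lemma posw_gt0 x : 0 < posw w x.
Proof. by rewrite /posw; case: ifP. Qed.

Lemma measurable_posw : measurable_fun setT (posw w).
Proof.
have [mw _ _] := hw; apply: measurable_fun_ifT => //.
by apply: measurable_fun_ltr.
Qed.

Lemma posw_ae : {ae mu, forall x, w x = posw w x}.
Proof. by have [_ _] := hw; apply: filterS => x w0; rewrite /posw w0. Qed.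

Lemma poswV_ae : {ae mu, forall x, (w x)^-1 = (posw w x)^-1}.
Proof. by apply: filterS posw_ae => x ->. Qed.

(** The integral of w over a cube is positive, so that a finite A2 characteristic
    forces 1 / w to be locally integrable. *)
Lemma A2w_posw : (A2_char w < +oo)%E -> exists K, A2w (posw w) K.
Proof.
move=> A2; have [mw iw _] := hw; exists (fine (A2_char w)).
have mp := measurable_posw; have p0 := posw_gt0.
have mVp := measurable_invr mp.
have EE (Q : cube R N) (h h' : Rn R N -> R) : measurable_fun setT h -> measurable_fun setT h' ->
   {ae mu, forall x, h x = h' x} ->
   (\int[mu]_(x in cube_set Q) (h x)%:E = \int[mu]_(x in cube_set Q) (h' x)%:E)%E.
  move=> mh mh' hh; apply: ae_eq_integral; first exact: measurable_cube_set.
  - by apply/measurable_EFinP; exact: (measurable_funS measurableT).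
  - by apply/measurable_EFinP; exact: (measurable_funS measurableT).
  - by apply: filterS hh => x -> _.
have Ew (Q : cube R N) := EE Q _ _ mw mp posw_ae.
have EV (Q : cube R N) := EE Q _ _ (measurable_invr mw) mVp poswV_ae.
have ip (Q : cube R N) : 0 < side Q -> mu.-integrable (cube_set Q) (EFin \o posw w).
  move=> Q0; apply/integrableP; split.
    by apply/measurable_EFinP; exact: (measurable_funS measurableT).
  have /integrableP[_] := iw _ Q0; congr (_ < _)%E.
  apply: (EE Q (fun x => `|w x|) (fun x => `|posw w x|)); try exact: measurableT_comp.
  by apply: filterS posw_ae => x ->.
have pos (Q : cube R N) : 0 < side Q -> (0 < \int[mu]_(x in cube_set Q) (posw w x)%:E)%E.
  move=> Q0; have i0 : (0 <= \int[mu]_(x in cube_set Q) (posw w x)%:E)%E.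
    by apply: integral_ge0 => x _; rewrite lee_fin ltW.
  rewrite lt_neqAle i0 andbT; apply/eqP => E0.
  have mpQ : measurable_fun (cube_set Q) (EFin \o posw w).
    by apply/measurable_EFinP; exact: (measurable_funS measurableT).
  have := (ae_eq_integral_abs mu (measurable_cube_set Q) mpQ).1.
  have -> : (\int[mu]_(x in cube_set Q) `|(EFin \o posw w) x| = 0)%E.
    by rewrite E0; apply: eq_integral => x _; rewrite gee0_abs// lee_fin ltW.
  move=> /(_ erefl) ae0.
  have : mu (cube_set Q) = 0%E.
    apply: measure_negligible; first exact: measurable_cube_set.
    apply: negligibleS ae0 => x xQ /(_ xQ) /= /eqP; rewrite eqe => /eqP px.
    by have := p0 x; rewrite px ltxx.
  rewrite leb_cube ?ltW// => -[] /eqP.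
  by rewrite expf_eq0 (gt_eqF Q0) andbF.
have bnd (Q : cube R N) (Q0 : 0 < side Q) :
    ((((side Q ^+ N)^-1)%:E * \int[mu]_(x in cube_set Q) (posw w x)%:E) *
    (((side Q ^+ N)^-1)%:E * \int[mu]_(x in cube_set Q) ((posw w x)^-1)%:E) <= A2_char w)%E.
  by apply: ereal_sup_ubound; exists Q => //; rewrite leb_cube ?ltW//= Ew EV.
have l0 (Q : cube R N) : 0 < side Q -> 0 < (side Q ^+ N)^-1.
  by move=> Q0; rewrite invr_gt0 exprn_gt0.
have V0 (Q : cube R N) : (0 <= \int[mu]_(x in cube_set Q) ((posw w x)^-1)%:E)%E.
  by apply: integral_ge0 => x _; rewrite lee_fin invr_ge0 ltW.
have iV (Q : cube R N) : 0 < side Q ->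
    mu.-integrable (cube_set Q) (EFin \o (fun x => (posw w x)^-1)).
  move=> Q0; apply/integrableP; split.
    by apply/measurable_EFinP; exact: (measurable_funS measurableT).
  under eq_integral do rewrite /= ger0_norm ?invr_ge0 ?ltW//.
  rewrite ltey; apply: contraTneq A2 => Voo; rewrite -leNgt.
  apply: le_trans (bnd Q Q0); rewrite Voo gt0_muley ?lte_fin ?l0//.
  by rewrite gt0_muley// mule_gt0// ?lte_fin ?l0// pos.
split => //.
move=> Q Q0; set l := side Q ^+ N.
have Ep := fineK (integrable_fin_num (measurable_cube_set Q) (ip Q Q0)).
have EVp := fineK (integrable_fin_num (measurable_cube_set Q) (iV Q Q0)).
have := bnd Q Q0; rewrite -Ep -EVp -!EFinM => b.
have A0 : (0 <= A2_char w)%E.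
  apply: le_trans b; rewrite lee_fin !mulr_ge0 ?(ltW (l0 _ Q0))//.
    by apply: Rintegral_ge0 => x _; rewrite ltW.
  by apply: Rintegral_ge0 => x _; rewrite invr_ge0 ltW.
have Af : A2_char w \is a fin_num by rewrite ge0_fin_numE.
move: b; rewrite -(fineK Af) lee_fin => b.
rewrite -ler_pdivrMr ?exprn_gt0//.
apply: le_trans b; rewrite le_eqVlt; apply/orP; left; apply/eqP.
by rewrite -/l /Rintegral; field; rewrite gt_eqF// exprn_gt0.
Qed.

End positive_representative.

Theorem theorem3p1 (d : measure_display) (Omega : measurableType d)
    (R : realType) (P : probability Omega R) (N : nat) (hN : (0 < N)%N)
    (beta : int -> {RV P >-> N.-tuple bool})
    (beta_unif : uniform_bits beta) (beta_indep : independent_bits beta)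
    (gamma : R) (hgamma : 0 < gamma < 2^-1) (r : nat) (hr : (0 < r)%N)
    (I0 : dyadic N) (hpi : 0 < pi_good beta r gamma I0)
    (w : Rn R N -> R) (hw : weight w) (hA2 : (A2_char w < +oo)%E)
    (m : int)
    (T : (Rn R N -> R) -> (Rn R N -> R)) (hT : bounded_linear_L2 w T)
    (f g : Rn R N -> R)
    (hf : L2 w f) (hg : L2 (fun x => (w x)^-1) g)
    (f_supp : compactly_supported f) (g_supp : compactly_supported g)
    (cgood : dyadic N -> dyadic N -> Omega -> R)
    (cgoodP : forall I J : dyadic N,
      is_cond_exp P (sigma_bits beta [set j : int | 2 ^ (- j) < dside R J])
        (one_good beta r gamma I) (cgood I J))
    (pi_ : Omega -> cube R N -> cube R N -> R)
    (pi_P : forall (om : Omega) (I J : dyadic N),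
      pi_ om (dshift I (bits_of beta om)) (dshift J (bits_of beta om)) =
      if dside R I <= dside R J then cgood I J om else cgood J I om) :
  [/\ 'E_P[fun om => (let b := bits_of beta om in
         \sum_(IJ \in [set IJ : dyadic N * dyadic N |
             [/\ side_range m n (dside R IJ.1), side_range m n (dside R IJ.2)
               & dside R IJ.2 >= dside R IJ.1]])
           (Tcoef T m f g (dshift IJ.2 b) (dshift IJ.1 b) *
            cgood IJ.1 IJ.2 om * one_good beta r gamma IJ.2 om)
       + \sum_(IJ \in [set IJ : dyadic N * dyadic N |
             [/\ side_range m n (dside R IJ.1), side_range m n (dside R IJ.2)
               & dside R IJ.2 < dside R IJ.1]])
           (Tcoef T m f g (dshift IJ.2 b) (dshift IJ.1 b) *
            one_good beta r gamma IJ.1 om * cgood IJ.2 IJ.1 om))%R]%E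
       @[n --> \oo] -->
       (pairing g (T f) * pi_good beta r gamma I0 ^+ 2)%:E,
      'E_P[fun om => (let b := bits_of beta om in
         \sum_(IJ \in [set IJ : cube R N * cube R N |
             [/\ dsys b IJ.1 /\ dsys b IJ.2,
                 side_range m n (side IJ.1) /\ side_range m n (side IJ.2),
                 side IJ.2 >= side IJ.1 -> good r gamma b IJ.2,
                 side IJ.1 > side IJ.2 -> good r gamma b IJ.1
               & good_pair r gamma b IJ.1 IJ.2]])
           (Tcoef T m f g IJ.2 IJ.1 * pi_ om IJ.1 IJ.2))%R]%E
       @[n --> \oo] -->
       (pairing g (T f) * pi_good beta r gamma I0 ^+ 2)%:E
    & {ae P, forall om, forall I J : cube R N,
         dsys (bits_of beta om) I -> dsys (bits_of beta om) J ->
         0 <= pi_ om I J <= 1}].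
Proof.
have [K A2] := A2w_posw hw hA2.
have [TL2 Tlin [C0 TC]] := hT.
have [mw _ _] := hw.
have Lw := L2E mw (measurable_posw hw) (posw_ae hw) (posw_gt0 w).
have Ls := L2E (measurable_invr mw) (A2w_measurable (A2wV A2)) (poswV_ae hw)
  (A2w_gt0 (A2wV A2)).
have Lf : wL2 (leb R N) (posw w) f by apply/Lw.
have Lg : wL2 (leb R N) (fun x => (posw w x)^-1) g by apply/Ls.
have TL h : wL2 (leb R N) (posw w) h -> wL2 (leb R N) (posw w) (T h).
  by move=> /Lw /TL2 /Lw.
have Tl (c : R) h k : wL2 (leb R N) (posw w) h -> wL2 (leb R N) (posw w) k ->
    {ae leb R N, forall x, T (fun y => c * h y + k y) x = c * T h x + T k x}.
  by move=> /Lw Lh /Lw Lk; exact: Tlin.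
have Tb h : wL2 (leb R N) (posw w) h ->
    sqnorm (leb R N) (posw w) (T h) <= C0 ^+ 2 * sqnorm (leb R N) (posw w) h.
  move=> Lh; have Th := TL _ Lh; have := TC h ((Lw h).2 Lh).
  rewrite (L2normE mw (measurable_posw hw) (posw_ae hw) (posw_gt0 w) Lh).
  rewrite (L2normE mw (measurable_posw hw) (posw_ae hw) (posw_gt0 w) Th) lee_fin => b.
  have n0 u := sqnorm_ge0 (leb R N) (posw_gt0 w) u.
  rewrite -(sqr_sqrtr (n0 (T h))) -[X in _ * X](sqr_sqrtr (n0 h)) -exprMn.
  by rewrite ler_sqr ?nnegrE ?sqrtr_ge0// (le_trans (sqrtr_ge0 _) b).
have [M1 M1f] := f_supp; have [M2 M2g] := g_supp.
pose M := Num.max 0 (Num.max M1 M2).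
have M0 : 0 <= M by rewrite le_max lexx.
have fM : {ae leb R N, forall x, (exists i, M < `|coor x i|) -> f x = 0}.
  apply: filterS M1f => x fx [i xi]; apply: fx; exists i; apply: le_lt_trans xi.
  by rewrite !le_max lexx orbT.
have gM : {ae leb R N, forall x, (exists i, M < `|coor x i|) -> g x = 0}.
  apply: filterS M2g => x gx [i xi]; apply: gx; exists i; apply: le_lt_trans xi.
  by rewrite !le_max lexx !orbT.
split.
- exact: (first_form_cvg beta_unif beta_indep A2 (sqr_ge0 C0) TL Tl Tb m M0 Lf Lg fM gM cgoodP).
- exact: (second_form_cvg beta_unif beta_indep A2 (sqr_ge0 C0) TL Tl Tb m
    M0 Lf Lg fM gM cgoodP pi_P).
- exact: (pi_itv beta_unif beta_indep cgoodP pi_P).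
Qed.
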